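(* Let $\alpha\in[1,2)$ and assume $\beta<\infty$ and $\gamma^{(\alpha)}<\infty$. Let $p=p(\alpha,k)$ be the largest integer with $0\le p\le k$ and $p<(\alpha-1)/(2-\alpha)$, with $p=0$ if no such positive integer exists. Let $f:\mathbb{R}\to\mathbb{C}$ and $C$ be as follows: - if $\alpha=1$: $f$ is three times continuously differentiable with bounded derivatives of orders $1,2,3$, and $C=\|f'\|+\|f'''\|$; - if $\alpha\in(1,2)$: $f$ is $k+4$ times continuously differentiable with bounded derivatives of orders $1,\dots,k+4$, and $C=\|f'\|+\dots+\|f^{(k+4)}\|$. Then $$\Big|\int_{\mathbb{R}}f(u)\,d\mathbb{P}\{\mathbb{S}\le u\}-\int_{\mathbb{R}}f(u)\,dN_p(u)\Big|\le c\,C(\beta+\gamma^{(\alpha)}),$$ where $c>0$ depends only on $k$ and $\alpha$.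
   Context: **Setting.** Let $k\ge1$ and $n\ge1$ be integers. Let $X,X_1,\dots,X_n$ be i.i.d. random variables. Let $l$ be a real Borel function. For $j=1,\dots,k$, let $t_j$ be a real Borel function of $j$ variables that is invariant under permutations of its arguments. Put $L_i=l(X_i)$. For $A=\{i_1,\dots,i_j\}\subset\{1,\dots,n\}$ with $|A|=j$, put $T_A=t_j(X_{i_1},\dots,X_{i_j})$, and write $T_{1\dots j}=T_{\{1,\dots,j\}}$. Define - $\mathbb{L}=\sum_iL_i$, - $\mathbb{T}=\sum_{j=1}^k\sum_{|A|=j}T_A$, - $\mathbb{S}=\mathbb{L}+\mathbb{T}$. **Standing assumptions.** - $\mathbb{E}L_1=0$ and $n\,\mathbb{E}L_1^2=1$. - Each $t_j(X_1,\dots,X_j)$ is integrable and degenerate: $\mathbb{E}[t_j(X_1,\dots,X_j)\mid X_2,\dots,X_j]=0$ a.s. For $j=1$ this means $\mathbb{E}t_1(X_1)=0$. **Notation.** - $\beta=n\,\mathbb{E}|L_1|^3$. - $\gamma^{(\alpha)}=\sum_{j=1}^k\binom{n}{j}\mathbb{E}|T_{1\dots j}|^\alpha$. - $\kappa_j=\binom{n}{j}\mathbb{E}[L_1\cdots L_j\,\mathbb{T}]$. - $\Phi$ is the standard normal distribution function. - $N_0=\Phi$, and $N_p(x)=\Phi(x)+\sum_{j=1}^p(-1)^{j+1}\kappa_j\Phi^{(j+1)}(x)$. - $\|h\|=\sup_x|h(x)|$. *)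

(* Defs.v *)
From HB Require Import structures.
From mathcomp Require Import all_boot all_order all_algebra.
From mathcomp Require Import all_classical all_reals all_analysis.
From mathcomp Require Import complex.

Set Implicit Arguments.
Unset Strict Implicit.
Unset Printing Implicit Defensive.

Import Order.TTheory GRing.Theory Num.Theory.
Import numFieldNormedType.Exports.

Local Open Scope classical_set_scope.
Local Open Scope ring_scope.

Definition dern {R : realType} (j : nat) (g : R -> R) : R -> R :=
  iter j (fun h => derive1 h) g.

Definition Phi {R : realType} (x : R) : R :=
  Rintegral lebesgue_measure [set u : R | u <= x] (normal_pdf 0 1).

Definition Np {R : realType} (kappa : nat -> R) (p : nat) (x : R) : R :=
  Phi x + \sum_(1 <= j < p.+1) (-1) ^+ j.+1 * kappa j * dern j.+1 Phi x.

Definition p_alpha_k {R : realType} (alpha : R) (k : nat) : nat :=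
  \max_(0 <= j < k.+1 | (j%:R < (alpha - 1) / (2 - alpha))) j.

Definition cabs {R : rcfType} (z : R[i]) : R :=
  Num.sqrt (complex.Re z ^+ 2 + complex.Im z ^+ 2).

Definition cdern {R : realType} (j : nat) (f : R -> R[i]) : R -> R[i] :=
  fun x => Complex (dern j (fun u => complex.Re (f u)) x)
                   (dern j (fun u => complex.Im (f u)) x).

Definition rCn {R : realType} (m : nat) (g : R -> R) : Prop :=
  (forall j, (j < m)%N -> forall x : R, derivable (dern j g) x 1)
  /\ continuous (dern m g).

Definition cCn {R : realType} (m : nat) (f : R -> R[i]) : Prop :=
  rCn m (fun u => complex.Re (f u)) /\ rCn m (fun u => complex.Im (f u)).

Definition cbounded {R : realType} (h : R -> R[i]) : Prop :=
  exists M : R, forall x, cabs (h x) <= M.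

Definition supnorm {R : realType} (h : R -> R[i]) : R :=
  sup (range (fun x => cabs (h x))).

Definition cint {d} {T : measurableType d} {R : realType}
  (mu : {measure set T -> \bar R}) (D : set T) (h : T -> R[i]) : R[i] :=
  Complex (Rintegral mu D (fun w => complex.Re (h w)))
          (Rintegral mu D (fun w => complex.Im (h w))).

Definition mutually_independent {d} {Omega : measurableType d} {R : realType}
  (P : probability Omega R) {d'} {T : measurableType d'} (n : nat)
  (X : 'I_n -> Omega -> T) : Prop :=
  forall B : 'I_n -> set T, (forall i, measurable (B i)) ->
    P (\bigcap_(i in [set: 'I_n]) (X i @^-1` B i))
    = (\prod_(i < n) P (X i @^-1` B i))%E.

Definition identically_distributed {d} {Omega : measurableType d}
  {R : realType} (P : probability Omega R) {d'} {T : measurableType d'}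
  (n : nat) (X : 'I_n -> Omega -> T) : Prop :=
  forall i j (B : set T), measurable B -> P (X i @^-1` B) = P (X j @^-1` B).

Definition iid {d} {Omega : measurableType d} {R : realType}
  (P : probability Omega R) {d'} {T : measurableType d'} (n : nat)
  (X : 'I_n -> Omega -> T) : Prop :=
  (forall i, measurable_fun setT (X i)) /\
  mutually_independent P X /\ identically_distributed P X.

Section statistic.
Context {d} {Omega : measurableType d} {R : realType} {d'}
  {T : measurableType d'} (n : nat) (X : 'I_n -> Omega -> T)
  (l : T -> R) (t : forall j : nat, j.-tuple T -> R) (k : nat).

Definition Lv (i : 'I_n) (w : Omega) : R := l (X i w).

Definition TA (A : {set 'I_n}) (w : Omega) : R :=
  @t #|A| [tuple X (enum_val j) w | j < #|A|].

Definition Tfirst (j : nat) : Omega -> R := TA [set i : 'I_n | (i < j)%N].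

Definition TT (w : Omega) : R :=
  \sum_(A : {set 'I_n} | (0 < #|A| <= k)%N) TA A w.

Definition LL (w : Omega) : R := \sum_(i < n) Lv i w.

Definition SS (w : Omega) : R := LL w + TT w.

(* sigma(X_i : i in I) for I = {2, ..., j} (0-based 1..j-1) *)
Definition sigma_2_to (j : nat) : set (set Omega) :=
  <<s \big[setU/set0]_(i < n | (0 < i < j)%N)
        preimage_set_system setT (X i) measurable >>.

Variable P : probability Omega R.

(* E[ Y | G ] = 0 a.s.  (0 is a version of the conditional expectation):
   int_G Y dP = 0 for every G in the sigma-algebra *)
Definition cond_exp_zero (G : set (set Omega)) (Y : Omega -> R) : Prop :=
  forall A, G A -> (\int[P]_(w in A) (Y w)%:E = 0)%E.

Definition beta_ (i1 : 'I_n) : R :=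
  n%:R * Rintegral P setT (fun w => `|Lv i1 w| ^+ 3).

Definition gamma_ (alpha : R) : R :=
  \sum_(1 <= j < k.+1) 'C(n, j)%:R *
     Rintegral P setT (fun w => powR `|Tfirst j w| alpha).

Definition kappa (j : nat) : R :=
  'C(n, j)%:R *
    Rintegral P setT (fun w => (\prod_(i < n | (i < j)%N) Lv i w) * TT w).

End statistic.

(* Main.v *)
(* Write S for the linear part and T for the degenerate part. For alpha = 1 one
   has |E f(S + T) - E f(S)| <= |f'| E|T|, and Lindeberg's replacement argument
   compares E f(S) with the normal integral; the Gaussian steps merge since
   centred normal laws convolve.

   For 1 < alpha < 2, a von Bahr-Esseen inequality bounds E|T|^alpha by
   4^k gamma, so that E f(S + T) = E f(S) + sum_A E f'(S) T_A + O(gamma). By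
   degeneracy E f'(S) T_A only sees the mixed difference of f' in the
   directions L_i, i in A, which is at most prod_A min(1, |L_i|) and is
   prod_A L_i * f^(|A|+1) up to a higher order error. Young's inequality with
   the exponent q = alpha/(alpha - 1) then separates T_A from the L_i, and
   n E|L|^q <= 2 beta^(q-2). With s = q - 2, the condition j < (alpha - 1)/(2 - alpha)
   reads j s < 1: the orders with j s >= 1 contribute O(beta), while the others
   give kappa_j times the normal integral of f^(j+1), which integration by parts
   identifies with the correction in N_p. All this is for beta <= 1; when
   beta > 1 the crude bound E|T| <= 1 + E|T|^alpha suffices. *)

Require Import Defs.
From HB Require Import structures.
From mathcomp Require Import all_boot all_order all_algebra.
From mathcomp Require Import all_classical all_reals all_analysis.
From mathcomp Require Import measurable_realfun complex perm.
From mathcomp Require Import zify ring lra.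

Set Implicit Arguments.
Unset Strict Implicit.
Unset Printing Implicit Defensive.

Import Order.TTheory GRing.Theory Num.Theory.
Import numFieldNormedType.Exports.

Local Open Scope classical_set_scope.
Local Open Scope ring_scope.

(** * Powers and Taylor expansions *)

(** Everything is transported to the law Q of the sample on tuples, where independence enters
    through one fact: overwriting the coordinates outside a set K by those of an independent copy
    preserves Q ([merge_law]). Iterated integrals, factorization over disjoint blocks and
    conditional expectations are all read off from it, and permutation invariance of Q reduces each
    T_A to the first set of its size.

    The obstacle is that only third moments of the L_i are given, whereas Young's inequality asks
    for order q, which exceeds 3 when alpha < 3/2. Truncation by min(1, |L_i|) makes every moment
    finite, and it suffices for the orders without a main term; an order j with a main term has j s
    < 1, hence q < 3, so untruncated products are integrable where they occur.

    The number k + 4 of derivatives arises because the main term of A involves f^(|A|+1), and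
    Lindeberg's argument for the sum over the complement of A takes three more. Dropping the indices
    of A is harmless because 1/n <= n^(-1/2) <= beta, an inequality that also absorbs the third
    moments of the Gaussian steps. *)

Section powR_facts.
Context {R : realType}.
Implicit Types (x y z a b u w : R).

Lemma powR_norm_ge1 a y : 1 <= a -> 1 <= y -> y <= powR y a.
Proof.
by move=> a1 y1; rewrite -{1}(powRr1 (le_trans ler01 y1)) ler_powR.
Qed.

Lemma ler_powR2r a x y : 0 <= a -> 0 <= x -> x <= y -> powR x a <= powR y a.
Proof.
move=> a0 x0 xy; apply: ge0_ler_powR => //; rewrite nnegrE//.
exact: le_trans xy.
Qed.

Lemma ler_1DpowR a y : 1 <= a -> 0 <= y -> y <= 1 + powR y a.
Proof.
move=> a1 y0; have [y1|/ltW y1] := leP y 1; first by rewrite (le_trans y1)// lerDl powR_ge0.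
by rewrite (le_trans (powR_norm_ge1 a1 y1))// lerDr.
Qed.

Lemma powR_max a x y : 0 <= a -> 0 <= x -> 0 <= y ->
  powR (Num.max x y) a <= powR x a + powR y a.
Proof.
move=> a0 x0 y0; have [xy|yx] := leP x y; first by rewrite lerDr powR_ge0.
by rewrite lerDl powR_ge0.
Qed.

Lemma powRD_le a x y : 0 <= a <= 2 -> 0 <= x -> 0 <= y ->
  powR (x + y) a <= 4 * (powR x a + powR y a).
Proof.
move=> /andP[a0 a2] x0 y0; have m0 : 0 <= Num.max x y by rewrite le_max x0.
have xym : x + y <= 2 * Num.max x y.
  by rewrite mulrDl mul1r lerD// le_max lexx ?orbT.
rewrite (le_trans (ler_powR2r a0 (addr_ge0 x0 y0) xym))// powRM//.
apply: ler_pM; rewrite ?powR_ge0 ?powR_max//.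
rewrite (_ : 4 = powR 2 2); first by rewrite ler_powR// ler1n.
by rewrite powR_mulrn//; ring.
Qed.

(** With u = x / (x + y) in [0, 1] one has u <= u^a, and likewise for y; the two fractions add up to
    1. *)
Lemma powR_subadd a x y : 0 <= a <= 1 -> 0 <= x -> 0 <= y ->
  powR (x + y) a <= powR x a + powR y a.
Proof.
move=> /andP[a0 a1] x0 y0; have [xy0|xy0] := eqVneq (x + y) 0.
  have -> : x = 0 by apply/eqP; rewrite eq_le x0 -xy0 lerDl y0.
  by rewrite add0r lerDr powR_ge0.
have {}xy0 : 0 < x + y by rewrite lt_def xy0 addr_ge0.
have H z : 0 <= z <= x + y -> z / (x + y) <= powR (z / (x + y)) a.
  move=> /andP[z0 zxy].
  have u0 : 0 <= z / (x + y) by rewrite divr_ge0// ltW.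
  have u1 : z / (x + y) <= 1 by rewrite ler_pdivrMr// mul1r.
  have [->|un0] := eqVneq (z / (x + y)) 0; first exact: powR_ge0.
  rewrite -{1}(powRr1 u0); apply: ger_powR => //.
  by rewrite lt_def un0 u0.
have E z : 0 <= z -> powR z a = powR (z / (x + y)) a * powR (x + y) a.
  by move=> z0; rewrite -powRM ?divr_ge0 ?divfK ?gt_eqF// ltW.
rewrite [X in _ <= X + _]E// [X in _ <= _ + X]E// -mulrDl -[leLHS]mul1r.
rewrite ler_wpM2r ?powR_ge0//.
rewrite (@le_trans _ _ (x / (x + y) + y / (x + y)))//.
  by rewrite -mulrDl divff// gt_eqF.
by apply: lerD; apply: H; rewrite ?x0 ?y0 ?lerDl ?lerDr.
Qed.

(* The derivative of [|x|^a / a], a monotone Hoelder continuous function for 1 <= a <= 2. *)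
Definition dpow a x := Num.sg x * powR `|x| (a - 1).

Lemma norm_dpow a x : 1 < a -> `|dpow a x| = powR `|x| (a - 1).
Proof.
move=> a1; rewrite /dpow normrM normr_sg ger0_norm ?powR_ge0//.
have [->|x0] := eqVneq x 0; last by rewrite mul1r.
by rewrite normr0 powR0 ?mulr0// gt_eqF// subr_gt0.
Qed.

Lemma dpow_mulr a x : 1 < a -> x * dpow a x = powR `|x| a.
Proof.
move=> a1; rewrite /dpow mulrA (mulrC x) -normrEsg mulr_powRB1//.
exact: lt_trans a1.
Qed.

(** Oddness reduces to y >= 0. For equal signs, subadditivity of the power a - 1 <= 1 gives the
    constant 1; for opposite signs |x - y| = |x| + |y| dominates both powers, whence the 2. *)
Lemma dpow_holder a x y : 1 < a <= 2 ->
  `|dpow a x - dpow a y| <= 2 * powR `|x - y| (a - 1).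
Proof.
move=> /andP[a1 a2]; have a01 : 0 <= a - 1 <= 1 by lra.
have a0 : 0 <= a - 1 by lra.
wlog : x y / 0 <= y.
  move=> W; have [y0|/ltW y0] := leP 0 y; first exact: W.
  have := W (- x) (- y); rewrite oppr_ge0 => /(_ y0).
  have dN u : dpow a (- u) = - dpow a u by rewrite /dpow sgrN normrN mulNr.
  by rewrite !dN -!opprD !normrN.
move=> y0.
have K u w : 0 <= u -> 0 <= w -> powR u (a - 1) - powR w (a - 1) <= powR `|u - w| (a - 1).
  move=> u0 w0; rewrite lerBlDr (le_trans _ (powR_subadd _ _ _))//.
  by rewrite ler_powR2r// -lerBlDr ler_norm.
have dE u : 0 <= u -> dpow a u = powR u (a - 1).
  rewrite le_eqVlt => /orP[/eqP <-|u0]; last by rewrite /dpow gtr0_sg// mul1r gtr0_norm.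
  by rewrite /dpow sgr0 mul0r powR0// gt_eqF// subr_gt0.
have [x0|x0] := leP 0 x.
  rewrite !dE// (@le_trans _ _ (powR `|x - y| (a - 1)))//; last first.
    by rewrite ler_peMl ?powR_ge0// ler1n.
  by rewrite ler_norml lerNl opprB {1}distrC !K.
have -> : dpow a x = - powR (- x) (a - 1).
  by rewrite /dpow ltr0_sg// mulN1r ltr0_norm.
rewrite dE// -opprD normrN ger0_norm ?addr_ge0 ?powR_ge0// mulrDl mul1r.
have xy : `|x - y| = - x + y.
  by rewrite ltr0_norm; [rewrite opprB addrC|rewrite subr_lt0 (lt_le_trans x0)].
rewrite xy; apply: lerD; apply: ler_powR2r => //; lra.
Qed.

(** The engine of the moment inequality: the middle term is linear in y, so it integrates to zero
    when y is degenerate in a coordinate that x does not involve. *)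
Lemma powR_norm_expand a x y : 1 < a <= 2 ->
  powR `|x + y| a <= powR `|x| a + a * (dpow a x * y) + 4 * powR `|y| a.
Proof.
move=> /andP[a1 a2]; have a0 : 0 < a by lra.
(* Convexity of the a-th power, with the tangent taken at x + y; it comes from Young's inequality
   for |x| |x + y|^(a-1). *)
have h1 : powR `|x + y| a <= powR `|x| a + a * (y * dpow a (x + y)).
  have am1 : 0 < a - 1 by lra.
  have q0 : 0 < a / (a - 1) by rewrite divr_gt0.
  have conj : a^-1 + (a / (a - 1))^-1 = 1 by field; lra.
  have := @conjugate_powR _ `|x| (powR `|x + y| (a - 1)) _ _ (normr_ge0 _) (powR_ge0 _ _) a0 q0 conj.
  rewrite -powRrM (_ : (a - 1) * (a / (a - 1)) = a); last by field; lra.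
  move=> /(ler_wpM2l (ltW a0)).
  rewrite (_ : a * (_ / a + _) = powR `|x| a + (a - 1) * powR `|x + y| a) => [Y|]; last first.
    by field; lra.
  have xd : x * dpow a (x + y) <= `|x| * powR `|x + y| (a - 1).
    by rewrite (le_trans (ler_norm _))// normrM norm_dpow.
  have := dpow_mulr (x + y) a1; nra.
(* Hoelder continuity moves the slope from x + y back to x at the price 2 |y|^a; the factor a <= 2
   then turns the 2 into 4. *)
have h2 : y * dpow a (x + y) <= dpow a x * y + 2 * powR `|y| a.
  have := @dpow_holder a (x + y) x; rewrite a1 a2 => /(_ isT).
  rewrite (_ : x + y - x = y); last by ring.
  move=> /(ler_wpM2l (normr_ge0 y)); rewrite -normrM => /(le_trans (ler_norm _)).
  rewrite [`|y| * (2 * _)]mulrCA mulr_powRB1//; nra.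
rewrite (le_trans h1)// -addrA lerD2l.
have := ler_wpM2l (ltW a0) h2; have := powR_ge0 `|y| a; nra.
Qed.

(* Taylor at order 1 when only [a] moments are available. *)
Lemma powR_mean_le a x y : 1 < a -> 0 <= x -> 0 <= y ->
  powR x (a - 1) * y <= powR x a + powR y a.
Proof.
move=> a1 x0 y0; have a0 : 0 < a by lra.
have a10 : 0 <= a - 1 by lra.
have m0 : 0 <= Num.max x y by rewrite le_max x0.
rewrite (le_trans _ (powR_max (ltW a0) x0 y0))//.
rewrite -(mulr_powRB1 m0 a0) mulrC ler_pM ?powR_ge0//; first by rewrite le_max lexx orbT.
by rewrite ler_powR2r// le_max lexx.
Qed.

End powR_facts.

(** * Mean value and Taylor inequalities on the real line *)

Section mean_value.
Context {R : realType}.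
Implicit Types (x y M : R) (g h : R -> R).

Lemma is_derive_shift g (g' : R) (a x : R) : is_derive (x + a) 1 g g' ->
  is_derive x 1 (fun u => g (u + a)) g'.
Proof.
move=> dg.
have da : is_derive x 1 (fun u : R => u + a) 1.
  by apply: is_derive_eq; rewrite addr0.
have := @is_derive1_comp _ g (fun u : R => u + a) x g' 1 dg da.
by rewrite mulr1.
Qed.

(** The increment may have either sign; the location |c - x| <= |y| is what lets the Taylor bounds
    below iterate the statement. *)
Lemma mean_value g (g' : R -> R) x y : (forall z : R, is_derive z 1 g (g' z)) ->
  exists2 c, `|c - x| <= `|y| & g (x + y) - g x = g' c * y.
Proof.
move=> dg.
have cg : continuous g.
  by move=> z; apply/differentiable_continuous/derivable1_diffP; case: (dg z).
have [y0|/ltW y0] := leP 0 y.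
  have xy : x <= x + y by rewrite lerDl.
  have [c] := MVT_segment xy (fun z _ => dg z) (continuous_subspaceT cg).
  rewrite in_itv /= => /andP[xc cy]; rewrite [x + y - x]addrAC subrr add0r => E.
  by exists c => //; rewrite !ger0_norm ?subr_ge0// lerBlDl.
have xy : x + y <= x by rewrite gerDl.
have [c] := MVT_segment xy (fun z _ => dg z) (continuous_subspaceT cg).
rewrite in_itv /= => /andP[xc cy]; rewrite opprD addrA subrr sub0r => E.
exists c; first by rewrite !ler0_norm ?subr_le0//; lra.
by rewrite -opprB E mulrN opprK.
Qed.

Lemma mean_value_le g (g' : R -> R) M x y : (forall z : R, is_derive z 1 g (g' z)) ->
  (forall z, `|g' z| <= M) -> `|g (x + y) - g x| <= M * `|y|.
Proof.
move=> dg gM; have [c _ ->] := mean_value x y dg.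
by rewrite normrM ler_wpM2r.
Qed.

Lemma taylor1 g (g' g'' : R -> R) M x y : (forall z : R, is_derive z 1 g (g' z)) ->
  (forall z : R, is_derive z 1 g' (g'' z)) -> (forall z, `|g'' z| <= M) ->
  `|g (x + y) - g x - g' x * y| <= M * `|y| ^+ 2.
Proof.
move=> dg dg' gM; have [c cx ->] := mean_value x y dg.
rewrite -mulrBl normrM expr2 mulrA ler_wpM2r//.
have := mean_value_le x (c - x) dg' gM; rewrite [x + (c - x)]addrC subrK => /le_trans; apply.
by rewrite ler_wpM2l// (le_trans _ (gM 0)).
Qed.

(** The left-hand side, as a function of the increment, has for derivative the first-order remainder
    of g', to which [taylor1] applies. Sharp constants are not sought. *)
Lemma taylor2 g (g' g'' g3 : R -> R) M x y : (forall z : R, is_derive z 1 g (g' z)) ->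
  (forall z : R, is_derive z 1 g' (g'' z)) ->
  (forall z : R, is_derive z 1 g'' (g3 z)) -> (forall z, `|g3 z| <= M) ->
  `|g (x + y) - g x - g' x * y - g'' x * (y ^+ 2 / 2)| <= M * `|y| ^+ 3.
Proof.
move=> dg dg' dg'' gM.
pose F u := g (u + x) - g' x * u - g'' x * (u ^+ 2 / 2).
have dF (u : R) : is_derive u 1 F (g' (u + x) - g' x - g'' x * u).
  have d1 := is_derive_shift (dg (u + x)).
  have d2 : is_derive u 1 (fun u => g' x * u) (g' x).
    by apply: is_derive_eq; rewrite /GRing.scale /= mulr1.
  have d3 : is_derive u 1 (fun u => g'' x * (u ^+ 2 / 2)) (g'' x * u).
    by apply: is_derive_eq; rewrite /GRing.scale /=; field.
  exact: is_deriveB (is_deriveB d1 d2) d3.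
have [c cx] := mean_value 0 y dF.
rewrite /F !add0r expr0n /= mul0r !mulr0 !subr0.
rewrite (_ : _ - _ = g (x + y) - g x - g' x * y - g'' x * (y ^+ 2 / 2)) => [->|]; last first.
  by rewrite (addrC y); ring.
rewrite normrM [_ ^+ 3]exprSr mulrA ler_wpM2r//.
have := taylor1 x c dg' dg'' gM; rewrite (addrC x) => /le_trans; apply.
rewrite ler_wpM2l// ?(le_trans _ (gM 0))// ler_sqr ?nnegrE//.
by rewrite subr0 in cx.
Qed.

(** Interpolates between the quadratic bound for |y| <= 1 and the linear bound for |y| >= 1; as 1 <=
    a <= 2, both lie below a multiple of |y|^a. *)
Lemma taylor_powR g (g' g'' : R -> R) M a x y : 1 <= a <= 2 ->
  (forall z : R, is_derive z 1 g (g' z)) ->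
  (forall z : R, is_derive z 1 g' (g'' z)) ->
  (forall z, `|g' z| <= M) -> (forall z, `|g'' z| <= M) ->
  `|g (x + y) - g x - g' x * y| <= 2 * M * powR `|y| a.
Proof.
move=> /andP[a1 a2] dg dg' g'M g''M.
have M0 : 0 <= M by rewrite (le_trans _ (g'M 0)).
have [y1|/ltW y1] := leP `|y| 1.
  rewrite (le_trans (taylor1 x y dg dg' g''M))// -mulrA.
  have : `|y| ^+ 2 <= powR `|y| a.
    have [->|y0] := eqVneq y 0; first by rewrite normr0 expr0n powR_ge0.
    rewrite -powR_mulrn// ger_powR//.
    by rewrite normr_gt0 y0.
  by move=> /(ler_wpM2l M0); have := mulr_ge0 M0 (powR_ge0 `|y| a); lra.
rewrite (@le_trans _ _ (2 * M * `|y|))//; last first.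
  by rewrite ler_wpM2l ?mulr_ge0// powR_norm_ge1.
have h1 := mean_value_le x y dg g'M.
have h2 : `|g' x * y| <= M * `|y| by rewrite normrM ler_wpM2r.
by rewrite (le_trans (ler_normB _ _))//; lra.
Qed.

End mean_value.

(** * Mixed differences and their approximation by derivatives *)

Section mixed_differences.
Context {R : realType}.
Implicit Types (x y a M : R) (g : R -> R) (s : seq R).

(** This is the alternating sum, over the sublists of s, of g at y plus the sum of the sublist. *)
Fixpoint mixed_diff g y s : R :=
  if s is a :: s' then mixed_diff g (y + a) s' - mixed_diff g y s' else g y.

(** The recursion moves the base point; here the first difference is moved into the function, so
    that an induction on s can replace g and its derivatives by their differences in direction a. *)
Lemma mixed_diff_cons g y a s :
  mixed_diff g y (a :: s) = mixed_diff (fun x => g (x + a) - g x) y s.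
Proof.
elim: s y => [//|b s IH] y; rewrite [RHS]/= -!IH /= [y + b + a]addrAC; ring.
Qed.

(** Induction on the family of differences in direction a: these are bounded by 2M min(1, |a|),
    through the triangle inequality when |a| >= 1 and the mean value inequality otherwise. *)
Lemma mixed_diff_le s (gd : nat -> R -> R) M y :
  (forall j, (j < size s)%N -> forall z : R, is_derive z 1 (gd j) (gd j.+1 z)) ->
  (forall j, (j <= size s)%N -> forall z, `|gd j z| <= M) ->
  `|mixed_diff (gd 0%N) y s| <= 2 ^+ size s * M * \prod_(a <- s) Num.min 1 `|a|.
Proof.
elim: s gd M y => [|a s IH] gd M y dg gM.
  by rewrite big_nil mulr1 mul1r; exact: gM.
rewrite mixed_diff_cons.
have M0 : 0 <= M by rewrite (le_trans _ (gM 0%N _ 0)).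
have := IH (fun j x => gd j (x + a) - gd j x) (2 * M * Num.min 1 `|a|) y.
rewrite big_cons /= => /(_ _ _)/le_trans; apply.
- move=> j js z; apply: is_deriveB; last by apply: dg; exact: ltnW.
  by apply: is_derive_shift; apply: dg; exact: ltnW.
- move=> j js z; have [a1|a1] := leP 1 `|a|.
    rewrite mulr1 (le_trans (ler_normB _ _))// mulrDl mul1r.
    by apply: lerD; apply: gM; exact: leqW.
  have := mean_value_le (M := M) z a (dg j js) (gM j.+1 js).
  by have := mulr_ge0 M0 (normr_ge0 a); lra.
- by rewrite exprS le_eqVlt; apply/orP; left; apply/eqP; ring.
Qed.

(** Each direction a contributes one derivative and one factor a. The differences in direction a are
    of size M |a|, which feeds the induction; exchanging the last difference for a derivative costs
    M |a|^2 times the other factors. *)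
Lemma mixed_diff_approx s (gd : nat -> R -> R) M y :
  (forall j, (j <= size s)%N -> forall z : R, is_derive z 1 (gd j) (gd j.+1 z)) ->
  (forall j, (j <= (size s).+1)%N -> forall z, `|gd j z| <= M) ->
  `|mixed_diff (gd 0%N) y s - (\prod_(a <- s) a) * gd (size s) y|
     <= M * \prod_(a <- s) `|a| * \sum_(a <- s) `|a|.
Proof.
elim: s gd M y => [|a s IH] gd M y dg gM.
  by rewrite !big_nil mulr0 mul1r subrr normr0.
rewrite mixed_diff_cons.
have M0 : 0 <= M by rewrite (le_trans _ (gM 0%N _ 0)).
have H1 : `|mixed_diff (fun x => gd 0%N (x + a) - gd 0%N x) y s
    - (\prod_(b <- s) b) * (gd (size s) (y + a) - gd (size s) y)|
    <= M * `|a| * \prod_(b <- s) `|b| * \sum_(b <- s) `|b|.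
  apply: (IH (fun j x => gd j (x + a) - gd j x)) => j js z.
  - apply: is_deriveB; last by apply: dg; exact: leqW.
    by apply: is_derive_shift; apply: dg; exact: leqW.
  - by apply: (mean_value_le (g' := gd j.+1)) => u; [exact: dg|exact: gM].
have T : `|gd (size s) (y + a) - gd (size s) y - gd (size s).+1 y * a| <= M * `|a| ^+ 2.
  apply: (@taylor1 _ (gd (size s)) (gd (size s).+1) (gd (size s).+2)) => z.
  - exact: (dg (size s) (leqnSn _)).
  - exact: (dg (size s).+1 (leqnn _)).
  - exact: (gM (size s).+2 (leqnn _)).
rewrite !big_cons [X in `|X|](_ : _ = (mixed_diff (fun x => gd 0%N (x + a) - gd 0%N x) y s
    - (\prod_(b <- s) b) * (gd (size s) (y + a) - gd (size s) y)) +
    (\prod_(b <- s) b) * (gd (size s) (y + a) - gd (size s) y - gd (size s).+1 y * a)); last first.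
  by rewrite /=; ring.
rewrite (le_trans (ler_normD _ _))// normrM normr_prod.
have P0 : 0 <= \prod_(b <- s) `|b| by exact: prodr_ge0.
rewrite (le_trans (lerD H1 (ler_wpM2l P0 T)))// le_eqVlt; apply/orP; left.
by apply/eqP; ring.
Qed.

End mixed_differences.

(** * Integration *)

Notation itg mu f := (integrable mu setT (EFin \o f)).

Section itg.
Context {d} {T : measurableType d} {R : realType}.
Variable mu : {measure set T -> \bar R}.
Implicit Types f g : T -> R.

Lemma itg_measurable f : itg mu f -> measurable_fun setT f.
Proof. by move=> /measurable_int/measurable_EFinP. Qed.

Lemma itgD f g : itg mu f -> itg mu g -> itg mu (fun x => f x + g x).
Proof.
move=> fi gi; apply: eq_integrable (integrableD measurableT fi gi) => //.
Qed.

Lemma itgB f g : itg mu f -> itg mu g -> itg mu (fun x => f x - g x).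
Proof.
move=> fi gi; apply: eq_integrable (integrableB measurableT fi gi) => //.
Qed.

Lemma itgZ c f : itg mu f -> itg mu (fun x => c * f x).
Proof.
by move=> fi; apply: eq_integrable (integrableZl measurableT c fi).
Qed.

Lemma itg_norm f : itg mu f -> itg mu (fun x => `|f x|).
Proof. exact: integrable_norm. Qed.

Lemma itg_sum I (s : seq I) (P : pred I) (F : I -> T -> R) :
  (forall i, P i -> itg mu (F i)) -> itg mu (fun x => \sum_(i <- s | P i) F i x).
Proof.
move=> Fi; apply: eq_integrable (integrable_sum measurableT s Fi) => // x _.
by rewrite /= sumEFin.
Qed.

Lemma itg_le f g : measurable_fun setT f -> itg mu g ->
  (forall x, `|f x| <= g x) -> itg mu f.
Proof.
move=> mf gi fg; apply: le_integrable gi => //; first exact/measurable_EFinP.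
by move=> x _ /=; rewrite lee_fin (le_trans (fg x))// ler_norm.
Qed.

Lemma Rintegral_sum I (s : seq I) (P : pred I) (F : I -> T -> R) :
  (forall i, P i -> itg mu (F i)) ->
  \int[mu]_x (\sum_(i <- s | P i) F i x) = \sum_(i <- s | P i) \int[mu]_x F i x.
Proof.
move=> Fi; elim: s => [|i s IH].
  under eq_Rintegral do rewrite big_nil.
  by rewrite big_nil Rintegral_cst// mul0r.
under eq_Rintegral do rewrite big_cons.
rewrite big_cons -IH; case: ifPn => // Pi.
by rewrite RintegralD//; [exact: Fi | exact: itg_sum].
Qed.

Lemma ler_Rintegral f g : itg mu f -> itg mu g -> (forall x, f x <= g x) ->
  \int[mu]_x f x <= \int[mu]_x g x.
Proof. by move=> fi gi fg; exact: le_Rintegral. Qed.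

Lemma ler_norm_Rintegral f g : measurable_fun setT f -> itg mu g ->
  (forall x, `|f x| <= g x) -> `|\int[mu]_x f x| <= \int[mu]_x g x.
Proof.
move=> mf gi fg; have fi := itg_le mf gi fg.
apply: le_trans (le_normr_Rintegral measurableT fi) _.
by apply: ler_Rintegral => //; exact: itg_norm.
Qed.

Lemma EFin_Rintegral f : itg mu f ->
  (\int[mu]_x f x)%:E = (\int[mu]_x (f x)%:E)%E.
Proof. by move=> fi; rewrite fineK//; exact: integrable_fin_num. Qed.

End itg.

Section itg_probability.
Context {d} {T : measurableType d} {R : realType} (mu : probability T R).
Implicit Types f g : T -> R.

Lemma itg_cst c : itg mu (fun=> c).
Proof. exact: finite_measure_integrable_cst. Qed.

Lemma Rintegral_probability_cst c : \int[mu]_x c = c.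
Proof. by rewrite Rintegral_cst// [X in fine X](probability_setT mu) mulr1. Qed.

Lemma ler_norm_Rintegral_cst f c : measurable_fun setT f ->
  (forall x, `|f x| <= c) -> `|\int[mu]_x f x| <= c.
Proof.
move=> mf fc; rewrite -[leRHS]Rintegral_probability_cst.
exact: ler_norm_Rintegral (itg_cst c) fc.
Qed.

End itg_probability.

(** * Fubini's theorem for real-valued integrals *)

Section fubini.
Context {d1 d2} {T1 : measurableType d1} {T2 : measurableType d2} {R : realType}.
Variables (m1 : {sigma_finite_measure set T1 -> \bar R})
  (m2 : {sigma_finite_measure set T2 -> \bar R}).
Variable F : T1 * T2 -> R.
Hypothesis iF : itg (m1 \x m2)%E F.

(** The sections are integrable only almost everywhere; on the exceptional null set [fine] may
    replace an infinite inner integral by 0, which does not affect the outer integral. *)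
Let inner : ae_eq m1 setT (fun x => (\int[m2]_y (F (x, y))%:E)%E)
  (fun x => (\int[m2]_y F (x, y))%:E).
Proof.
move: (ae_integrable1 iF); apply: filterS => x ix _; rewrite fineK//; exact: integrable_fin_num.
Qed.

Lemma itg_fubini : itg m1 (fun x => \int[m2]_y F (x, y)).
Proof.
apply: le_integrable (integrable_fubini_F iF) => //.
  apply/measurable_EFinP; apply: measurableT_comp (measurable_fubini_F iF).
  exact: fine_measurable.
move=> x _ /=; rewrite /Rintegral /fubini_F.
by case: (\int[m2]_y _)%E => [r||] /=; rewrite ?normr0 ?lexx ?leey.
Qed.

Lemma Rintegral_fubini :
  \int[(m1 \x m2)%E]_z F z = \int[m1]_x \int[m2]_y F (x, y).
Proof.
rewrite /Rintegral -[in LHS](integral12_prod_meas1 iF); congr fine.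
apply: ae_eq_integral => //.
- exact: (measurable_fubini_F iF).
- exact: (measurable_int _ itg_fubini).
Qed.

End fubini.

(** * Averaging operators and the Lindeberg argument *)

Definition lip {R : realType} (K : R) (h : R -> R) :=
  forall x y, `|h x - h y| <= K * `|x - y|.

Section lip.
Context {R : realType}.
Implicit Types (h : R -> R) (K : R).

Lemma lip_ge0 K h : lip K h -> 0 <= K.
Proof.
move=> /(_ 1 0); rewrite subr0 normr1 mulr1; exact: le_trans.
Qed.

Lemma lip_continuous K h : lip K h -> continuous h.
Proof.
move=> hK x; apply/cvgrPdist_lt => e e0.
have [K0|K0] := eqVneq K 0.
  by near=> y; rewrite (le_lt_trans (hK x y))// K0 mul0r.
have {}K0 : 0 < K by rewrite lt_def K0 (lip_ge0 hK).
near=> y; rewrite (le_lt_trans (hK x y))// mulrC -ltr_pdivlMr//; near: y.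
by apply: (@nbhsx_ballx R R x (e / K)); rewrite divr_gt0.
Unshelve. all: end_near. Qed.

Lemma lip_measurable K h : lip K h -> measurable_fun setT h.
Proof. by move=> /lip_continuous; exact: continuous_measurable_fun. Qed.

Lemma lip_growth K h x : lip K h -> `|h x| <= `|h 0| + K * `|x|.
Proof.
move=> /(_ x 0); rewrite subr0 => hx.
by rewrite -lerBlDl (le_trans _ hx)// lerB_dist.
Qed.

End lip.

Section average.
Context {d} {S : measurableType d} {R : realType} (mu : probability S R)
  (Y : S -> R).
Hypothesis mY : measurable_fun setT Y.
Implicit Types (h : R -> R) (K M : R).

(** Iterating this operator n times gives the mean of h at x plus n independent copies of Y, without
    constructing the copies. *)
Definition average h (x : R) := \int[mu]_s h (x + Y s).

Lemma itg_lip K h x : itg mu Y -> lip K h -> itg mu (fun s => h (x + Y s)).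
Proof.
move=> iY hK; apply: (itg_le (g := fun s => `|h x| + K * `|Y s|)).
- apply: measurableT_comp (lip_measurable hK) _.
  exact: measurable_funD.
- apply: itgD; first exact: itg_cst.
  by apply: itgZ; exact: itg_norm.
- move=> s; rewrite -lerBlDl (le_trans (lerB_dist _ _))//.
  by rewrite (le_trans (hK _ _))// addrAC subrr add0r.
Qed.

Lemma average_lip K h : itg mu Y -> lip K h -> lip K (average h).
Proof.
move=> iY hK x y; rewrite /average -RintegralB//; try exact: itg_lip hK.
apply: ler_norm_Rintegral_cst.
  by apply: (itg_measurable (mu := mu)); apply: itgB; exact: itg_lip hK.
by move=> s; rewrite (le_trans (hK _ _))// opprD addrACA subrr addr0.
Qed.

(** Averaging contracts the sup norm, so the errors of successive replacements add up without
    amplification. *)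
Lemma average_bound K K' h g B : itg mu Y -> lip K h -> lip K' g ->
  (forall x, `|h x - g x| <= B) -> forall x, `|average h x - average g x| <= B.
Proof.
move=> iY hK gK hg x; rewrite /average -RintegralB//;
  [|exact: itg_lip hK|exact: itg_lip gK].
apply: ler_norm_Rintegral_cst => //.
by apply: (itg_measurable (mu := mu)); apply: itgB; [exact: itg_lip hK|exact: itg_lip gK].
Qed.

End average.

(** [h1] and [h2] stand for the first two derivatives, but only the Taylor inequality is recorded:
    in this form the property survives averaging without differentiation under the integral sign.
    The Lipschitz constants serve integrability only, which is why they are not quantified. *)
Definition smooth3 {R : realType} (M : R) (h : R -> R) := exists h1 h2 : R -> R,
  [/\ exists K, lip K h, exists K, lip K h1, exists K, lip K h2 &
    forall x a, `|h (x + a) - h x - h1 x * a - h2 x * (a ^+ 2 / 2)| <= M * `|a| ^+ 3].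

Lemma le_1Dcube {R : realFieldType} (y : R) : 0 <= y -> y <= 1 + y ^+ 3.
Proof.
move=> y0; have : 0 <= (y - 1) ^+ 2 * (y + 2) by rewrite mulr_ge0 ?sqr_ge0// addr_ge0.
have : 0 <= y ^+ 3 by rewrite exprn_ge0.
nra.
Qed.

Lemma sqr_le_1Dcube {R : realFieldType} (y : R) : 0 <= y -> y ^+ 2 <= 1 + y ^+ 3.
Proof.
move=> y0; have : 0 <= (y - 1) ^+ 2 * (2 * y + 1).
  by rewrite mulr_ge0 ?sqr_ge0// addr_ge0// mulr_ge0.
nra.
Qed.

Section moments.
Context {d} {S : measurableType d} {R : realType} (mu : probability S R)
  (Y : S -> R).
Hypothesis mY : measurable_fun setT Y.
Hypothesis iY3 : itg mu (fun s => `|Y s| ^+ 3).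

Lemma itg_moment1 : itg mu Y.
Proof.
apply: (itg_le (g := fun s => 1 + `|Y s| ^+ 3)) => //.
  by apply: itgD => //; exact: itg_cst.
by move=> s; exact: le_1Dcube.
Qed.

Lemma itg_moment2 : itg mu (fun s => Y s ^+ 2).
Proof.
apply: (itg_le (g := fun s => 1 + `|Y s| ^+ 3)) => //.
- exact: measurable_funX.
- by apply: itgD => //; exact: itg_cst.
- by move=> s; rewrite normrX; exact: sqr_le_1Dcube.
Qed.

Lemma average_smooth3 M h : smooth3 M h -> smooth3 M (average mu Y h).
Proof.
have iY := itg_moment1.
move=> [h1 [h2 [[K hK] [K1 h1K] [K2 h2K] hM]]].
exists (average mu Y h1), (average mu Y h2).
split; [by exists K; exact: average_lip|by exists K1; exact: average_lip|
  by exists K2; exact: average_lip|].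
move=> x a; rewrite /average.
have i0 := itg_lip mY _ iY hK; have i1 := itg_lip mY _ iY h1K.
have i2 := itg_lip mY _ iY h2K.
rewrite -RintegralB// -RintegralZr// -RintegralB//; last 2 first.
- exact: itgB.
- by under eq_fun do rewrite mulrC; exact: itgZ.
have i1a := itgZ a (i1 x); have i2a := itgZ (a ^+ 2 / 2) (i2 x).
rewrite -RintegralZr// -RintegralB//; last 2 first.
- by apply: itgB; [exact: itgB|under eq_fun do rewrite mulrC].
- by under eq_fun do rewrite mulrC.
apply: ler_norm_Rintegral_cst => [|s].
  apply: (itg_measurable (mu := mu)).
  apply: itgB; first apply: itgB; first exact: itgB.
  - by under eq_fun do rewrite mulrC.
  - by under eq_fun do rewrite mulrC.
by rewrite (addrAC x a).
Qed.

Hypothesis Y0 : \int[mu]_s Y s = 0.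

Lemma average_taylor M h (h1 h2 : R -> R) x : (exists K, lip K h) ->
  (forall a, `|h (x + a) - h x - h1 x * a - h2 x * (a ^+ 2 / 2)|
     <= M * `|a| ^+ 3) ->
  `|average mu Y h x - h x - h2 x * ((\int[mu]_s Y s ^+ 2) / 2)|
     <= M * \int[mu]_s `|Y s| ^+ 3.
Proof.
have iY := itg_moment1; have iY2 := itg_moment2.
move=> [K hK] hM; have i0 := itg_lip mY _ iY hK.
have -> : average mu Y h x - h x - h2 x * ((\int[mu]_s Y s ^+ 2) / 2) =
   \int[mu]_s (h (x + Y s) - h x - h1 x * Y s - h2 x / 2 * (Y s ^+ 2)).
  rewrite RintegralB//; last 2 first.
  - by apply: itgB; [apply: itgB => //; exact: itg_cst|exact: itgZ].
  - exact: itgZ.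
  rewrite RintegralB//; last 2 first.
  - by apply: itgB => //; exact: itg_cst.
  - exact: itgZ.
  rewrite RintegralB//; last exact: itg_cst.
  rewrite !RintegralZl// Y0 Rintegral_probability_cst mulr0 subr0 /average.
  by congr (_ - _); rewrite mulrA mulrAC.
rewrite -RintegralZl//; apply: ler_norm_Rintegral => [||s].
- apply: (itg_measurable (mu := mu)); apply: itgB; last exact: itgZ.
  by apply: itgB; [apply: itgB => //; exact: itg_cst|exact: itgZ].
- exact: itgZ.
- by rewrite (_ : _ / 2 * _ = h2 x * (Y s ^+ 2 / 2))//; ring.
Qed.

End moments.

Section lindeberg.
Context {R : realType}.
Context {d} {S : measurableType d} (mu : probability S R) (Y : S -> R).
Context {d'} {S' : measurableType d'} (nu : probability S' R) (Z : S' -> R).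
Hypothesis mY : measurable_fun setT Y.
Hypothesis iY3 : itg mu (fun s => `|Y s| ^+ 3).
Hypothesis Y0 : \int[mu]_s Y s = 0.
Hypothesis mZ : measurable_fun setT Z.
Hypothesis iZ3 : itg nu (fun s => `|Z s| ^+ 3).
Hypothesis Z0 : \int[nu]_s Z s = 0.
Hypothesis YZ : \int[mu]_s Y s ^+ 2 = \int[nu]_s Z s ^+ 2.

(** One replacement is made at the outermost operator: the equal first and second moments leave a
    third-order error, by the Taylor inequality for the Z-iterate. The remaining difference of
    iterates is handled by contraction. *)
Lemma lindeberg M h x n : smooth3 M h ->
  `|iter n (average mu Y) h x - iter n (average nu Z) h x| <=
    n%:R * (M * (\int[mu]_s `|Y s| ^+ 3 + \int[nu]_s `|Z s| ^+ 3)).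
Proof.
move=> hM; set B := M * _.
have SA m : smooth3 M (iter m (average mu Y) h).
  by elim: m => //= m; exact: average_smooth3.
have SB m : smooth3 M (iter m (average nu Z) h).
  by elim: m => //= m; exact: average_smooth3.
elim: n x => [|n IH] x; first by rewrite /= subrr normr0 mul0r.
rewrite !iterS; set u := iter n _ _; set w := iter n _ _.
have step : `|average mu Y w x - average nu Z w x| <= B.
  have [h1 [h2 [hK _ _ hT]]] := SB n.
  have := average_taylor mY iY3 Y0 hK (hT x).
  have := average_taylor mZ iZ3 Z0 hK (hT x).
  rewrite -YZ /B mulrDr -/w !ler_norml; lra.
have [_ [_ [[Ku uK] _ _ _]]] := SA n.
have [_ [_ [[Kw wK] _ _ _]]] := SB n.
have := average_bound mY (itg_moment1 mY iY3) uK wK IH x.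
by move: step; rewrite -/u -/w -natr1 mulrDl mul1r !ler_norml; lra.
Qed.

End lindeberg.

(** * Gaussian integrals *)

Section normal_integral.
Context {R : realType}.
Variables (m s : R).
Local Notation mu := (@lebesgue_measure R).
Local Notation N := (normal_prob m s).
Local Notation D := (Radon_Nikodym_SigmaFinite.f N mu).

Let mpdf : measurable_fun (setT : set (measurableTypeR R))
  (fun x : measurableTypeR R => (normal_pdf m s x)%:E).
Proof. by apply/measurable_EFinP; exact: measurable_normal_pdf. Qed.

Let NM := normal_prob_dominates m s.

(** Integrals against the normal law are rewritten with its Radon-Nikodym derivative; this
    identifies the latter with the explicit density. *)
Let D_pdf : ae_eq mu setT D (fun x => (normal_pdf m s x)%:E).
Proof.
apply: integral_ae_eq => //.
- exact: (Radon_Nikodym_SigmaFinite.f_integrable NM).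
- move=> E _ mE; rewrite -Radon_Nikodym_SigmaFinite.f_integral//.
Qed.

Lemma ge0_integral_normal (f : measurableTypeR R -> \bar R) : measurable_fun setT f ->
  (forall x, 0 <= f x)%E ->
  (\int[N]_x f x = \int[mu]_x (f x * (normal_pdf m s x)%:E))%E.
Proof.
move=> mf f0; rewrite -(Radon_Nikodym_SigmaFinite.change_of_variables NM)//.
apply: ae_eq_integral => //.
- apply: emeasurable_funM => //.
  by have /measurable_int := Radon_Nikodym_SigmaFinite.f_integrable NM.
- exact: emeasurable_funM.
- exact: ae_eqe_mul2l.
Qed.

Lemma itg_normal (f : measurableTypeR R -> R) : measurable_fun setT f ->
  itg mu (fun x => f x * normal_pdf m s x) -> itg N f.
Proof.
move=> mf /integrableP[_ fi]; apply/integrableP; split; first exact/measurable_EFinP.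
rewrite ge0_integral_normal//; last first.
  by apply: measurableT_comp => //; exact/measurable_EFinP.
apply: le_lt_trans fi; rewrite le_eqVlt; apply/orP; left; apply/eqP.
by apply: eq_integral => x _ /=; rewrite normrM (ger0_norm (normal_pdf_ge0 _ _ _)).
Qed.

Lemma Rintegral_normal (f : measurableTypeR R -> R) : itg N f ->
  \int[N]_x f x = \int[mu]_x (f x * normal_pdf m s x).
Proof.
move=> fi; congr fine; rewrite -(Radon_Nikodym_change_of_variables NM)//.
apply: ae_eq_integral => //.
- by apply: emeasurable_funM => //; exact: measurable_int fi.
- apply/measurable_EFinP; apply: measurable_funM => //.
    exact: (itg_measurable fi).
  exact: measurable_normal_pdf.
- have E : (fun x => (f x * normal_pdf m s x)%:E) =
    (fun x => (f x)%:E * (normal_pdf m s x)%:E)%E by [].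
  rewrite E; apply: ae_eqe_mul2l.
  apply: ae_eq_trans D_pdf; apply: ae_eq_sym.
  exact: ae_eq_Radon_Nikodym_SigmaFinite.
Qed.

End normal_integral.

(** * Gaussian tails, integration by parts and moments *)

Section gaussian_tails.
Context {R : realType}.
Local Notation mu := (@lebesgue_measure R).
Implicit Types (s x : R) (p : {poly R}).

Lemma normal_pdf_prod s x : 0 < s ->
  normal_pdf 0 s x = normal_peak s * expR (- (x ^+ 2 / (s ^+ 2 *+ 2))).
Proof.
by move=> s0; rewrite normal_pdfE ?gt_eqF// /normal_fun subr0 mulNr.
Qed.

(** With y = x^2 / (4 s^2) the density decays like exp(-2y). One factor exp(-y) is kept, and is the
    density of variance 2 s^2 up to a constant; the other absorbs the power because exp(y) >= 1 +
    y^(n+1) / (n+1)!. *)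
Lemma exprn_normal_pdf_bound s n : 0 < s -> exists2 C, 0 <= C &
  forall x, `|x| ^+ n * normal_pdf 0 s x <= C * normal_pdf 0 (Num.sqrt 2 * s) x.
Proof.
move=> s0; have r2 : 0 < Num.sqrt 2 :> R by rewrite sqrtr_gt0.
set s' := Num.sqrt 2 * s; have s'0 : 0 < s' by rewrite mulr_gt0.
have s2 : 0 < s ^+ 2 by rewrite exprn_gt0.
have P0 := normal_peak_gt0 (lt0r_neq0 s0).
have P0' := normal_peak_gt0 (lt0r_neq0 s'0).
pose c := 1 + (s ^+ 2 * 4) ^+ n.+1 * (n.+1)`!%:R.
have c0 : 0 <= c.
  by rewrite addr_ge0// mulr_ge0// exprn_ge0// mulr_ge0// ltW.
exists (c * normal_peak s / normal_peak s').
  by rewrite divr_ge0 ?mulr_ge0 ?normal_peak_ge0.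
move=> x; rewrite !normal_pdf_prod// mulrA.
rewrite [X in _ <= X](_ : _ = c * normal_peak s * expR (- (x ^+ 2 / (s' ^+ 2 *+ 2)))); last first.
  by rewrite mulrA divfK// gt_eqF.
set y := x ^+ 2 / (s ^+ 2 * 4).
have y0 : 0 <= y by rewrite divr_ge0 ?sqr_ge0// mulr_ge0// ltW.
have -> : x ^+ 2 / (s' ^+ 2 *+ 2) = y.
  by rewrite /s' /y exprMn sqr_sqrtr//; congr (_ / _); ring.
have -> : x ^+ 2 / (s ^+ 2 *+ 2) = y + y.
  by rewrite /y; field; rewrite gt_eqF.
rewrite opprD expRD !mulrA ler_pM2r ?expR_gt0//.
rewrite mulrAC ler_pM2r// expRN ler_pdivrMr ?expR_gt0//.
have xy : x ^+ 2 = s ^+ 2 * 4 * y by rewrite /y mulrC divfK// mulf_neq0// ?gt_eqF.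
have h1 : `|x| ^+ n <= 1 + y ^+ n.+1 * (s ^+ 2 * 4) ^+ n.+1.
  rewrite mulrC -exprMn -xy -[x ^+ 2]ger0_norm ?sqr_ge0// normrX -exprM.
  have [x1|x1] := leP `|x| 1.
    rewrite (@le_trans _ _ 1) ?exprn_ile1//.
    by rewrite lerDl exprn_ge0.
  rewrite (@le_trans _ _ (`|x| ^+ (2 * n.+1))) ?lerDr//.
  by rewrite ler_eXn2l// (leq_trans (leqnSn n))// leq_pmull.
rewrite (le_trans h1)// /c.
have := @expR_ge1Dxn _ y n y0.
have e1 : 1 <= expR y by rewrite -expR0 ler_expR.
rewrite -lerBrDl ler_pdivrMr ?ltr0n ?fact_gt0// => h2.
have K0 : 0 <= (s ^+ 2 * 4) ^+ n.+1 by rewrite exprn_ge0// mulr_ge0// ltW.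
rewrite mulrDl mul1r lerD// -[leRHS]mulrA [leLHS]mulrC ler_wpM2l// (le_trans h2)//.
by rewrite mulrC ler_wpM2l// gerBl.
Qed.


End gaussian_tails.

Section gaussian_derivatives.
Context {R : realType}.
Local Notation mu := (@lebesgue_measure R).
Implicit Types (s x : R) (p : {poly R}).

Lemma itg_exprn_normal s n : 0 < s ->
  itg mu (fun x => `|x| ^+ n * normal_pdf 0 s x).
Proof.
move=> s0; have [C C0 hC] := exprn_normal_pdf_bound n s0.
apply: (itg_le (g := fun x : measurableTypeR R => C * normal_pdf 0 (Num.sqrt 2 * s) x)).
- apply: measurable_funM; last exact: measurable_normal_pdf.
  by apply: measurable_funX; exact: normr_measurable.
- by apply: itgZ; exact: integrable_normal_pdf.
- by move=> x; rewrite ger0_norm// mulr_ge0// normal_pdf_ge0.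
Qed.

Lemma itg_growth_normal s n (g : R -> R) C : 0 < s -> continuous g ->
  (forall x, `|g x| <= C * (1 + `|x| ^+ n)) ->
  itg mu (fun x => g x * normal_pdf 0 s x).
Proof.
move=> s0 cg gC.
apply: (itg_le (g := fun x : measurableTypeR R => C * (`|x| ^+ 0 * normal_pdf 0 s x + `|x| ^+ n * normal_pdf 0 s x))).
- by apply: measurable_funM; [exact: continuous_measurable_fun|exact: measurable_normal_pdf].
- by apply: itgZ; apply: itgD; exact: itg_exprn_normal.
- move=> x; rewrite normrM (ger0_norm (normal_pdf_ge0 _ _ _)) expr0 -mulrDl mulrA.
  by rewrite ler_wpM2r// normal_pdf_ge0.
Qed.

Lemma poly_growth p : exists C, forall x, `|p.[x]| <= C * (1 + `|x| ^+ size p).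
Proof.
exists (\sum_(i < size p) `|p`_i|) => x; rewrite horner_coef.
rewrite (le_trans (ler_norm_sum _ _ _))// mulr_suml ler_sum// => i _.
rewrite normrM normrX ler_wpM2l//.
have [x1|x1] := leP `|x| 1.
  by rewrite (@le_trans _ _ 1) ?exprn_ile1// lerDl exprn_ge0.
rewrite (@le_trans _ _ (`|x| ^+ size p)) ?lerDr//.
by rewrite ler_eXn2l// ltnW.
Qed.

Lemma is_derive_normal_pdf s x : 0 < s ->
  is_derive x 1 (normal_pdf 0 s : R -> R) (- (x / s ^+ 2) * normal_pdf 0 s x).
Proof.
move=> s0; have -> : normal_pdf 0 s =
    (fun x => normal_peak s * expR (- (x ^+ 2 / (s ^+ 2 *+ 2)))).
  by apply/funext => y; rewrite normal_pdf_prod.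
apply: is_derive_eq; rewrite /= /GRing.scale /=.
by field; rewrite gt_eqF.
Qed.

End gaussian_derivatives.

Section by_parts.
Context {R : realType}.
Local Notation mu := (@lebesgue_measure R).

(** On [-(n+1), n+1] the integral is a boundary term of size at most 2K / (n+1); dominated
    convergence passes to the whole line. The bound on |x| |F x| replaces a separate study of the
    limits of F. *)
Lemma Rintegral_derive_eq0 (F F' : R -> R) (K : R) :
  (forall x : R, is_derive x 1 F (F' x)) -> continuous F' ->
  itg mu F' -> (forall x : R, `|x| * `|F x| <= K) -> \int[mu]_x F' x = 0.
Proof.
move=> dF cF' iF' FK.
pose A (n : nat) : set R := [set` `[(- n.+1%:R : R), n.+1%:R]].
pose f_ (n : nat) : measurableTypeR R -> \bar R := (EFin \o F') \_ (A n).
have ftc n : (\int[mu]_x f_ n x = (F n.+1%:R - F (- n.+1%:R))%:E)%E.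
  rewrite -integral_mkcond EFinB; apply: continuous_FTC2.
  - by rewrite -subr_gt0 opprK ltr_pwDr.
  - exact: continuous_subspaceT.
  - have cF : continuous F.
      by move=> x; apply/differentiable_continuous/derivable1_diffP; case: (dF x).
    split => [x _||]; first by case: (dF x).
    + exact/cvg_at_right_filter/cF.
    + exact/cvg_at_left_filter/cF.
  - by move=> x _; rewrite derive1E derive_val.
have mA n : measurable (A n : set (measurableTypeR R)) by exact: measurable_itv.
have mF' : measurable_fun (setT : set (measurableTypeR R)) (EFin \o F').
  by apply/measurable_EFinP; exact: continuous_measurable_fun.
have := @dominated_convergence _ (measurableTypeR R) R mu setT measurableT f_
  (EFin \o F') (fun x => `|F' x|%:E).
case.
- move=> n; apply/(measurable_restrictT _ (mA n)); exact: measurable_funTS.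
- exact: mF'.
- apply: aeW => x _; apply: cvg_near_cst; near=> n.
  rewrite /f_ patchE mem_set// /A /= in_itv /= -ler_norml.
  rewrite (le_trans (ltW (truncnS_gt _)))// ler_nat ltnS.
  near: n; exact: nbhs_infty_ge.
- exact: (itg_norm iF').
- apply: aeW => x n _; rewrite /f_ patchE; case: ifP => _ //=.
  by rewrite normr0 lee_fin.
move=> _ _; set u := (X in X @ _ --> _) => uF.
have u0 : u @ \oo --> 0%E.
  have -> : u = EFin \o (fun n => F n.+1%:R - F (- n.+1%:R)).
    by apply/funext => n; rewrite /u /= ftc.
  apply: cvg_EFin; first by near=> n.
  apply/cvgrPdist_le => e e0; near=> n; rewrite sub0r normrN /=.
  have n0 : 0 < n.+1%:R :> R by [].
  have h1 : `|F n.+1%:R| <= K / n.+1%:R.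
    by rewrite ler_pdivlMr// mulrC; have := FK n.+1%:R; rewrite ger0_norm.
  have h2 : `|F (- n.+1%:R)| <= K / n.+1%:R.
    by rewrite ler_pdivlMr// mulrC; have := FK (- n.+1%:R); rewrite normrN ger0_norm.
  rewrite (le_trans (ler_normB _ _))// (le_trans (lerD h1 h2))// -mulr2n.
  rewrite -mulrnAl ler_pdivrMr// mulrC -ler_pdivrMr//.
  rewrite (le_trans (ltW (truncnS_gt _)))// ler_nat ltnS.
  near: n; exact: nbhs_infty_ge.
have /(cvg_lim (@ereal_hausdorff R)) uE := uF.
move/(cvg_lim (@ereal_hausdorff R)) : u0; rewrite uE /Rintegral => E.
by rewrite [X in fine X]E.
Unshelve. all: end_near. Qed.

End by_parts.

Definition growth {R : realType} (g : R -> R) :=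
  exists C n, forall x : R, `|g x| <= C * (1 + `|x| ^+ n).

Section growth.
Context {R : realType}.
Implicit Types (g h : R -> R).

Lemma growth_ge0 g (C : R) n : (forall x : R, `|g x| <= C * (1 + `|x| ^+ n)) -> 0 <= C.
Proof.
by move=> /(_ 0)/(le_trans (normr_ge0 _)); rewrite pmulr_lge0// ltr_pwDl// exprn_ge0.
Qed.

Lemma expr_le_growth (y : R) m n : 0 <= y -> (m <= n)%N -> y ^+ m <= 1 + y ^+ n.
Proof.
move=> y0 mn; have [y1|y1] := leP y 1.
  by rewrite (@le_trans _ _ 1) ?exprn_ile1// lerDl exprn_ge0.
by rewrite (@le_trans _ _ (y ^+ n)) ?lerDr// ler_eXn2l.
Qed.

Lemma growthD g h : growth g -> growth h -> growth (fun x => g x + h x).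
Proof.
move=> [C [n gC]] [D [m hD]]; have C0 := growth_ge0 gC; have D0 := growth_ge0 hD.
exists (2 * (C + D)), (n + m)%N => x; rewrite (le_trans (ler_normD _ _))//.
have /(ler_wpM2l C0) h1 := expr_le_growth (normr_ge0 x) (leq_addr m n).
have /(ler_wpM2l D0) h2 := expr_le_growth (normr_ge0 x) (leq_addl n m).
have : 0 <= C * `|x| ^+ (n + m) by rewrite mulr_ge0// exprn_ge0.
have : 0 <= D * `|x| ^+ (n + m) by rewrite mulr_ge0// exprn_ge0.
move: (gC x) (hD x) h1 h2; lra.
Qed.

Lemma growthM g h : growth g -> growth h -> growth (fun x => g x * h x).
Proof.
move=> [C [n gC]] [D [m hD]]; have C0 := growth_ge0 gC; have D0 := growth_ge0 hD.
exists (3 * (C * D)), (n + m)%N => x; rewrite normrM.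
rewrite (le_trans (ler_pM _ _ (gC x) (hD x)))//.
have h1 := expr_le_growth (normr_ge0 x) (leq_addr m n).
have h2 := expr_le_growth (normr_ge0 x) (leq_addl n m).
rewrite [leLHS]mulrACA [3 * _]mulrC -[leRHS]mulrA ler_wpM2l ?mulr_ge0//.
by move: h1 h2; rewrite exprD; move: (`|x| ^+ n) (`|x| ^+ m) => a b; nra.
Qed.

Lemma growth_poly (p : {poly R}) : growth (horner p).
Proof. by have [C hC] := poly_growth p; exists C, (size p). Qed.

Lemma growth_cst (c : R) : growth (fun=> c).
Proof.
by exists `|c|, 0%N => x; rewrite expr0 ler_peMr// lerDl.
Qed.

Lemma lip_growth_growth (K : R) h : lip K h -> growth h.
Proof.
move=> hK; exists (`|h 0| + K), 1%N => x; rewrite expr1.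
rewrite (le_trans (lip_growth x hK))//.
have := lip_ge0 hK; have := normr_ge0 x; have := normr_ge0 (h 0).
move: `|x| `|h 0| => a b; nra.
Qed.

Lemma itg_growth (s : R) g : 0 < s -> continuous g -> growth g ->
  itg (@lebesgue_measure R) (fun x => g x * normal_pdf 0 s x).
Proof. by move=> s0 cg [C [n gC]]; exact: itg_growth_normal s0 cg gC. Qed.

Lemma itg_growth_normal_prob (s : R) g : 0 < s -> continuous g -> growth g ->
  itg (normal_prob 0 s) g.
Proof.
move=> s0 cg gg; apply: itg_normal; first exact: continuous_measurable_fun.
exact: itg_growth.
Qed.

Lemma growth_normal_pdf_bound (s : R) g : 0 < s -> growth g ->
  exists K, forall x, `|g x| * normal_pdf 0 s x <= K.
Proof.
move=> s0 [C [n gC]]; have C0 := growth_ge0 gC.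
have [D D0 hD] := exprn_normal_pdf_bound n s0.
have s'0 : Num.sqrt 2 * s != 0 by rewrite gt_eqF// mulr_gt0// sqrtr_gt0.
exists (C * (normal_peak s + D * normal_peak (Num.sqrt 2 * s))) => x.
rewrite (le_trans (ler_wpM2r (normal_pdf_ge0 _ _ _) (gC x)))// -mulrA ler_wpM2l//.
rewrite mulrDl mul1r lerD ?normal_pdf_ub ?gt_eqF// (le_trans (hD x))//.
by rewrite ler_wpM2l// normal_pdf_ub.
Qed.

End growth.

Section stein.
Context {R : realType}.
Local Notation mu := (@lebesgue_measure R).
Implicit Types (s : R) (g : R -> R).

Lemma derive_continuous g (g' : R -> R) : (forall x : R, is_derive x 1 g (g' x)) -> continuous g.
Proof.
by move=> dg x; apply/differentiable_continuous/derivable1_diffP; case: (dg x).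
Qed.

(** The difference of the two integrands is the derivative of g times the density, whose integral
    vanishes. *)
Lemma Rintegral_stein s g (g' : R -> R) : 0 < s -> (forall x : R, is_derive x 1 g (g' x)) ->
  continuous g' -> growth g -> growth g' ->
  \int[mu]_x (g' x * normal_pdf 0 s x) =
    \int[mu]_x (g x * (x / s ^+ 2) * normal_pdf 0 s x).
Proof.
move=> s0 dg cg' gg gg'; have cg := derive_continuous dg.
have clin : continuous (fun x : R => x / s ^+ 2) by move=> x; apply: cvgM => //; exact: cvg_cst.
have glin : growth (fun x : R => x / s ^+ 2).
  apply: growthM; last exact: growth_cst.
  by exists 1, 1%N => x; rewrite mul1r expr1 lerDr.
have cgx : continuous (fun x => g x * (x / s ^+ 2)).
  by move=> x; apply: cvgM; [exact: cg|exact: clin].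
have i1 := itg_growth s0 cg' gg'.
have i2 := itg_growth s0 cgx (growthM gg glin).
have [K hK] : exists K, forall x : R, `|x * g x| * normal_pdf 0 s x <= K.
  apply: growth_normal_pdf_bound => //; apply: growthM gg.
  by exists 1, 1%N => x; rewrite mul1r expr1 lerDr.
apply/eqP; rewrite -subr_eq0 -RintegralB//; apply/eqP.
apply: (@Rintegral_derive_eq0 _ (fun x => g x * normal_pdf 0 s x) _ K).
- move=> x; have := is_derive_normal_pdf x s0 => dpdf.
  apply: (is_derive_eq (is_deriveM (dg x) dpdf)).
  by rewrite /GRing.scale /=; ring.
- move=> x; apply: cvgB; apply: cvgM.
  + exact: cg'.
  + by apply: continuous_normal_pdf; rewrite gt_eqF.
  + exact: cgx.
  + by apply: continuous_normal_pdf; rewrite gt_eqF.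
- exact: itgB.
- move=> x; rewrite normrM mulrA -normrM (ger0_norm (normal_pdf_ge0 _ _ _)).
  exact: hK.
Qed.

Lemma normal_mean s : 0 < s -> \int[normal_prob 0 s]_x x = 0.
Proof.
move=> s0; have s20 : s ^+ 2 != 0 by rewrite expf_eq0/= gt_eqF.
have gid : growth (fun x : R => x) by exists 1, 1%N => x; rewrite mul1r expr1 lerDr.
have cid : continuous (fun x : R => x) by move=> x; exact: cvg_id.
rewrite Rintegral_normal; last exact: itg_growth_normal_prob.
(* The test function is chosen so that g x * (x / s^2) is the monomial to be integrated; the higher
   moments below follow the same pattern. *)
have := @Rintegral_stein s (fun=> s ^+ 2) (fun=> 0) s0.
under eq_Rintegral do rewrite mul0r; rewrite Rintegral_cst// mul0r => H.
rewrite [RHS]H//.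
- by apply: eq_Rintegral => x _; congr (_ * _); field; exact: lt0r_neq0.
- by move=> x; exact: cvg_cst.
- exact: growth_cst.
- exact: growth_cst.
Qed.

Lemma normal_second_moment s : 0 < s -> \int[normal_prob 0 s]_x x ^+ 2 = s ^+ 2.
Proof.
move=> s0; have s20 : s ^+ 2 != 0 by rewrite expf_eq0/= gt_eqF.
have gid : growth (fun x : R => x) by exists 1, 1%N => x; rewrite mul1r expr1 lerDr.
have cid : continuous (fun x : R => x) by move=> x; exact: cvg_id.
rewrite Rintegral_normal; last first.
  apply: itg_growth_normal_prob => //; first exact: exprn_continuous.
  by exists 1, 2%N => x; rewrite mul1r normrX lerDr.
have := @Rintegral_stein s (fun x => s ^+ 2 * x) (fun=> s ^+ 2) s0.
have -> : \int[mu]_x (s ^+ 2 * normal_pdf 0 s x) = s ^+ 2.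
  rewrite RintegralZl//; last exact: integrable_normal_pdf.
  by rewrite /Rintegral integral_normal_pdf mulr1.
move=> H; rewrite [RHS]H//.
- by apply: eq_Rintegral => x _; congr (_ * _); field; exact: lt0r_neq0.
- move=> x; apply: is_derive_eq; by rewrite /GRing.scale/= mulr1.
- by move=> x; exact: cvg_cst.
- by apply: growthM => //; exact: growth_cst.
- exact: growth_cst.
Qed.

Lemma normal_fourth_moment s : 0 < s -> \int[normal_prob 0 s]_x x ^+ 4 = 3 * s ^+ 4.
Proof.
move=> s0; have s20 : s ^+ 2 != 0 by rewrite expf_eq0/= gt_eqF.
have g2 : growth (fun x : R => x ^+ 2) by exists 1, 2%N => x; rewrite mul1r normrX lerDr.
have g3 : growth (fun x : R => x ^+ 3) by exists 1, 3%N => x; rewrite mul1r normrX lerDr.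
have g4 : growth (fun x : R => x ^+ 4) by exists 1, 4%N => x; rewrite mul1r normrX lerDr.
have i2 := itg_growth s0 (@exprn_continuous _ 2) g2.
have i4 := itg_growth s0 (@exprn_continuous _ 4) g4.
rewrite Rintegral_normal; last exact: itg_growth_normal_prob (@exprn_continuous _ 4) g4.
have := @Rintegral_stein s (fun x => s ^+ 2 * x ^+ 3) (fun x => 3 * s ^+ 2 * x ^+ 2) s0.
have -> : \int[mu]_x (3 * s ^+ 2 * x ^+ 2 * normal_pdf 0 s x) = 3 * s ^+ 4.
  under eq_Rintegral do rewrite -mulrA.
  rewrite RintegralZl// -Rintegral_normal; last first.
    exact: itg_growth_normal_prob (@exprn_continuous _ 2) g2.
  by rewrite normal_second_moment//; ring.
move=> H; rewrite [RHS]H//.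
- by apply: eq_Rintegral => x _; congr (_ * _); field; exact: lt0r_neq0.
- by move=> x; apply: is_derive_eq; rewrite /GRing.scale/=; ring.
- by move=> x; apply: cvgM; [exact: cvg_cst|exact: exprn_continuous].
- by apply: growthM => //; exact: growth_cst.
- by apply: growthM => //; exact: growth_cst.
Qed.

Lemma itg_normal_third s : 0 < s -> itg (normal_prob 0 s) (fun x => `|x| ^+ 3).
Proof.
move=> s0; apply: itg_growth_normal_prob => //.
  move=> x; apply: (@continuous_comp _ _ _ (fun y : R => `|y|) (fun y => y ^+ 3)).
    exact: norm_continuous.
  exact: exprn_continuous.
by exists 1, 3%N => x; rewrite mul1r normrX normr_id lerDr.
Qed.

(** Expanding y^2 (s - y)^2 >= 0 gives y^3 <= (s/2) y^2 + y^4 / (2s); inserting the moments s^2 and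
    3 s^4 yields s^3/2 + 3 s^3/2. *)
Lemma normal_third_moment s : 0 < s ->
  \int[normal_prob 0 s]_x `|x| ^+ 3 <= 2 * s ^+ 3.
Proof.
move=> s0.
have i2 : itg (normal_prob 0 s) (fun x => x ^+ 2).
  apply: itg_growth_normal_prob => //; first exact: exprn_continuous.
  by exists 1, 2%N => x; rewrite mul1r normrX lerDr.
have i4 : itg (normal_prob 0 s) (fun x => x ^+ 4).
  apply: itg_growth_normal_prob => //; first exact: exprn_continuous.
  by exists 1, 4%N => x; rewrite mul1r normrX lerDr.
rewrite (_ : 2 * s ^+ 3 = s / 2 * s ^+ 2 + (2 * s)^-1 * (3 * s ^+ 4)); last first.
  by field; rewrite gt_eqF.
rewrite -(normal_second_moment s0) -(normal_fourth_moment s0).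
rewrite -!RintegralZl// -RintegralD//; [|exact: itgZ|exact: itgZ].
apply: ler_Rintegral; [exact: itg_normal_third|by apply: itgD; exact: itgZ|].
move=> x; rewrite -[x ^+ 2]real_normK ?num_real// (_ : x ^+ 4 = `|x| ^+ 4); last first.
  by rewrite -normrX ger0_norm// exprn_even_ge0.
have := normr_ge0 x; move: `|x| => y y0; rewrite -subr_ge0.
rewrite (_ : _ - _ = (2 * s)^-1 * (y ^+ 2 * (s - y) ^+ 2)); last first.
  by field; rewrite gt_eqF.
apply: mulr_ge0; last by rewrite mulr_ge0// sqr_ge0.
by rewrite invr_ge0 mulr_ge0// ltW.
Qed.

End stein.

(** * Convolution of centred normal laws *)

Section translation.
Context {R : realType}.
Local Notation mu := (@lebesgue_measure R).

Lemma lebesgue_measure_shift (c : R) (A : set (measurableTypeR R)) : measurable A ->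
  mu A = pushforward mu (fun x : measurableTypeR R => x + c : measurableTypeR R) A.
Proof.
have mc : measurable_fun setT (fun x : measurableTypeR R => x + c : measurableTypeR R).
  exact: measurable_funD.
apply: (lebesgue_measure_unique (mu :=
  @measure_function_pushforward__canonical__measure_function_Measure _ _ _ _ R mu _ mc)).
move=> X [[a b] _ <-] /=.
rewrite /pushforward (_ : _ @^-1` _ = `]a - c, b - c]%classic); last first.
  by apply/seteqP; split=> y /=; rewrite !in_itv /= ltrBlDr lerBrDr.
rewrite !lebesgue_measure_itv /= !lte_fin ltrD2r; case: ifP => // _.
by rewrite -!EFinB; congr EFin; ring.
Qed.

Lemma ge0_integral_shift (c : R) (f : measurableTypeR R -> \bar R) :
  measurable_fun setT f -> (forall x, 0 <= f x)%E ->
  (\int[mu]_x f (x + c)%R = \int[mu]_x f x)%E.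
Proof.
move=> mf f0.
have mc : measurable_fun setT (fun x : measurableTypeR R => x + c : measurableTypeR R).
  exact: measurable_funD.
rewrite -(@ge0_integral_pushforward _ _ _ _ _ _ mc mu setT f)//.
by apply: eq_measure_integral => /= A mA _; rewrite -lebesgue_measure_shift.
Qed.

End translation.

Lemma measurable_normal_pdf_comp {R : realType} {d} {T : measurableType d}
    (m s : R) (g : T -> R) : measurable_fun setT g ->
  measurable_fun setT (fun x => normal_pdf m s (g x)).
Proof. by move=> mg; exact: (measurableT_comp (measurable_normal_pdf m s) mg). Qed.

Section convolution.
Context {R : realType}.
Local Notation mu := (@lebesgue_measure R).
Variables (s r t : R).
Hypotheses (s0 : 0 < s) (r0 : 0 < r) (t0 : 0 < t) (srt : t ^+ 2 = s ^+ 2 + r ^+ 2).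

(** Completing the square: the joint density of Y and W = Y + Z is the density of W times the normal
    conditional density of Y given W. *)
Lemma normal_pdf_convolution (w y : R) :
  normal_pdf 0 r (w - y) * normal_pdf 0 s y =
  normal_pdf 0 t w * normal_pdf (w * s ^+ 2 / t ^+ 2) (s * r / t) y.
Proof.
have srt0 : 0 < s * r / t by rewrite divr_gt0// mulr_gt0.
rewrite !normal_pdf_prod// normal_pdfE ?gt_eqF//.
rewrite mulrACA -expRD [RHS]mulrACA /normal_fun -expRD; congr (_ * expR _).
  rewrite /normal_peak -!invfM -!sqrtrM; last 2 first.
  - by rewrite mulrn_wge0// mulr_ge0 ?sqr_ge0// pi_ge0.
  - by rewrite mulrn_wge0// mulr_ge0 ?sqr_ge0// pi_ge0.
  by congr (Num.sqrt _)^-1; rewrite exprMn exprVn exprMn; field; rewrite gt_eqF.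
have sr2 : s ^+ 2 + r ^+ 2 != 0 by rewrite -srt expf_eq0/= gt_eqF.
rewrite !exprMn exprVn !srt; field.
by rewrite sr2 !gt_eqF.
Qed.

Local Notation Ns := (normal_prob 0 s).
Local Notation Nr := (normal_prob 0 r).
Local Notation Nt := (normal_prob 0 t).

(** After the shift w = y + z, Tonelli exchanges the integrals, and the conditional density of y
    given w integrates to 1. *)
Lemma ge0_convolution (h : measurableTypeR R -> R) : measurable_fun setT h ->
  (forall x, 0 <= h x) ->
  (\int[Ns]_y \int[Nr]_z (h (y + z)%R)%:E = \int[Nt]_w (h w)%:E)%E.
Proof.
move=> mh h0.
have inner (y : R) : (\int[Nr]_z (h (y + z)%R)%:E =
    \int[mu]_w (h w * normal_pdf 0 r (w - y))%R%:E)%E.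
  rewrite ge0_integral_normal; first last.
  - by move=> x; rewrite lee_fin.
  - apply/measurable_EFinP; by apply: (measurableT_comp mh); apply: measurable_funD.
  rewrite -[RHS](ge0_integral_shift y); first last.
  - by move=> x; rewrite lee_fin mulr_ge0// normal_pdf_ge0.
  - apply/measurable_EFinP; apply: measurable_funM => //.
    apply: measurable_normal_pdf_comp; exact: measurable_funB.
  by apply: eq_integral => z _; rewrite addrK (addrC z).
under eq_integral do rewrite inner.
have mF : measurable_fun setT (fun yw : measurableTypeR R * measurableTypeR R =>
    (h yw.2 * (normal_pdf 0 r (yw.2 - yw.1) * normal_pdf 0 s yw.1))%:E).
  apply/measurable_EFinP; apply: measurable_funM.
    exact: (measurableT_comp mh measurable_snd).
  apply: measurable_funM.
    by apply: measurable_normal_pdf_comp; apply: measurable_funB.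
  exact: measurable_normal_pdf_comp.
have F0 (yw : measurableTypeR R * measurableTypeR R) : 
    (0 <= (h yw.2 * (normal_pdf 0 r (yw.2 - yw.1) * normal_pdf 0 s yw.1))%R%:E)%E.
  by rewrite lee_fin mulr_ge0// mulr_ge0// normal_pdf_ge0.
have mFy (y : measurableTypeR R) : measurable_fun setT
    (fun w : measurableTypeR R => (h w * normal_pdf 0 r (w - y))%:E).
  apply/measurable_EFinP; apply: measurable_funM => //.
  by apply: measurable_normal_pdf_comp; exact: measurable_funB.
rewrite [LHS]ge0_integral_normal; first last.
- move=> y; apply: integral_ge0 => w _.
  by rewrite lee_fin mulr_ge0// normal_pdf_ge0.
- have mF' : measurable_fun setT (fun yw : measurableTypeR R * measurableTypeR R =>
    (h yw.2 * normal_pdf 0 r (yw.2 - yw.1))%:E).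
    apply/measurable_EFinP; apply: measurable_funM.
      exact: (measurableT_comp mh measurable_snd).
    by apply: measurable_normal_pdf_comp; apply: measurable_funB.
  apply: (measurable_fun_fubini_tonelli_F (m2 := mu) _ mF') => yw.
  by rewrite lee_fin mulr_ge0// normal_pdf_ge0.
transitivity (\int[mu]_y \int[mu]_w
  (h w * (normal_pdf 0 r (w - y) * normal_pdf 0 s y))%R%:E)%E.
  apply: eq_integral => y _; rewrite -ge0_integralZr//.
  - by apply: eq_integral => w _; rewrite -EFinM mulrA.
  - by move=> w _; rewrite lee_fin mulr_ge0// normal_pdf_ge0.
  - by rewrite lee_fin normal_pdf_ge0.
rewrite (fubini_tonelli (m1 := mu) (m2 := mu) _ mF F0) /=.
rewrite [RHS]ge0_integral_normal; first last.
- by move=> w; rewrite lee_fin.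
- exact/measurable_EFinP.
apply: eq_integral => w _.
under eq_integral do rewrite normal_pdf_convolution mulrA EFinM.
rewrite ge0_integralZl//; first last.
- by rewrite lee_fin mulr_ge0// normal_pdf_ge0.
- by move=> y _; rewrite lee_fin normal_pdf_ge0.
- by apply/measurable_EFinP; exact: measurable_normal_pdf.
by rewrite integral_normal_pdf mule1 EFinM.
Qed.

Local Notation gaussian u := (average (normal_prob 0 u) (fun z : measurableTypeR R => z : R)).

Lemma itg_id u : 0 < u -> itg (normal_prob 0 u) (fun z : measurableTypeR R => z : R).
Proof.
by move=> u0; apply: itg_moment1 (itg_normal_third u0).
Qed.

Lemma gaussian_comp_ge0 K h x : lip K h -> (forall x, 0 <= h x) ->
  gaussian s (gaussian r h) x = gaussian t h x.
Proof.
move=> hK h0.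
suff E : (\int[Ns]_y (gaussian r h (x + y)%R)%:E = \int[Nt]_w (h (x + w)%R)%:E)%E.
  exact: (congr1 fine E).
pose hx (w : R) := h (x + w).
have mhx : measurable_fun setT (hx : measurableTypeR R -> R).
  apply: (measurableT_comp (lip_measurable hK)); exact: measurable_funD.
have hx0 (w : measurableTypeR R) : 0 <= hx w by exact: h0.
have E := ge0_convolution mhx hx0.
transitivity (\int[Ns]_y \int[Nr]_z (hx (y + z)%R)%:E)%E; last exact: E.
apply: eq_integral => y _.
have mid : measurable_fun setT (fun z : measurableTypeR R => z : R) by [].
have iz := itg_lip mid (x + y) (itg_id r0) hK.
transitivity (\int[Nr]_z (h (x + y + z)%R)%:E)%E; first exact: (EFin_Rintegral iz).
by apply: eq_integral => z _; rewrite /hx addrA.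
Qed.

Lemma gaussian_comp K h x : lip K h ->
  gaussian s (gaussian r h) x = gaussian t h x.
Proof.
move=> hK.
(* Both functions are nonnegative and Lipschitz with difference h, which reduces the claim to the
   Tonelli case. *)
pose p x := `|h x| + h x; pose q x := `|h x|.
have qK : lip K q by move=> a b; rewrite (le_trans _ (hK a b))// ler_dist_dist.
have pK : lip (K + K) p.
  move=> a b; rewrite mulrDl (_ : _ - _ = q a - q b + (h a - h b)); last first.
    by rewrite /p /q; ring.
  by rewrite (le_trans (ler_normD _ _))// lerD.
have mid : measurable_fun setT (fun z : measurableTypeR R => z : R) by [].
have E u : 0 < u -> gaussian u h = (fun y => gaussian u p y - gaussian u q y).
  move=> u0; apply/funext => y; rewrite /average -RintegralB//; last 2 first.
  - exact: (itg_lip _ _ (itg_id u0) pK).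
  - exact: (itg_lip _ _ (itg_id u0) qK).
  by apply: eq_Rintegral => z _; rewrite /p /q addrAC subrr add0r.
have p0 y : 0 <= p y by rewrite /p -lerBlDr sub0r ler_normr lexx orbT.
have q0 y : 0 <= q y by rewrite /q.
have Gp := gaussian_comp_ge0 x pK p0; have Gq := gaussian_comp_ge0 x qK q0.
have ip := itg_lip mid x (itg_id s0) (average_lip mid (itg_id r0) pK).
have iq := itg_lip mid x (itg_id s0) (average_lip mid (itg_id r0) qK).
rewrite [RHS](congr1 (fun g => g x) (E t t0)) [X in average _ _ X](E r r0).
exact: (etrans (RintegralB measurableT ip iq) (congr2 (fun a b => a - b) Gp Gq)).
Qed.

End convolution.

Notation gaussian u := (average (normal_prob 0 u) (fun z : measurableTypeR _ => z)).

(** Variances add up: the first n + 1 steps have merged into standard deviation sqrt(n+1) s by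
    induction, and one more convolution gives t. *)
Lemma iter_gaussian {R : realType} (s t K : R) (h : R -> R) n x :
  0 < s -> 0 < t -> t ^+ 2 = n.+1%:R * s ^+ 2 -> lip K h ->
  iter n.+1 (gaussian s) h x = gaussian t h x.
Proof.
move=> s0 t0 st hK; elim: n t t0 st x => [|n IH] t t0 st x.
  rewrite mul1r in st; rewrite /=; suff -> : t = s by [].
  by apply/eqP; rewrite -(eqrXn2 (n := 2)) ?ltW// st.
have r0 : 0 < Num.sqrt n.+1%:R * s by rewrite mulr_gt0// sqrtr_gt0.
have r2 : (Num.sqrt n.+1%:R * s) ^+ 2 = n.+1%:R * s ^+ 2.
  by rewrite exprMn sqr_sqrtr.
rewrite iterS; have -> : iter n.+1 (gaussian s) h = gaussian (Num.sqrt n.+1%:R * s) h.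
  by apply/funext => y; exact: IH.
apply: (gaussian_comp s0 r0 t0 _ _ hK).
by rewrite r2 st -natr1 mulrDl mul1r addrC.
Qed.

(** * Hermite polynomials and the correction terms of the expansion *)

Section hermite.
Context {R : realType}.
Local Notation mu := (@lebesgue_measure R).
Local Notation phi := (normal_pdf 0 1 : R -> R).

(** This is (-1)^m times the usual Hermite polynomial: with this sign, differentiating [hermite m]
    times the density gives exactly [hermite m.+1] times the density. *)
Definition hermite (m : nat) : {poly R} := iter m (fun q => q^`() - 'X * q) 1.

Lemma hermite0 (x : R) : (hermite 0).[x] = 1.
Proof. exact: hornerC. Qed.

Lemma hermiteS m (x : R) :
  (hermite m.+1).[x] = (hermite m)^`().[x] - x * (hermite m).[x].
Proof. by rewrite [hermite m.+1]iterS -/(hermite m) !hornerE. Qed.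

Lemma is_derive_Phi (x : R) : is_derive x 1 (@Phi R) (phi x).
Proof.
have -> : @Phi R = (fun x => \int[mu]_(u in [set` Interval -oo%O (BRight x)]) phi u).
  by apply/funext => y; rewrite /Phi -set_itvNyc.
have x1 : x < x + 1 by rewrite ltrDl.
have ip : mu.-integrable [set` Interval -oo%O (BRight (x + 1))] (EFin \o phi).
  by apply: integrableS (integrable_normal_pdf 0 1) => //; exact: measurable_itv.
have cp : {for x, continuous phi} by apply: continuous_normal_pdf; rewrite oner_neq0.
have [] := continuous_FTC1 x1 ip (ltNyr _) cp.
by move=> dF; rewrite derive1E => E; exact: (DeriveDef dF E).
Qed.

Lemma is_derive_hermite m (x : R) : is_derive x 1
  (fun x => (hermite m).[x] * phi x) ((hermite m.+1).[x] * phi x).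
Proof.
have d1 := is_derive_poly (hermite m) x.
have d2 := is_derive_normal_pdf x (@ltr01 R).
apply: (is_derive_eq (is_deriveM d1 d2)).
transitivity ((hermite m).[x] * (- (x / 1 ^+ 2) * phi x) + phi x * (hermite m)^`().[x]) => //.
by rewrite hermiteS expr1n divr1; ring.
Qed.

Lemma dern_Phi m : dern m.+1 Phi = (fun x => (hermite m).[x] * phi x).
Proof.
elim: m => [|m IH].
  apply/funext => x; rewrite /dern /= derive1E hermite0 mul1r.
  by have [_ ->] := is_derive_Phi x.
rewrite /dern iterS -/(dern m.+1 Phi) IH; apply/funext => x.
by rewrite derive1E; have [_ ->] := is_derive_hermite m x.
Qed.

Lemma is_derive_dern_Phi m (x : R) : is_derive x 1 (dern m Phi) (dern m.+1 Phi x).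
Proof.
case: m => [|m].
  by rewrite dern_Phi hermite0 mul1r; exact: is_derive_Phi.
rewrite !dern_Phi; exact: is_derive_hermite.
Qed.

Lemma is_derive_Np kappa p (x : R) : is_derive x 1 (Np kappa p)
  (phi x + \sum_(1 <= j < p.+1) (-1) ^+ j.+1 * kappa j * dern j.+2 Phi x).
Proof.
elim: p => [|p IH].
  rewrite big_geq// addr0 (_ : Np _ _ = Phi); last first.
    by apply/funext => y; rewrite /Np big_geq// addr0.
  by have := is_derive_dern_Phi 0 x; rewrite dern_Phi hermite0 mul1r.
rewrite big_nat_recr//= (_ : Np _ _ = Np kappa p +
  ((-1) ^+ p.+2 * kappa p.+1) *: dern p.+2 (@Phi R)); last first.
  by apply/funext => y; rewrite /Np big_nat_recr//= addrA.
rewrite addrA; apply: is_deriveD.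
by apply: is_deriveZ; exact: is_derive_dern_Phi.
Qed.

Variable (f : R -> R) (p : nat).
Hypothesis df : forall j, (j <= p)%N -> forall x : R, derivable (dern j f) x 1.
Hypothesis cf : continuous (dern p.+1 f).
Hypothesis gf : forall j, (j <= p.+1)%N -> growth (dern j f).

Let is_derive_dern j (x : R) : (j <= p)%N -> is_derive x 1 (dern j f) (dern j.+1 f x).
Proof. by move=> jp; apply: DeriveDef; [exact: df|rewrite -derive1E]. Qed.

Let continuous_dern j : (j <= p.+1)%N -> continuous (dern j f).
Proof.
rewrite leq_eqVlt => /orP[/eqP -> //|jp].
by apply: derive_continuous => x; exact: is_derive_dern.
Qed.

Lemma itg_hermite j m : (j <= p.+1)%N ->
  itg mu (fun x => dern j f x * ((hermite m).[x] * phi x)).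
Proof.
move=> jp.
have -> : (fun x => dern j f x * ((hermite m).[x] * phi x)) =
    (fun x => dern j f x * (hermite m).[x] * phi x).
  by apply/funext => x; rewrite mulrA.
apply: itg_growth => //.
- by move=> x; apply: cvgM; [exact: continuous_dern|exact: continuous_horner].
- by apply: growthM; [exact: gf|exact: growth_poly].
Qed.

(** The identity of [Rintegral_stein] for f^(j) times [hermite m]: one derivative passes from the
    Gaussian factor to f, with a minus sign. *)
Lemma Rintegral_hermiteS j m : (j <= p)%N ->
  \int[mu]_x (dern j f x * ((hermite m.+1).[x] * phi x)) =
  - \int[mu]_x (dern j.+1 f x * ((hermite m).[x] * phi x)).
Proof.
move=> jp.
have ch q : continuous (horner q : R -> R) by exact: continuous_horner.
have cX : continuous (fun x : R => x) by move=> x; exact: cvg_id.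
have d (x : R) : is_derive x 1 (fun x => dern j f x * (hermite m).[x])
    (dern j.+1 f x * (hermite m).[x] + dern j f x * (hermite m)^`().[x]).
  apply: (is_derive_eq (is_deriveM (is_derive_dern x jp) (is_derive_poly (hermite m) x))).
  by rewrite /GRing.scale /= addrC mulrC.
have := Rintegral_stein (@ltr01 R) d.
have c1 : continuous (fun x => dern j.+1 f x * (hermite m).[x]).
  by move=> x; apply: cvgM; [exact: continuous_dern|exact: ch].
have c2 : continuous (fun x => dern j f x * (hermite m)^`().[x]).
  by move=> x; apply: cvgM; [apply: continuous_dern; exact: leqW|exact: ch].
have g1 : growth (fun x => dern j.+1 f x * (hermite m).[x]).
  by apply: growthM; [exact: gf|exact: growth_poly].
have g2 : growth (fun x => dern j f x * (hermite m)^`().[x]).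
  by apply: growthM; [apply: gf; exact: leqW|exact: growth_poly].
have g3 : growth (fun x => dern j f x * (hermite m).[x]).
  by apply: growthM; [apply: gf; exact: leqW|exact: growth_poly].
have c12 : continuous (fun x => dern j.+1 f x * (hermite m).[x] + dern j f x * (hermite m)^`().[x]).
  by move=> x; apply: cvgD; [exact: c1|exact: c2].
move=> /(_ c12 g3 (growthD g1 g2)) E.
have i1 := itg_growth (@ltr01 R) c1 g1.
have i2 := itg_growth (@ltr01 R) c2 g2.
have i3 := itg_hermite m.+1 (leqW jp).
have -> : \int[mu]_x (dern j.+1 f x * ((hermite m).[x] * phi x)) =
    \int[mu]_x (dern j.+1 f x * (hermite m).[x] * phi x).
  by apply: eq_Rintegral => x _; rewrite mulrA.
apply/eqP; rewrite -subr_eq0 opprK -RintegralD//; apply/eqP.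
transitivity (\int[mu]_x ((dern j.+1 f x * (hermite m).[x] + dern j f x * (hermite m)^`().[x]) * phi x)
   - \int[mu]_x (dern j f x * (hermite m).[x] * (x / 1 ^+ 2) * phi x)); last first.
  by rewrite E subrr.
rewrite -RintegralB//.
- by apply: eq_Rintegral => x _; rewrite hermiteS expr1n divr1; ring.
- by under eq_fun do rewrite mulrDl; exact: itgD.
- apply: itg_growth => //.
    move=> x; apply: cvgM.
      apply: cvgM; [apply: continuous_dern; exact: leqW|exact: ch].
    by apply: cvgM; [exact: cvg_id|exact: cvg_cst].
  apply: growthM => //; apply: growthM; last exact: growth_cst.
  by exists 1, 1%N => x; rewrite mul1r expr1 lerDr.
Qed.

Lemma Rintegral_hermite m j : (j + m <= p.+1)%N ->
  \int[mu]_x (dern j f x * ((hermite m).[x] * phi x)) =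
  (-1) ^+ m * \int[mu]_x (dern (j + m) f x * phi x).
Proof.
elim: m j => [|m IH] j jm.
  by rewrite addn0 expr0 mul1r; apply: eq_Rintegral => x _; rewrite hermite0 mul1r.
have jp : (j <= p)%N by move: jm; rewrite addnS ltnS; apply: leq_trans; exact: leq_addr.
by rewrite Rintegral_hermiteS// IH ?addSnnS// exprS mulN1r mulNr.
Qed.

(** The j-th correction takes j + 1 integrations by parts, whose sign (-1)^(j+1) cancels the one in
    the definition of [Np]. *)
Lemma Rintegral_Np kappa :
  \int[mu]_x (f x * derive1 (Np kappa p) x) =
  \int[normal_prob 0 1]_x f x +
  \sum_(1 <= j < p.+1) kappa j * \int[normal_prob 0 1]_x dern j.+1 f x.
Proof.
have N j : (j <= p.+1)%N -> \int[normal_prob 0 1]_x dern j f x =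
    \int[mu]_x (dern j f x * phi x).
  move=> jp; rewrite Rintegral_normal//; apply: itg_growth_normal_prob => //.
  - exact: continuous_dern.
  - exact: gf.
have -> : (fun x => f x * derive1 (Np kappa p) x) = (fun x =>
   dern 0 f x * ((hermite 0).[x] * phi x) +
   \sum_(1 <= j < p.+1) ((-1) ^+ j.+1 * kappa j) * (dern 0 f x * ((hermite j.+1).[x] * phi x))).
  apply/funext => x; rewrite derive1E; have [_ ->] := is_derive_Np kappa p x.
  rewrite mulrDr hermite0 mul1r; congr (_ + _); rewrite mulr_sumr.
  by apply: eq_bigr => j _; rewrite dern_Phi mulrCA.
rewrite RintegralD//; first last.
- by apply: itg_sum => j _; apply: itgZ; exact: itg_hermite.
- exact: itg_hermite.
rewrite Rintegral_sum; last by move=> j _; apply: itgZ; exact: itg_hermite.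
rewrite (Rintegral_hermite (m := 0) (j := 0))// mul1r -(N 0%N)//; congr (_ + _).
rewrite big_nat [RHS]big_nat; apply: eq_bigr => j /andP[j0 jp].
rewrite RintegralZl//; last exact: itg_hermite.
rewrite (Rintegral_hermite (j := 0))// N// add0n mulrACA -expr2.
by rewrite sqrr_sign mul1r.
Qed.

End hermite.

(** * Product laws and degenerate functions *)

Definition has_law {d1 d2} {S : measurableType d1} {V : measurableType d2}
    {R : realType} (mu : {measure set S -> \bar R}) (phi : S -> V)
    (Q : {measure set V -> \bar R}) :=
  measurable_fun setT phi /\ forall A, measurable A -> mu (phi @^-1` A) = Q A.

Section has_law.
Context {d1 d2} {S : measurableType d1} {V : measurableType d2} {R : realType}.
Variables (mu : {measure set S -> \bar R}) (phi : S -> V)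
  (Q : {measure set V -> \bar R}).
Hypothesis muQ : has_law mu phi Q.

Lemma ge0_integral_law (F : V -> \bar R) : measurable_fun setT F ->
  (forall v, 0 <= F v)%E -> (\int[mu]_s F (phi s) = \int[Q]_v F v)%E.
Proof.
move=> mF F0; have [mphi mphiE] := muQ.
rewrite -(@ge0_integral_pushforward _ _ _ _ _ _ mphi mu setT F)//.
by apply: eq_measure_integral => /= A mA _; rewrite /pushforward mphiE.
Qed.

Lemma itg_law (F : V -> R) : itg Q F -> itg mu (fun s => F (phi s)).
Proof.
move=> /integrableP[mF iF]; have [mphi mphiE] := muQ.
apply/integrableP; split; first exact: measurableT_comp mF mphi.
rewrite /= (ge0_integral_law (F := fun v => `|(F v)%:E|%E))//.
exact: measurableT_comp.
Qed.

Lemma itg_lawP (F : V -> R) : measurable_fun setT F ->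
  itg mu (fun s => F (phi s)) -> itg Q F.
Proof.
move=> mF /integrableP[_ iF]; have [mphi mphiE] := muQ.
apply/integrableP; split; first exact/measurable_EFinP.
rewrite /= -(ge0_integral_law (F := fun v => `|(F v)%:E|%E))//.
by apply: measurableT_comp => //; exact/measurable_EFinP.
Qed.

Lemma integral_law (F : V -> R) : itg Q F ->
  (\int[mu]_s (F (phi s))%:E = \int[Q]_v (F v)%:E)%E.
Proof.
move=> iF; have [mphi mphiE] := muQ.
rewrite -(@integral_pushforward _ _ _ _ _ _ mphi mu setT (EFin \o F))//.
- by apply: eq_measure_integral => /= A mA _; rewrite /pushforward mphiE.
- exact: measurable_int iF.
- exact: itg_law.
Qed.

Lemma Rintegral_law (F : V -> R) : itg Q F ->
  \int[mu]_s F (phi s) = \int[Q]_v F v.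
Proof. by move=> iF; rewrite /Rintegral integral_law. Qed.

End has_law.

Section tuple_law.
Context {R : realType} (n : nat).
Local Notation V := (n.-tuple R).

Definition rect (B : 'I_n -> set R) : set V := [set v | forall i, B i (tnth v i)].

Lemma measurable_rect B : (forall i, measurable (B i)) -> measurable (rect B).
Proof.
move=> mB; rewrite (_ : rect B = \bigcap_(i in setT) ((fun v : V => tnth v i) @^-1` B i)).
  apply: fin_bigcap_measurable; first exact: finite_finset.
  by move=> i _; rewrite -[X in measurable X]setTI; exact: (measurable_tnth i).
by apply/seteqP; split=> v /= vB i => [_|]; exact: vB.
Qed.

Lemma rect_setI B C : rect B `&` rect C = rect (fun i => B i `&` C i).
Proof.
apply/seteqP; split=> v /=; first by move=> [vB vC] i; split.
by move=> vBC; split=> i; have [] := vBC i.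
Qed.

Let rects := [set rect B | B in [set B | forall i, measurable (B i)]].

(** Measurable rectangles are stable under intersection and generate the sigma-algebra of tuples. *)
Lemma tuple_law_unique (m1 m2 : {measure set V -> \bar R}) :
  (m1 setT < +oo)%E ->
  (forall B, (forall i, measurable (B i)) -> m1 (rect B) = m2 (rect B)) ->
  forall A, measurable A -> m1 A = m2 A.
Proof.
move=> m1T m12 A mA.
apply: (@g_sigma_algebra_measure_unique _ _ _ rects _ (fun=> setT)).
- by move=> _ [B mB <-]; exact: measurable_rect.
- move=> _; exists (fun=> setT) => //.
  by apply/seteqP; split.
- by apply/seteqP; split=> // v _; exists 0%N.
- move=> _ _ [B mB <-] [C mC <-]; exists (fun i => B i `&` C i); last by rewrite rect_setI.
  by move=> i; apply: measurableI; [exact: mB|exact: mC].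
- by move=> _ [B mB <-]; exact: m12.
- by [].
- apply: smallest_sub mA; first exact: smallest_sigma_algebra.
  rewrite -bigcup_seq => X [i _] [C mC <-]; rewrite setTI.
  apply: sub_sigma_algebra.
  (* A condition on one coordinate is a rectangle whose other sides are full. *)
  exists (fun j => if j == i then C else setT).
    by move=> j; case: ifP.
  apply/seteqP; split=> v /=; first by move=> /(_ i); rewrite eqxx.
  by move=> Cv j; case: eqP => // ->.
Qed.

Variable Q : probability V R.

Definition product_law := forall B, (forall i, measurable (B i)) ->
  Q (rect B) = (\prod_(i < n) Q [set v | B i (tnth v i)])%E.

(** Resampling of the coordinates outside K. It makes Fubini available for a block of coordinates
    and its complement without splitting the tuple space into a product. *)
Definition merge (K : {set 'I_n}) (vv : V * V) : V :=
  [tuple if i \in K then tnth vv.1 i else tnth vv.2 i | i < n].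

Lemma measurable_merge K : measurable_fun setT (merge K).
Proof.
apply/measurable_fun_tnthP => i.
have -> : (@tnth n R)^~ i \o merge K =
    if i \in K then (fun vv => tnth vv.1 i) else (fun vv => tnth vv.2 i).
  by apply/funext => vv /=; rewrite tnth_mktuple; case: ifP.
case: ifP => _.
- exact: measurableT_comp (measurable_tnth i) measurable_fst.
- exact: measurableT_comp (measurable_tnth i) measurable_snd.
Qed.

Lemma merge_law K : product_law -> has_law (Q \x Q)%E (merge K) Q.
Proof.
move=> pQ; split; first exact: measurable_merge.
pose m' : {measure set V -> \bar R} :=
  @measure_function_pushforward__canonical__measure_function_Measure _ _ _ _ R
    (Q \x Q)%E _ (@measurable_merge K).
move=> A mA; apply: (@tuple_law_unique m' Q) mA.
  rewrite /m' /= /pushforward preimage_setT -setXTT product_measure1E//.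
  by rewrite [X in (X * _)%E](probability_setT Q) [X in (_ * X)%E](probability_setT Q) mule1 ltry.
move=> B mB; rewrite /m' /= /pushforward.
have -> : merge K @^-1` rect B = rect (fun i => if i \in K then B i else setT) `*`
    rect (fun i => if i \in K then setT else B i).
  apply/seteqP; split=> -[v v'] /=.
    move=> vB; split=> i; have := vB i; rewrite tnth_mktuple; case: ifP => //.
  by move=> [vB vB'] i; rewrite tnth_mktuple; have := vB i; have := vB' i; case: ifP.
have mB1 i : measurable (if i \in K then B i else setT) by case: ifP.
have mB2 i : measurable (if i \in K then setT else B i) by case: ifP.
rewrite product_measure1E; [|exact: measurable_rect..].
rewrite [X in (X * _)%E](pQ _ mB1) [X in (_ * X)%E](pQ _ mB2) [RHS](pQ _ mB).
rewrite -big_split /=; apply: eq_bigr => i _; case: ifP => _.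
- by rewrite [X in (_ * X)%E](probability_setT Q) mule1.
- by rewrite [X in (X * _)%E](probability_setT Q) mul1e.
Qed.

Definition depends (K : {set 'I_n}) {T} (H : V -> T) :=
  forall v v' : V, (forall i, i \in K -> tnth v i = tnth v' i) -> H v = H v'.

End tuple_law.

Lemma measurable_sg {R : realType} : measurable_fun setT (@Num.sg R).
Proof.
have -> : @Num.sg R = (fun x => \1_(`]0, +oo[%classic : set R) x - \1_(`]-oo, 0[%classic : set R) x).
  apply/funext => x; rewrite !indicE !mem_setE !in_itv /= andbT.
  have [x0|x0|->] := ltgtP x 0.
  - by rewrite ltr0_sg //= sub0r.
  - by rewrite gtr0_sg //= subr0.
  - by rewrite sgr0 subr0.
by apply: measurable_funB; apply: measurable_indic; exact: measurable_itv.
Qed.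

(** * Independence and degeneracy under a product law *)

Section product_law.
Context {R : realType} (n : nat).
Local Notation V := (n.-tuple R).
Variable Q : probability V R.
Hypothesis pQ : product_law Q.
Implicit Types (K A : {set 'I_n}) (F G H Y : V -> R).

Lemma dependsS K A {T} (H : V -> T) : K \subset A -> depends K H -> depends A H.
Proof. by move=> /fintype.subsetP KA HK v v' vv; apply: HK => i /KA; exact: vv. Qed.

Lemma depends_comp K {T U} (H : V -> T) (h : T -> U) : depends K H -> depends K (h \o H).
Proof. by move=> HK v v' vv /=; rewrite (HK v v'). Qed.

Lemma depends2 K {T U W} (H : V -> T) (H' : V -> U) (h : T -> U -> W) :
  depends K H -> depends K H' -> depends K (fun v => h (H v) (H' v)).
Proof. by move=> HK HK' v v' vv; rewrite (HK v v')// (HK' v v'). Qed.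

Lemma depends_sum K I (r : seq I) (P : pred I) (H : I -> V -> R) :
  (forall i, P i -> depends K (H i)) -> depends K (fun v => \sum_(i <- r | P i) H i v).
Proof. by move=> HK v v' vv; apply: eq_bigr => i Pi; exact: HK. Qed.

Lemma depends_prod K I (r : seq I) (P : pred I) (H : I -> V -> R) :
  (forall i, P i -> depends K (H i)) -> depends K (fun v => \prod_(i <- r | P i) H i v).
Proof. by move=> HK v v' vv; apply: eq_bigr => i Pi; exact: HK. Qed.

Lemma depends_tnth K {T} (h : R -> T) i : i \in K -> depends K (fun v : V => h (tnth v i)).
Proof. by move=> iK v v' vv; rewrite vv. Qed.

Lemma depends_mergel K {T} (H : V -> T) v v' : depends K H -> H (merge K (v, v')) = H v.
Proof. by move=> HK; apply: HK => i iK; rewrite tnth_mktuple iK. Qed.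

Lemma depends_merger K {T} (H : V -> T) v v' : depends (~: K) H -> H (merge K (v, v')) = H v'.
Proof. by move=> HK; apply: HK => i; rewrite inE tnth_mktuple => /negbTE ->. Qed.

Lemma itg_merge K F : itg Q F -> itg (Q \x Q)%E (fun vv => F (merge K vv)).
Proof. by move=> iF; exact: itg_law (merge_law K pQ) _ iF. Qed.

Lemma Rintegral_merge K F : itg Q F ->
  \int[Q]_v F v = \int[Q]_v \int[Q]_v' F (merge K (v, v')).
Proof.
move=> iF; rewrite -(Rintegral_law (merge_law K pQ) iF).
by rewrite (Rintegral_fubini (itg_merge K iF)).
Qed.

Lemma itg_indep K G H : depends K G -> depends (~: K) H -> itg Q G -> itg Q H ->
  itg Q (fun v => G v * H v).
Proof.
move=> GK HK iG iH; have mG := itg_measurable iG; have mH := itg_measurable iH.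
apply: (itg_lawP (merge_law K pQ)); first exact: measurable_funM.
have E : (fun vv : V * V => G (merge K vv) * H (merge K vv)) =
    (fun vv => G vv.1 * H vv.2).
  by apply/funext => -[v v']; rewrite depends_mergel// depends_merger.
rewrite E; apply/integrable12ltyP.
  apply/measurable_EFinP; apply: measurable_funM.
  - exact: (measurableT_comp mG measurable_fst).
  - exact: (measurableT_comp mH measurable_snd).
have /integrableP[_ fG] := iG; have /integrableP[_ fH] := iH.
rewrite (_ : (\int[_]_x _)%E = (\int[Q]_x (`|(G x)%:E| * \int[Q]_y `|(H y)%:E|))%E); last first.
  apply: eq_integral => v _; rewrite -ge0_integralZl//; last first.
    by apply: measurableT_comp => //; exact/measurable_EFinP.
  by apply: eq_integral => v' _; rewrite -abseM -EFinM.
rewrite ge0_integralZr//; last 2 first.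
- by apply: measurableT_comp => //; exact/measurable_EFinP.
- by apply: integral_ge0 => v _.
by rewrite lte_mul_pinfty// ?integral_ge0// ge0_fin_numE// integral_ge0.
Qed.

Lemma Rintegral_indep K G H : depends K G -> depends (~: K) H -> itg Q G -> itg Q H ->
  \int[Q]_v (G v * H v) = (\int[Q]_v G v) * \int[Q]_v H v.
Proof.
move=> GK HK iG iH; rewrite (Rintegral_merge K) ?(itg_indep GK)//.
rewrite -RintegralZr//; apply: eq_Rintegral => v _; rewrite -RintegralZl//.
by apply: eq_Rintegral => v' _; rewrite depends_mergel// depends_merger.
Qed.

(* [Y] has vanishing conditional expectation given the coordinates other than [i]. *)
Definition degenerate (i : 'I_n) Y := forall H, measurable_fun setT H ->
  depends (~: [set i]) H -> itg Q (fun v => H v * Y v) -> \int[Q]_v (H v * Y v) = 0.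

(** Passes from indicators of events in the coordinates of A other than i to all admissible test
    functions H: the partial integral of Y over coordinate i depends on A minus i only, so the
    hypothesis already forces it to vanish almost everywhere. *)
Lemma degenerate_intro A i Y : depends A Y -> itg Q Y ->
  (forall D : set V, measurable D -> depends (A :\ i) D ->
     \int[Q]_v (\1_D v * Y v) = 0) -> degenerate i Y.
Proof.
move=> AY iY Y0; set K := ~: [set i].
(* A version of the conditional expectation of Y given all coordinates but i; [key] below is its
   defining property. *)
pose t v := \int[Q]_v' Y (merge K (v, v')).
have it : itg Q t := itg_fubini (itg_merge K iY).
have mt := itg_measurable it.
have tA : depends (A :\ i) t.
  move=> v w vw; apply: eq_Rintegral => u _; apply: AY => j jA.
  rewrite !tnth_mktuple; case: ifP => //; rewrite !inE => ji.
  by apply: vw; rewrite !inE ji.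
have key H : measurable_fun setT H -> depends K H -> itg Q (fun v => H v * Y v) ->
    \int[Q]_v (H v * Y v) = \int[Q]_v (H v * t v).
  move=> mH HK iHY; rewrite (Rintegral_merge K iHY) /Rintegral; congr fine.
  apply: ae_eq_integral => //.
  - exact: measurable_int (itg_fubini (itg_merge K iHY)).
  - by apply/measurable_EFinP; exact: measurable_funM.
  - move: (ae_integrable1 (itg_merge K iY)); apply: filterS => v iv _.
    rewrite /t -RintegralZl//; congr EFin; apply: eq_Rintegral => v' _.
    by rewrite depends_mergel.
(* Testing against the events t > 0 and t < 0 gives the integral of |t|. *)
have t0 : \int[Q]_v `|t v| = 0.
  pose D1 := [set v | 0 < t v]; pose D2 := [set v | t v < 0].
  have mD1 : measurable D1.
    rewrite (_ : D1 = setT `&` t @^-1` `]0, +oo[); first exact: mt.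
    by rewrite setTI; apply/seteqP; split => v /=; rewrite in_itv/= andbT.
  have mD2 : measurable D2.
    rewrite (_ : D2 = setT `&` t @^-1` `]-oo, 0[); first exact: mt.
    by rewrite setTI; apply/seteqP; split => v /=; rewrite in_itv/=.
  have D1A : depends (A :\ i) D1 by exact: (depends_comp (fun x : R => is_true (0 < x)) tA).
  have D2A : depends (A :\ i) D2 by exact: (depends_comp (fun x : R => is_true (x < 0)) tA).
  have AK : A :\ i \subset K by apply/fintype.subsetP => j; rewrite !inE => /andP[].
  have dI D : depends (A :\ i) D -> depends K (\1_D : V -> R).
    move=> /(dependsS AK) DK v v' vv; rewrite !indicE; congr (_%:R); congr nat_of_bool.
    by apply/idP/idP; rewrite !inE (DK _ _ vv).
  have iI D F : measurable D -> itg Q F -> itg Q (fun v => \1_D v * F v).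
    move=> mD iF; apply: (itg_le (g := fun v => `|F v|)); last first.
    - move=> v; rewrite normrM ler_piMl// indicE; case: (v \in D); rewrite ?normr1 ?normr0//.
    - exact: itg_norm.
    - by apply: measurable_funM; [exact: measurable_indic|exact: itg_measurable iF].
  have E : (fun v => `|t v|) = (fun v => \1_D1 v * t v - \1_D2 v * t v).
    apply/funext => v; rewrite !indicE; have [tv|tv|->] := ltgtP (t v) 0.
    - rewrite memNset ?mem_set// /D1 /= ?mul0r ?mul1r ?sub0r ?ltr0_norm//.
      by apply/negP; rewrite -leNgt ltW.
    - rewrite mem_set// memNset ?mul0r ?mul1r ?subr0 ?gtr0_norm//.
      by apply/negP; rewrite -leNgt ltW.
    - by rewrite normr0 !mulr0 subr0.
  rewrite E RintegralB//; [|exact: iI..].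
  rewrite -!key; [|exact: measurable_indic|exact: dI|exact: iI|exact: measurable_indic|exact: dI|exact: iI].
  by rewrite !Y0// subr0.
have tae : ae_eq Q setT (EFin \o t) (cst 0%E).
  apply/ae_eq_integral_abs => //; first exact/measurable_EFinP.
  by rewrite /= -(EFin_Rintegral (itg_norm it)) t0.
move=> H mH HK iHY; rewrite key//.
rewrite /Rintegral -[RHS]/(fine 0%E) -(integral0 Q setT); congr fine.
apply: ae_eq_integral => //.
- by apply/measurable_EFinP; exact: measurable_funM.
- by move: tae; apply: filterS => v /= tv _; have [->] := tv I; rewrite mulr0.
Qed.

(** An event depending on no coordinate has a constant indicator, so only the mean has to vanish. *)
Lemma degenerate_mean0 i Y : depends [set i] Y -> itg Q Y -> \int[Q]_v Y v = 0 ->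
  degenerate i Y.
Proof.
move=> Yi iY Y0; apply: (degenerate_intro Yi iY) => D mD.
rewrite finset.setDv => D0.
have E v v' : (\1_D v : R) = \1_D v'.
  rewrite !indicE; congr (_%:R); congr nat_of_bool.
  by apply/idP/idP; rewrite !inE (D0 v v')// => ?; rewrite inE.
pose v0 : V := [tuple 0 | _ < n].
transitivity (\int[Q]_v (\1_D v0 * Y v)).
  by apply: eq_Rintegral => v _; rewrite (E v v0).
by rewrite RintegralZl// Y0 mulr0.
Qed.

(** * Moments of sums of degenerate functions *)

Section moments.
Variables (a : R) (T : {set 'I_n} -> V -> R) (F : {set {set 'I_n}}).
Hypothesis a12 : 1 < a <= 2.
Hypothesis TA : forall A, A \in F -> depends A (T A).
Hypothesis iT : forall A, A \in F -> itg Q (T A).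
Hypothesis iTa : forall A, A \in F -> itg Q (fun v => powR `|T A v| a).
Hypothesis dT : forall A, A \in F -> forall i, i \in A -> degenerate i (T A).

Let mpow (f : V -> R) b : measurable_fun setT f -> measurable_fun setT (fun v => powR `|f v| b).
Proof.
move=> mf; apply: measurableT_comp (measurable_powR b) _.
exact: measurableT_comp.
Qed.

Let a1 : 1 < a. Proof. by case/andP: a12. Qed.
Let a2 : a <= 2. Proof. by case/andP: a12. Qed.

Lemma itg_powR_sum (E : {set {set 'I_n}}) : E \subset F ->
  itg Q (fun v => powR `|\sum_(A in E) T A v| a).
Proof.
move=> /fintype.subsetP EF.
have a02 : 0 <= a <= 2 by rewrite a2 (le_trans ler01 (ltW a1)).
have K (s : seq {set 'I_n}) : (forall A, A \in s -> A \in F) ->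
    itg Q (fun v => powR `|\sum_(A <- s) T A v| a).
  elim: s => [|A s IH] sF.
    under eq_fun do rewrite big_nil normr0; exact: itg_cst.
  have AF : A \in F by rewrite sF// mem_head.
  have sF' B : B \in s -> B \in F by move=> Bs; rewrite sF// inE Bs orbT.
  apply: (itg_le (g := fun v => 4 * (powR `|T A v| a + powR `|\sum_(A <- s) T A v| a))).
  - apply: mpow; apply: (itg_measurable (mu := Q)).
    by under eq_fun do rewrite big_seq; apply: itg_sum => B /sF; exact: iT.
  - by apply: itgZ; apply: itgD; [exact: iTa|exact: IH].
  - move=> v; rewrite big_cons ger0_norm ?powR_ge0//.
    rewrite (le_trans _ (powRD_le a02 _ _))//.
    by apply: ler_powR2r; rewrite ?ler_normD//; case/andP: a02.
have := K (enum E); under eq_fun do rewrite big_enum; apply.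
by move=> A; rewrite mem_enum; exact: EF.
Qed.

(* Von Bahr-Esseen type inequality. The coordinates in [s] are treated one at a
   time: splitting the family according to whether the index [i] belongs to [A],
   the first order term of the expansion vanishes by degeneracy. *)
Lemma moment_sum_le_seq (s : seq 'I_n) (E : {set {set 'I_n}}) : E \subset F ->
  (forall A B i, A \in E -> B \in E -> i \notin s -> (i \in A) = (i \in B)) ->
  \int[Q]_v powR `|\sum_(A in E) T A v| a <=
    \sum_(A in E) 4 ^+ count (fun i => i \in A) s * \int[Q]_v powR `|T A v| a.
Proof.
elim: s E => [|i s IH] E EF Es.
  (* No coordinate is left, so all members of [E] coincide: the family is empty or a singleton. *)
  have [->|[A AE]] := set_0Vmem E.
    rewrite big_set0; under eq_Rintegral do rewrite big_set0 normr0 powR0 ?gt_eqF ?(lt_trans ltr01)//.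
    by rewrite Rintegral_cst// mul0r.
  have -> : E = [set A]%SET.
    apply/setP => B; rewrite inE; apply/idP/eqP => [BE|->//].
    by apply/setP => j; exact: Es.
  by rewrite big_set1 mul1r; under eq_Rintegral do rewrite big_set1.
pose E0 := [set A in E | i \notin A]%SET; pose E1 := [set A in E | i \in A]%SET.
have E0E : E0 \subset E by apply/fintype.subsetP => A; rewrite inE => /andP[].
have E1E : E1 \subset E by apply/fintype.subsetP => A; rewrite inE => /andP[].
have E0F := fintype.subset_trans E0E EF; have E1F := fintype.subset_trans E1E EF.
have split (f : {set 'I_n} -> R) : \sum_(A in E) f A = \sum_(A in E0) f A + \sum_(A in E1) f A.
  rewrite (bigID (fun A => i \in A)) /= addrC; congr (_ + _).
  - by apply: eq_bigl => A; rewrite inE.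
  - by apply: eq_bigl => A; rewrite inE.
have iE0 := itg_powR_sum E0F; have iE1 := itg_powR_sum E1F.
have inF (E' : {set {set 'I_n}}) A : E' \subset F -> A \in E' -> A \in F by move=> /fintype.subsetP E'F /E'F.
have iS (E' : {set {set 'I_n}}) : E' \subset F -> itg Q (fun v => \sum_(A in E') T A v).
  by move=> GF; apply: itg_sum => A AG; apply: iT; exact: inF AG.
pose W v := dpow a (\sum_(A in E0) T A v).
have mW : measurable_fun setT W.
  have mS := itg_measurable (iS _ E0F).
  rewrite /W /dpow; apply: measurable_funM; last exact: mpow.
  exact: measurableT_comp measurable_sg mS.
have iWT A : A \in F -> itg Q (fun v => W v * T A v).
  move=> AF; apply: (itg_le (g := fun v => powR `|\sum_(A in E0) T A v| a + powR `|T A v| a)).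
  - by apply: measurable_funM => //; apply: (itg_measurable (iT AF)).
  - by apply: itgD => //; exact: iTa.
  - by move=> v; rewrite normrM norm_dpow// powR_mean_le.
have WT0 : \int[Q]_v (W v * \sum_(A in E1) T A v) = 0.
  under eq_Rintegral do rewrite mulr_sumr.
  rewrite Rintegral_sum; last by move=> A /(inF _ _ E1F); exact: iWT.
  apply: big1 => A AE1; have AF := inF _ _ E1F AE1.
  apply: (dT AF (i := i)) => //; last exact: iWT.
    by move: AE1; rewrite inE => /andP[].
  apply: (depends_comp (dpow a)); apply: depends_sum => B BE0.
  apply: dependsS (TA (inF _ _ E0F BE0)).
  by apply/fintype.subsetP => j jB; rewrite !inE; apply: contraTneq jB => ->; move: BE0; rewrite inE => /andP[].
have iWT1 : itg Q (fun v => W v * \sum_(A in E1) T A v).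
  under eq_fun do rewrite mulr_sumr.
  by apply: itg_sum => A /(inF _ _ E1F); exact: iWT.
have agree (E' : {set {set 'I_n}}) : E' \subset E -> (forall A B, A \in E' -> B \in E' -> (i \in A) = (i \in B)) ->
    forall A B j, A \in E' -> B \in E' -> j \notin s -> (j \in A) = (j \in B).
  move=> /fintype.subsetP GE Gi A B j AG BG js; have [->|ji] := eqVneq j i; first exact: Gi.
  by apply: Es; rewrite ?GE// inE negb_or ji.
have {}agree0 := agree _ E0E; have {}agree1 := agree _ E1E.
have h0 : \int[Q]_v powR `|\sum_(A in E0) T A v| a <=
    \sum_(A in E0) 4 ^+ count (fun i => i \in A) s * \int[Q]_v powR `|T A v| a.
  by apply: IH => //; apply: agree0 => A B; rewrite !inE => /andP[_ /negbTE ->] /andP[_ /negbTE ->].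
have h1 : \int[Q]_v powR `|\sum_(A in E1) T A v| a <=
    \sum_(A in E1) 4 ^+ count (fun i => i \in A) s * \int[Q]_v powR `|T A v| a.
  by apply: IH => //; apply: agree1 => A B; rewrite !inE => /andP[_ ->] /andP[_ ->].
rewrite split.
(* The factor 4 of the expansion falls only on the sets containing i, which is why the final
   exponent counts the elements of A. *)
apply: (@le_trans _ _ (\int[Q]_v (powR `|\sum_(A in E0) T A v| a +
   a * (W v * \sum_(A in E1) T A v) + 4 * powR `|\sum_(A in E1) T A v| a))).
  apply: ler_Rintegral; first exact: itg_powR_sum.
    by apply: itgD; [apply: itgD => //; exact: itgZ|exact: itgZ].
  by move=> v; rewrite split; exact: powR_norm_expand.
rewrite RintegralD//; [|by apply: itgD => //; exact: itgZ|exact: itgZ].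
rewrite RintegralD//; [|exact: itgZ].
rewrite !RintegralZl// WT0 mulr0 addr0; apply: lerD.
  apply: le_trans h0 _; apply: ler_sum => A; rewrite inE => /andP[_ /negbTE iA].
  by rewrite /= iA add0n.
apply: le_trans (ler_wpM2l _ h1) _ => //.
rewrite mulr_sumr; apply: ler_sum => A; rewrite inE => /andP[_ iA].
by rewrite /= iA exprS mulrA.
Qed.

Lemma moment_sum_le (E : {set {set 'I_n}}) : E \subset F ->
  \int[Q]_v powR `|\sum_(A in E) T A v| a <=
    \sum_(A in E) 4 ^+ #|A| * \int[Q]_v powR `|T A v| a.
Proof.
move=> EF; have := @moment_sum_le_seq (enum 'I_n) E EF.
move=> /(_ _)/le_trans; apply; first by move=> A B i _ _; rewrite mem_enum.
apply: ler_sum => A _; rewrite (_ : count _ _ = #|A|)//.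
by rewrite -sum1_count -sum1_card big_enum_cond.
Qed.

End moments.

End product_law.

(** * The linear part *)

Section linear_part.
Context {R : realType} (n : nat).
Local Notation V := (n.-tuple R).
Variable Q : probability V R.
Hypothesis pQ : product_law Q.
Hypothesis permQ : forall s : {perm 'I_n},
  has_law Q (fun v : V => [tuple tnth v (s i) | i < n]) Q.
Variables (l : R -> R) (i0 : 'I_n).
Hypothesis ml : measurable_fun setT l.

Definition summand (i : 'I_n) (v : V) : R := l (tnth v i).
Local Notation L := summand.

Lemma measurable_summand i : measurable_fun setT (L i).
Proof. exact: measurableT_comp ml (measurable_tnth i). Qed.

Lemma depends_summand (K : {set 'I_n}) i : i \in K -> depends K (L i).
Proof. exact: depends_tnth. Qed.

Lemma summand_perm i v : 
  L i0 [tuple tnth v (tperm i0 i j) | j < n] = L i v.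
Proof. by rewrite /summand tnth_mktuple tpermL. Qed.

Lemma itg_summand (h : R -> R) i :
  itg Q (fun v => h (L i0 v)) -> itg Q (fun v => h (L i v)).
Proof.
move=> ih; have := itg_law (permQ (tperm i0 i)) ih.
by under eq_fun do rewrite summand_perm.
Qed.

Lemma Rintegral_summand (h : R -> R) i : itg Q (fun v => h (L i0 v)) ->
  \int[Q]_v h (L i v) = \int[Q]_v h (L i0 v).
Proof.
move=> ih; rewrite -[RHS](Rintegral_law (permQ (tperm i0 i)) ih).
by apply: eq_Rintegral => v _; rewrite summand_perm.
Qed.

Lemma Rintegral_prod_summand (phi : 'I_n -> R -> R) (s : seq 'I_n) : uniq s ->
  (forall i, itg Q (fun v => phi i (L i v))) ->
  itg Q (fun v => \prod_(i <- s) phi i (L i v)) /\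
  \int[Q]_v (\prod_(i <- s) phi i (L i v)) = \prod_(i <- s) \int[Q]_v phi i (L i v).
Proof.
move=> + iphi; elim: s => [_|i s IH /= /andP[is_ us]].
  split; first by under eq_fun do rewrite big_nil; exact: itg_cst.
  under eq_Rintegral do rewrite big_nil.
  by rewrite Rintegral_probability_cst big_nil.
have [iP EP] := IH us.
have d1 : depends [set i] (fun v => phi i (L i v)).
  by apply: (depends_comp (phi i)); apply: depends_summand; rewrite inE.
have d2 : depends (~: [set i]) (fun v => \prod_(j <- s) phi j (L j v)).
  move=> v v' vv; rewrite big_seq [RHS]big_seq; apply: eq_bigr => j js.
  rewrite /summand vv// !inE; by apply: contraNneq is_ => <-.
have := itg_indep pQ d1 d2 (iphi i) iP; have := Rintegral_indep pQ d1 d2 (iphi i) iP.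
rewrite EP => E I; split; first by under eq_fun do rewrite big_cons.
by under eq_Rintegral do rewrite big_cons; rewrite E big_cons.
Qed.

Hypothesis iL3 : itg Q (fun v => `|L i0 v| ^+ 3).
Hypothesis L1 : \int[Q]_v L i0 v = 0.
Hypothesis L2 : n%:R * \int[Q]_v L i0 v ^+ 2 = 1.

Let mL0 := measurable_summand i0.
Let iL : itg Q (L i0) := itg_moment1 mL0 iL3.
Let iL2 : itg Q (fun v => L i0 v ^+ 2) := itg_moment2 mL0 iL3.

Let n0 : (0 < n)%N. Proof. exact: leq_ltn_trans (leq0n i0) (ltn_ord i0). Qed.
Let nR0 : 0 < n%:R :> R. Proof. by rewrite ltr0n. Qed.

(** Connects the sample with the averaging operators: each coordinate is split off by [merge], and
    exchangeability lets the law of L at [i0] serve for all summands. *)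
Lemma Rintegral_sum_summand (K : R) (h : R -> R) (s : seq 'I_n) x : uniq s -> lip K h ->
  \int[Q]_v h (x + \sum_(i <- s) L i v) = iter (size s) (average Q (L i0)) h x.
Proof.
move=> + hK; elim: s x => [|i s IH] x /=.
  move=> _; under eq_Rintegral do rewrite big_nil addr0.
  by rewrite Rintegral_probability_cst.
move=> /andP[is_ us].
have iLi j : itg Q (L j) by exact: (itg_summand (h := id)).
have iS (r : seq 'I_n) : itg Q (fun v => \sum_(j <- r) L j v) by apply: itg_sum => j _.
have lipA m : lip K (iter m (average Q (L i0)) h).
  by elim: m => //= m IHm; exact: average_lip.
rewrite (Rintegral_merge pQ [set i]); last by apply: (itg_lip _ _ _ hK) => //; exact: itg_measurable (iS _).
transitivity (\int[Q]_v iter (size s) (average Q (L i0)) h (x + L i v)).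
  apply: eq_Rintegral => v _; rewrite -IH//; apply: eq_Rintegral => v' _.
  rewrite big_cons addrA /summand tnth_mktuple inE eqxx; congr (h (_ + _)).
  rewrite big_seq [RHS]big_seq; apply: eq_bigr => j js.
  by rewrite tnth_mktuple inE; case: eqP is_ => // <-; rewrite js.
rewrite (Rintegral_summand (h := fun y => iter (size s) (average Q (L i0)) h (x + y)))//.
exact: (itg_lip _ _ iL (lipA _)).
Qed.

Definition beta3 := n%:R * \int[Q]_v `|L i0 v| ^+ 3.

(* Integrate [2 y^3 + b^3 >= 3 b y^2] with [b = n^{-1/2}]. *)
Lemma beta3_ge : (Num.sqrt n%:R)^-1 <= beta3.
Proof.
set b := (Num.sqrt n%:R)^-1; have b0 : 0 < b by rewrite invr_gt0 sqrtr_gt0.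
have nb2 : n%:R * b ^+ 2 = 1.
  by rewrite /b exprVn sqr_sqrtr ?ler0n// divff// gt_eqF.
have H : \int[Q]_v (3 * b * L i0 v ^+ 2) <= \int[Q]_v (2 * `|L i0 v| ^+ 3 + b ^+ 3).
  apply: ler_Rintegral; first exact: itgZ.
    by apply: itgD; [exact: itgZ|exact: itg_cst].
  move=> v; rewrite -[L i0 v ^+ 2]real_normK ?num_real//.
  have := normr_ge0 (L i0 v); move: `|L i0 v| => y y0; rewrite -subr_ge0.
  rewrite (_ : _ - _ = (y - b) ^+ 2 * (2 * y + b)); last by ring.
  by rewrite mulr_ge0 ?sqr_ge0// addr_ge0// ?mulr_ge0// ltW.
move: H; rewrite RintegralD; [|by []|exact: itgZ|exact: itg_cst].
rewrite Rintegral_probability_cst !RintegralZl// => /(ler_wpM2l (ltW nR0)).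
rewrite mulrDr [n%:R * (2 * _)]mulrCA -/beta3 [n%:R * (3 * b * _)]mulrCA L2 mulr1.
rewrite (_ : n%:R * b ^+ 3 = n%:R * b ^+ 2 * b); last by ring.
rewrite nb2; lra.
Qed.

Lemma beta3_gt0 : 0 < beta3.
Proof. by apply: lt_le_trans beta3_ge; rewrite invr_gt0 sqrtr_gt0. Qed.

Lemma invn_le_beta3 : n%:R^-1 <= beta3.
Proof.
apply: le_trans beta3_ge; rewrite lef_pV2 ?posrE ?sqrtr_gt0//.
have n1 : 1 <= Num.sqrt n%:R :> R.
  by rewrite -[leLHS]sqrtr1 ler_sqrt ?ler1n ?ler0n.
by rewrite -[leRHS](sqr_sqrtr (ltW nR0)) expr2 ler_peMl// sqrtr_ge0.
Qed.

(** The normal law is split into n Gaussian steps of standard deviation s = n^(-1/2). Their third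
    moments total at most 2 n s^3 = 2 s <= 2 beta, which with beta from the L_i gives the 3. *)
Lemma normal_approx M (h : R -> R) : smooth3 M h ->
  `|\int[Q]_v h (\sum_(i < n) L i v) - \int[normal_prob 0 1]_x h x| <= 3 * M * beta3.
Proof.
move=> hM; have [h1 [h2 [[K hK] _ _ hT]]] := hM.
have M0 : 0 <= M.
  by have := le_trans (normr_ge0 _) (hT 0 1); rewrite normr1 expr1n mulr1.
pose s : R := (Num.sqrt n%:R)^-1; have s0 : 0 < s by rewrite invr_gt0 sqrtr_gt0.
have s2 : s ^+ 2 = n%:R^-1 by rewrite exprVn sqr_sqrtr ?ltW.
have := Rintegral_sum_summand 0 (enum_uniq 'I_n) hK.
rewrite size_enum_ord.
have -> : \int[Q]_v h (0 + \sum_(i <- enum 'I_n) L i v) = \int[Q]_v h (\sum_(i < n) L i v).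
  by apply: eq_Rintegral => v _; rewrite add0r big_enum.
move=> ->.
have -> : \int[normal_prob 0 1]_x h x = iter n (gaussian s) h 0.
  rewrite -(prednK n0) (iter_gaussian (t := 1) (K := K))//.
    by apply: eq_Rintegral => x _; rewrite add0r.
  by rewrite prednK// s2 expr1n divff// gt_eqF.
have mid : measurable_fun setT (fun z : measurableTypeR R => z : R) by [].
have LZ : \int[Q]_v L i0 v ^+ 2 = \int[normal_prob 0 s]_z z ^+ 2.
  rewrite normal_second_moment// s2; apply: (mulfI (lt0r_neq0 nR0)).
  by rewrite L2 divff// gt_eqF.
apply: le_trans (lindeberg mL0 iL3 L1 mid (itg_normal_third s0) (normal_mean s0) LZ 0 n hM) _.
rewrite mulrCA mulrDr [3 * M]mulrC -mulrA ler_wpM2l// -/beta3.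
have := ler_wpM2l (ltW nR0) (normal_third_moment s0).
have -> : n%:R * (2 * s ^+ 3) = 2 * s.
  by rewrite exprSr s2; field; rewrite gt_eqF.
by have := beta3_ge; rewrite -/s; lra.
Qed.

Lemma average_summand_le M (g g' g'' : R -> R) (K : R) x : lip K g ->
  (forall z : R, is_derive z 1 g (g' z)) ->
  (forall z : R, is_derive z 1 g' (g'' z)) -> (forall z, `|g'' z| <= M) ->
  `|average Q (L i0) g x - g x| <= M * n%:R^-1.
Proof.
move=> gK dg dg' gM.
have -> : M / n%:R = \int[Q]_v (M * L i0 v ^+ 2).
  rewrite RintegralZl//; congr (_ * _); apply: (mulfI (lt0r_neq0 nR0)).
  by rewrite L2 divff// gt_eqF.
have ig := itg_lip mL0 x iL gK.
have -> : average Q (L i0) g x - g x = \int[Q]_v (g (x + L i0 v) - g x - g' x * L i0 v).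
  rewrite RintegralB//; [|by apply: itgB => //; exact: itg_cst|exact: itgZ].
  rewrite RintegralB//; last exact: itg_cst.
  by rewrite RintegralZl// L1 mulr0 subr0 Rintegral_probability_cst.
apply: ler_norm_Rintegral.
- apply: (itg_measurable (mu := Q)); apply: itgB; last exact: itgZ.
  by apply: itgB => //; exact: itg_cst.
- exact: itgZ.
- move=> v; rewrite -[L i0 v ^+ 2]real_normK ?num_real//.
  exact: taylor1 dg dg' gM.
Qed.

(* Leaving out the summands in [A] costs [#|A| / n]. *)
Lemma normal_approx_partial (A : {set 'I_n}) M (gd : nat -> R -> R) :
  (forall j, (j < 3)%N -> forall z : R, is_derive z 1 (gd j) (gd j.+1 z)) ->
  (forall j, (0 < j <= 3)%N -> forall z, `|gd j z| <= M) ->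
  `|\int[Q]_v gd 0%N (\sum_(i in ~: A) L i v) - \int[normal_prob 0 1]_x gd 0%N x|
    <= (#|A|%:R + 3) * M * beta3.
Proof.
move=> dg gM.
have M0 : 0 <= M by rewrite (le_trans _ (gM 1%N _ 0)).
have glip j : (j < 3)%N -> lip M (gd j).
  move=> j3 x y; have := mean_value_le y (x - y) (dg j j3) (gM j.+1 j3).
  by rewrite [y + _]addrC subrK.
have g3 : smooth3 M (gd 0%N).
  exists (gd 1%N), (gd 2%N); split; [by exists M; exact: glip..|].
  by move=> x a; exact: (taylor2 x a (dg 0%N isT) (dg 1%N isT) (dg 2%N isT) (gM 3%N isT)).
have := normal_approx g3.
set G := \int[normal_prob 0 1]_x _ => NA.
pose avg := average Q (L i0).
have E1 : \int[Q]_v gd 0%N (\sum_(i in ~: A) L i v) = iter #|~: A| avg (gd 0%N) 0.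
  have := Rintegral_sum_summand 0 (enum_uniq (~: A)) (glip 0%N isT).
  rewrite -cardE => <-; apply: eq_Rintegral => v _.
  by rewrite add0r big_enum.
have E2 : \int[Q]_v gd 0%N (\sum_(i < n) L i v) = iter (#|A| + #|~: A|) avg (gd 0%N) 0.
  have := Rintegral_sum_summand 0 (enum_uniq 'I_n) (glip 0%N isT).
  rewrite size_enum_ord cardsC card_ord => <-; apply: eq_Rintegral => v _.
  by rewrite add0r big_enum.
have lipA (h : R -> R) m : lip M h -> lip M (iter m avg h).
  by move=> hM; elim: m => //= m IHm; exact: average_lip.
have step m x : `|iter m avg (gd 0%N) x - gd 0%N x| <= m%:R * (M / n%:R).
  elim: m x => [|m IH] x; first by rewrite subrr normr0 mul0r.
  rewrite iterS -natr1 mulrDl mul1r.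
  have h1 := average_bound mL0 iL (lipA _ m (glip 0%N isT)) (glip 0%N isT) IH x.
  have h2 := average_summand_le x (glip 0%N isT) (dg 0%N isT) (dg 1%N isT) (gM 2%N isT).
  by move: h1 h2; rewrite -/avg !ler_norml; lra.
have stepA m B (u w : R -> R) : lip M u -> lip M w -> (forall x, `|u x - w x| <= B) ->
    forall x, `|iter m avg u x - iter m avg w x| <= B.
  move=> uM wM uw; elim: m => [//|m IH] x; rewrite !iterS.
  exact: (average_bound mL0 iL (lipA _ m uM) (lipA _ m wM) IH x).
have E3 : `|iter (#|A| + #|~: A|) avg (gd 0%N) 0 - iter #|~: A| avg (gd 0%N) 0|
    <= #|A|%:R * (M / n%:R).
  (* The surplus |A| averagings are put innermost, next to [gd 0], where each moves it by at most M
     / n; the outer ones contract. *)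
  rewrite addnC iterD; apply: stepA; [exact: lipA (glip 0%N isT)|exact: glip|exact: step].
have : #|A|%:R * (M / n%:R) <= #|A|%:R * M * beta3.
  by rewrite -mulrA ler_wpM2l// ler_wpM2l// invn_le_beta3.
move: NA E3; rewrite E1 E2 !ler_norml; lra.
Qed.

End linear_part.

(** * The degenerate part *)

Section integrability.
Context {d} {S : measurableType d} {R : realType} (mu : probability S R).

Lemma itg_lip_comp K (h : R -> R) (Y : S -> R) : lip K h -> itg mu Y ->
  itg mu (fun s => h (Y s)).
Proof.
move=> hK iY; have := itg_lip (itg_measurable iY) 0 iY hK.
by under eq_fun do rewrite add0r.
Qed.

Lemma itg_bounded_mul C (H Y : S -> R) : measurable_fun setT H ->
  (forall s, `|H s| <= C) -> itg mu Y -> itg mu (fun s => H s * Y s).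
Proof.
move=> mH HC iY; apply: (itg_le (g := fun s => C * `|Y s|)).
- by apply: measurable_funM => //; exact: itg_measurable iY.
- by apply: itgZ; exact: itg_norm.
- by move=> s; rewrite normrM ler_wpM2r.
Qed.

End integrability.

Lemma mixed_diff_bounded {R : realType} (g : R -> R) M y (s : seq R) :
  (forall z, `|g z| <= M) -> `|mixed_diff g y s| <= 2 ^+ size s * M.
Proof.
move=> gM; elim: s y => [|a s IH] y /=; first by rewrite mul1r.
rewrite (le_trans (ler_normB _ _))// exprS -mulrA mulrDl mul1r.
exact: lerD.
Qed.

(** Young's inequality for the conjugate exponents a and q, without the factors 1/a and 1/q. It
    separates T_A from the functions of the L_i. *)
Lemma young_powR {R : realType} (a x w : R) : 1 < a -> 0 <= w ->
  `|x| * w <= powR `|x| a + powR w (a / (a - 1)).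
Proof.
move=> a1 w0; have a0 : 0 < a by lra.
have am : 0 < a - 1 by lra.
have q0 : 0 < a / (a - 1) by rewrite divr_gt0.
have conj : a^-1 + (a / (a - 1))^-1 = 1 by field; lra.
apply: le_trans (conjugate_powR (normr_ge0 x) w0 a0 q0 conj) _.
apply: lerD.
- by rewrite ler_pdivrMr// ler_peMr ?powR_ge0// ltW.
- rewrite ler_pdivrMr// ler_peMr ?powR_ge0// ler_pdivlMr//; lra.
Qed.

Lemma powR_prod {R : realType} (I : Type) (r : seq I) (F : I -> R) q :
  (forall i, 0 <= F i) -> powR (\prod_(i <- r) F i) q = \prod_(i <- r) powR (F i) q.
Proof.
move=> F0; elim: r => [|i r IH]; first by rewrite !big_nil powR1.
by rewrite !big_cons powRM ?IH// prodr_ge0.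
Qed.

Lemma sum_card_le {R : realType} (n j : nat) (m : R) : 0 <= m ->
  \sum_(A : {set 'I_n} | #|A| == j) m ^+ j <= (n%:R * m) ^+ j.
Proof.
move=> m0; rewrite sumr_const -[leLHS]mulr_natl exprMn ler_wpM2r ?exprn_ge0//.
rewrite -natrX ler_nat (eq_card (B := [set A : {set 'I_n} | #|A| == j]%SET)); last first.
  by move=> A; rewrite !inE.
rewrite card_draws card_ord.
(* The binomial coefficient is at most n^j, by induction through (j+1) C(n+1, j+1) = (n+1) C(n,
   j). *)
elim: j {m m0} n => [|j IH] n; first by rewrite bin0.
case: n => [|n]; first by rewrite bin0n.
rewrite -(leq_pmul2l (ltn0Sn j)) -mul_bin_diag expnS mulnA.
apply: leq_trans (leq_mul (leqnn n.+1) (IH n)) _.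
apply: leq_mul; first exact: leq_pmull.
by case: (posnP j) => [->|j0]; rewrite ?expn0 ?leq_exp2r ?leqnSn.
Qed.

Section degenerate_part.
Context {R : realType} (n : nat).
Local Notation V := (n.-tuple R).
Variable Q : probability V R.
Hypothesis pQ : product_law Q.
Hypothesis permQ : forall s : {perm 'I_n},
  has_law Q (fun v : V => [tuple tnth v (s i) | i < n]) Q.
Variables (l : R -> R) (i0 : 'I_n).
Hypothesis ml : measurable_fun setT l.
Local Notation L := (@summand R n l).
Hypothesis iL3 : itg Q (fun v => `|L i0 v| ^+ 3).
Hypothesis L1 : \int[Q]_v L i0 v = 0.
Hypothesis L2 : n%:R * \int[Q]_v L i0 v ^+ 2 = 1.
Let mL i : measurable_fun setT (L i) := measurable_summand ml i.
Let iL i : itg Q (L i).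
Proof. exact: (itg_summand (h := id) permQ _ (itg_moment1 (mL i0) iL3)). Qed.

Variables (a : R) (k : nat) (T : {set 'I_n} -> V -> R).
Hypothesis a12 : 1 < a < 2.
Definition small_sets := [set A : {set 'I_n} | (0 < #|A| <= k)%N]%SET.
Local Notation F := small_sets.
Hypothesis TA : forall A, A \in F -> depends A (T A).
Hypothesis iT : forall A, A \in F -> itg Q (T A).
Hypothesis iTa : forall A, A \in F -> itg Q (fun v => powR `|T A v| a).
Hypothesis dT : forall A, A \in F -> forall i, i \in A -> degenerate Q i (T A).

Local Notation S := (fun v => \sum_(i < n) L i v).
Local Notation TT := (fun v => \sum_(A in F) T A v).
Local Notation tau A := (\int[Q]_v powR `|T A v| a).
Local Notation q := (a / (a - 1)).

Let a1 : 1 < a. Proof. by case/andP: a12. Qed.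
Let a2 : a < 2. Proof. by case/andP: a12. Qed.
Let q2 : 2 < q. Proof. by have := a1; have := a2 => ? ?; rewrite ltr_pdivlMr; lra. Qed.
Let q0 : 0 <= q. Proof. by apply: ltW; apply: lt_trans q2. Qed.

Let iS (r : seq 'I_n) (P : pred 'I_n) : itg Q (fun v => \sum_(i <- r | P i) L i v).
Proof. by apply: itg_sum => i _. Qed.
Let iTT : itg Q TT.
Proof. by apply: itg_sum => A; exact: iT. Qed.

Lemma tau_ge0 A : 0 <= tau A.
Proof. by apply: Rintegral_ge0 => v _; exact: powR_ge0. Qed.

(** The pointwise Taylor error is of order |T|^a, as only a-th moments of T are at hand; the moment
    inequality then costs 4^|A| <= 4^k for each set. *)
Lemma taylor_remainder (f f' f'' : R -> R) M :
  (forall z : R, is_derive z 1 f (f' z)) -> (forall z : R, is_derive z 1 f' (f'' z)) ->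
  (forall z, `|f' z| <= M) -> (forall z, `|f'' z| <= M) ->
  `|\int[Q]_v f (S v + TT v) - \int[Q]_v f (S v) - \sum_(A in F) \int[Q]_v (f' (S v) * T A v)|
    <= 2 * M * 4 ^+ k * \sum_(A in F) tau A.
Proof.
move=> df df' fM f'M.
have lipd g g' : (forall z : R, is_derive z 1 g (g' z)) -> (forall z, `|g' z| <= M) -> lip M g.
  by move=> dg gM x y; have := mean_value_le y (x - y) dg gM; rewrite [y + _]addrC subrK.
have fl := lipd _ _ df fM; have f'l := lipd _ _ df' f'M.
have mf' : measurable_fun setT (fun v => f' (S v)).
  exact: itg_measurable (itg_lip_comp f'l (iS _ _)).
have i1 := itg_lip_comp fl (itgD (iS (index_enum 'I_n) xpredT) iTT).
have i2 := itg_lip_comp fl (iS (index_enum 'I_n) xpredT).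
have i3 A : A \in F -> itg Q (fun v => f' (S v) * T A v).
  by move=> AF; apply: (itg_bounded_mul _ _ (iT AF)).
rewrite -Rintegral_sum// -RintegralB//.
have i4 : itg Q (fun v => \sum_(A in F) f' (S v) * T A v) by exact: itg_sum.
rewrite -RintegralB//; last exact: itgB.
have a12' : 1 < a <= 2 by rewrite a1 ltW.
have M0 : 0 <= M by rewrite (le_trans _ (fM 0)).
have iM := itg_powR_sum a12' iT iTa (fintype.subxx F).
apply: (@le_trans _ _ (\int[Q]_v (2 * M * powR `|TT v| a))).
  apply: ler_norm_Rintegral.
  - by apply: (itg_measurable (mu := Q)); apply: itgB => //; exact: itgB.
  - exact: itgZ.
  - move=> v; rewrite -mulr_sumr; apply: taylor_powR df df' fM f'M.
    by rewrite !ltW.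
rewrite RintegralZl// -mulrA ler_wpM2l ?mulr_ge0//.
apply: le_trans (moment_sum_le a12' TA iT iTa dT (fintype.subxx F)) _.
rewrite mulr_sumr; apply: ler_sum => A; rewrite inE => /andP[_ Ak].
by rewrite ler_wpM2r ?tau_ge0// ler_eXn2l// ltr1n.
Qed.

Lemma measurable_mixed_diff (g : R -> R) (y : V -> R) (s : seq 'I_n) : measurable_fun setT g ->
  measurable_fun setT y ->
  measurable_fun setT (fun v => mixed_diff g (y v) [seq L i v | i <- s]).
Proof.
move=> mg; elim: s y => [|i s IH] y my /=; first exact: measurableT_comp mg my.
by apply: measurable_funB; apply: IH => //; exact: measurable_funD.
Qed.

(* Degeneracy kills all the terms of the mixed difference except [g (S v)]. *)
Lemma degenerate_mixed_diff A (g : R -> R) C : A \in F -> measurable_fun setT g ->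
  (forall z, `|g z| <= C) ->
  \int[Q]_v (g (S v) * T A v) =
  \int[Q]_v (mixed_diff g (\sum_(i in ~: A) L i v) [seq L i v | i <- enum A] * T A v).
Proof.
move=> AF mg gC.
have key (s : seq 'I_n) : uniq s -> {subset s <= A} ->
    \int[Q]_v (g (S v) * T A v) =
    \int[Q]_v (mixed_diff g (\sum_(i | i \notin s) L i v) [seq L i v | i <- s] * T A v).
  elim: s => [_ _|i s IH /= /andP[is_ us] sA].
    by apply: eq_Rintegral => v _ /=; congr (g _ * _); apply: eq_bigl.
  rewrite IH//; last by move=> j js; apply: sA; rewrite inE js orbT.
  (* [U] keeps L_i in its base point and [W] has it removed. Their difference is the next mixed
     difference, and [W] times T_A integrates to zero because [W] ignores coordinate i. *)
  pose W v := mixed_diff g (\sum_(j | j \notin i :: s) L j v) [seq L j v | j <- s].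
  pose U v := mixed_diff g (\sum_(j | j \notin s) L j v) [seq L j v | j <- s].
  have bd (y : R) v : `|mixed_diff g y [seq L j v | j <- s]| <= 2 ^+ size s * C.
    by rewrite -(size_map (fun j => L j v)); exact: mixed_diff_bounded.
  have mS (P : pred 'I_n) : measurable_fun setT (fun v => \sum_(j | P j) L j v).
    exact: itg_measurable (iS _ P).
  have iW : itg Q (fun v => W v * T A v).
    apply: (itg_bounded_mul _ _ (iT AF)); first exact: measurable_mixed_diff.
    by move=> v; exact: bd.
  have iU : itg Q (fun v => U v * T A v).
    apply: (itg_bounded_mul _ _ (iT AF)); first exact: measurable_mixed_diff.
    by move=> v; exact: bd.
  have W0 : \int[Q]_v (W v * T A v) = 0.
    apply: (dT AF (i := i)) => //; first by apply: sA; rewrite mem_head.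
      exact: measurable_mixed_diff.
    move=> v v' vv; rewrite /W.
    have E j : j != i -> L j v = L j v' by move=> ji; rewrite /summand vv// !inE.
    congr mixed_diff.
      by apply: eq_bigr => j; rewrite inE negb_or => /andP[ji _]; exact: E.
    by apply/eq_in_map => j js; apply: E; apply: contraNneq is_ => <-.
  transitivity (\int[Q]_v (U v * T A v) - \int[Q]_v (W v * T A v)).
    by rewrite W0 subr0.
  rewrite -RintegralB//; apply: eq_Rintegral => v _.
  rewrite -mulrBl; congr ((mixed_diff g _ _ - _) * _).
  rewrite (bigD1 i)//= addrC; congr (_ + _); apply: eq_bigl => j.
  by rewrite inE negb_or andbC.
rewrite (key (enum A)) ?enum_uniq//; last by move=> i; rewrite mem_enum.
apply: eq_Rintegral => v _; congr (mixed_diff _ _ _ * _).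
by apply: eq_bigl => i; rewrite mem_enum inE.
Qed.

(** The share of the set A in kappa_|A|; see [kappa_law]. *)
Definition kap (A : {set 'I_n}) := \int[Q]_v ((\prod_(i in A) L i v) * T A v).

Lemma itg_mul_T A (w : V -> R) : A \in F -> measurable_fun setT w ->
  itg Q (fun v => powR `|w v| q) -> itg Q (fun v => w v * T A v).
Proof.
move=> AF mw iw; apply: (itg_le (g := fun v => powR `|T A v| a + powR `|w v| q)).
- by apply: measurable_funM => //; exact: itg_measurable (iT AF).
- by apply: itgD => //; exact: iTa.
- by move=> v; rewrite normrM mulrC young_powR.
Qed.

Lemma itg_prod_powR (A : {set 'I_n}) (phi : 'I_n -> R -> R) :
  (forall i x, 0 <= phi i x) ->
  (forall i, itg Q (fun v => powR (phi i (L i v)) q)) ->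
  itg Q (fun v => powR (\prod_(i in A) phi i (L i v)) q) /\
  \int[Q]_v powR (\prod_(i in A) phi i (L i v)) q =
  \prod_(i in A) \int[Q]_v powR (phi i (L i v)) q.
Proof.
move=> phi0 iphi.
have [] /= := Rintegral_prod_summand pQ (phi := fun i x => powR (phi i x) q) (enum_uniq A) iphi.
have -> : (fun v => \prod_(i <- enum A) powR (phi i (L i v)) q) =
    (fun v => powR (\prod_(i in A) phi i (L i v)) q).
  by apply/funext => v; rewrite -powR_prod// big_enum.
by move=> i1 ->; split=> //; rewrite big_enum.
Qed.

(** The q-th moments left by Young's inequality: [m1] is finite for every q, [m2] is used when q <=
    3, and [m3] belongs to the index that occurs twice in the error of [mixed_diff_approx]. *)
Definition m1 := \int[Q]_v powR (Num.min 1 `|L i0 v|) q.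
Definition m2 := \int[Q]_v powR `|L i0 v| q.
Definition m3 := \int[Q]_v powR (`|L i0 v| * Num.min 1 `|L i0 v|) q.

Let min0 (x : R) : 0 <= Num.min 1 `|x|. Proof. by rewrite le_min ler01 normr_ge0. Qed.
Let mmin : measurable_fun setT (fun x : R => Num.min 1 `|x|).
Proof. by apply: measurable_minr => //; exact: measurableT_comp. Qed.
Let mpow (f : V -> R) b : measurable_fun setT f -> measurable_fun setT (fun v => powR (f v) b).
Proof. by move=> mf; exact: measurableT_comp (measurable_powR b) mf. Qed.

Let mabs i : measurable_fun setT (fun v => `|L i v|).
Proof. by apply: measurableT_comp => //; exact: mL. Qed.

Lemma itg_m1 i : itg Q (fun v => powR (Num.min 1 `|L i v|) q).
Proof.
apply: (itg_le (g := fun=> 1)); last first.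
- move=> v; rewrite ger0_norm ?powR_ge0//.
  have := @ler_powR2r _ q (Num.min 1 `|L i v|) 1 q0 (min0 _).
  by rewrite ge_min lexx powR1; apply.
- exact: itg_cst.
- by apply: mpow; exact: measurableT_comp mmin (mL i).
Qed.

(** For the orders without a main term the mixed difference is estimated as a whole; Young's
    inequality and independence turn its truncated factors into a power of [m1]. *)
Lemma high_bound A (gd : nat -> R -> R) M : A \in F ->
  (forall j, (j < k)%N -> forall z : R, is_derive z 1 (gd j) (gd j.+1 z)) ->
  (forall j, (j <= k)%N -> forall z, `|gd j z| <= M) ->
  measurable_fun setT (gd 0%N) ->
  `|\int[Q]_v (gd 0%N (S v) * T A v)| <= 2 ^+ k * M * (tau A + m1 ^+ #|A|).
Proof.
move=> AF dg gM mg; have M0 : 0 <= M by rewrite (le_trans _ (gM 0%N _ 0)).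
have Ak : (#|A| <= k)%N by move: AF; rewrite inE => /andP[].
rewrite (degenerate_mixed_diff AF mg (gM 0%N (leq0n k))).
have [iP EP] := itg_prod_powR A (phi := fun _ x => Num.min 1 `|x|) (fun _ => min0) itg_m1.
have -> : m1 ^+ #|A| = \int[Q]_v powR (\prod_(i in A) Num.min 1 `|L i v|) q.
  rewrite EP -prodr_const; apply: eq_bigr => i _.
  exact: (esym (Rintegral_summand permQ (h := fun x => powR (Num.min 1 `|x|) q) i (itg_m1 i0))).
rewrite -RintegralD//; last exact: iTa.
rewrite -RintegralZl//; last by apply: itgD => //; exact: iTa.
apply: ler_norm_Rintegral.
- apply: measurable_funM; last exact: itg_measurable (iT AF).
  by apply: measurable_mixed_diff => //; exact: itg_measurable (iS _ _).
- by apply: itgZ; apply: itgD => //; exact: iTa.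
move=> v; set s := [seq L i v | i <- enum A].
have ss : size s = #|A| by rewrite size_map -cardE.
rewrite normrM (@le_trans _ _ (2 ^+ k * M * (`|T A v| * \prod_(i in A) Num.min 1 `|L i v|)))//; last first.
  by rewrite ler_wpM2l ?mulr_ge0 ?exprn_ge0// young_powR// prodr_ge0.
rewrite [`|T A v| * _]mulrC mulrA ler_wpM2r//.
have := @mixed_diff_le _ s gd M (\sum_(i in ~: A) L i v); rewrite ss big_map big_enum /=.
move=> H; apply: le_trans (H _ _) _.
- by move=> j js; apply: dg; exact: (leq_trans js Ak).
- by move=> j js; apply: gM; exact: (leq_trans js Ak).
apply: ler_wpM2r; first by apply: prodr_ge0 => i _.
by rewrite ler_wpM2r// ler_eXn2l// ltr1n.
Qed.

Section low_order.
Hypothesis q3 : q <= 3.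

Lemma itg_m2 i : itg Q (fun v => powR `|L i v| q).
Proof.
have iL3i : itg Q (fun v => `|L i v| ^+ 3).
  exact: (itg_summand (h := fun x => `|x| ^+ 3) permQ i iL3).
apply: (itg_le (g := fun v => 1 + `|L i v| ^+ 3)).
- exact: (mpow _ (mabs i)).
- by apply: itgD => //; exact: itg_cst.
- move=> v; rewrite ger0_norm ?powR_ge0//.
  have [x1|/ltW x1] := leP `|L i v| 1.
    have := ler_powR2r q0 (normr_ge0 (L i v)) x1; rewrite powR1 => /le_trans; apply.
    by rewrite lerDl exprn_ge0.
  by rewrite (@le_trans _ _ (`|L i v| ^+ 3)) ?lerDr// -powR_mulrn// ler_powR.
Qed.

(** Below 1 the left side is x^(2q) with 2q > 4 > 3; above 1 it is x^q with q <= 3. *)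
Let pow_min_le (x : R) : 0 <= x -> powR (x * Num.min 1 x) q <= x ^+ 3.
Proof.
move=> x0; have [x1|/ltW x1] := leP x 1.
  rewrite powRM// -powRD; last by rewrite gt_eqF//; have := q2; lra.
  have [->|xn0] := eqVneq x 0; first by rewrite powR0 ?expr0n// gt_eqF//; have := q2; lra.
  by rewrite -powR_mulrn// ger_powR//; [rewrite lt_def xn0 x0|have := q2; lra].
by rewrite mulr1 -powR_mulrn// ler_powR.
Qed.

Lemma itg_m3 i : itg Q (fun v => powR (`|L i v| * Num.min 1 `|L i v|) q).
Proof.
apply: (itg_le (g := fun v => `|L i v| ^+ 3)).
- apply: mpow; apply: measurable_funM => //.
  exact: measurableT_comp mmin (mL i).
- exact: (itg_summand (h := fun x => `|x| ^+ 3) permQ i iL3).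
- by move=> v; rewrite ger0_norm ?powR_ge0// pow_min_le.
Qed.

Lemma m3_le : n%:R * m3 <= beta3 Q l i0.
Proof.
by rewrite ler_wpM2l//; apply: ler_Rintegral => //; [exact: itg_m3|move=> v; exact: pow_min_le].
Qed.

Lemma m2_prod (A : {set 'I_n}) :
  itg Q (fun v => powR `|\prod_(i in A) L i v| q) /\
  \int[Q]_v powR `|\prod_(i in A) L i v| q = m2 ^+ #|A|.
Proof.
have [iP EP] := itg_prod_powR A (phi := fun _ x => `|x|) (fun _ => @normr_ge0 _ _) itg_m2.
have -> : (fun v => powR `|\prod_(i in A) L i v| q) = (fun v => powR (\prod_(i in A) `|L i v|) q).
  by apply/funext => v; rewrite normr_prod.
split => //; rewrite EP -prodr_const; apply: eq_bigr => i _.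
exact: (Rintegral_summand permQ (h := fun x => powR `|x| q) i (itg_m2 i0)).
Qed.

Lemma measurable_prod_summand (A : {set 'I_n}) :
  measurable_fun setT (fun v => \prod_(i in A) L i v).
Proof.
have H (s : seq 'I_n) : measurable_fun setT (fun v => \prod_(i <- s) L i v).
  elim: s => [|i s IH]; first by under eq_fun do rewrite big_nil; exact: measurable_cst.
  by under eq_fun do rewrite big_cons; apply: measurable_funM => //; exact: mL.
by have := H (enum A); under eq_fun do rewrite big_enum.
Qed.

Lemma kap_le A : A \in F -> `|kap A| <= tau A + m2 ^+ #|A|.
Proof.
move=> AF; have [iP EP] := m2_prod A.
rewrite -EP -RintegralD//; last exact: iTa.
apply: ler_norm_Rintegral.
- apply: measurable_funM; first exact: measurable_prod_summand.
  exact: itg_measurable (iT AF).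
- by apply: itgD => //; exact: iTa.
- by move=> v; rewrite normrM mulrC young_powR.
Qed.

(** The mixed difference is replaced by the product of the L_i, i in A, times a derivative at the
    sum over the complement of A. The error has one repeated index, hence the factor [m3], and k
    bounds the number of choices of that index. *)
Lemma low_bound A (gd : nat -> R -> R) M : A \in F ->
  (forall j, (j <= k)%N -> forall z : R, is_derive z 1 (gd j) (gd j.+1 z)) ->
  (forall j, (j <= k.+1)%N -> forall z, `|gd j z| <= M) ->
  measurable_fun setT (gd 0%N) -> measurable_fun setT (gd #|A|) ->
  `|\int[Q]_v (gd 0%N (S v) * T A v) -
      kap A * \int[Q]_v gd #|A| (\sum_(i in ~: A) L i v)|
    <= (2 ^+ k + 1) * M * k%:R * (tau A + m2 ^+ #|A|.-1 * m3).
Proof.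
move=> AF dg gM mg mgA; have M0 : 0 <= M by rewrite (le_trans _ (gM 0%N _ 0)).
have Ak : (#|A| <= k)%N by move: AF; rewrite inE => /andP[].
have k2 : 1 <= 2 ^+ k :> R by rewrite exprn_ege1// ler1n.
pose y v := \sum_(i in ~: A) L i v.
have my : measurable_fun setT y by exact: itg_measurable (iS _ _).
pose D v := mixed_diff (gd 0%N) (y v) [seq L i v | i <- enum A].
pose Pr v := \prod_(i in A) L i v.
have mD : measurable_fun setT D by exact: measurable_mixed_diff.
have mgy : measurable_fun setT (fun v => gd #|A| (y v)) by exact: measurableT_comp mgA my.
have igy : itg Q (fun v => gd #|A| (y v)).
  apply: (itg_le (g := fun=> M)) => //; first exact: itg_cst.
  by move=> v; apply: gM; exact: leqW.
have [iP EP] := m2_prod A.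
have iPT : itg Q (fun v => Pr v * T A v).
  by apply: itg_mul_T => //; exact: measurable_prod_summand.
rewrite (degenerate_mixed_diff AF mg (gM 0%N (leq0n _))).
(* The product with T_A lives on A and the derivative on its complement, so the integral
   factorizes. *)
have -> : kap A * \int[Q]_v gd #|A| (y v) = \int[Q]_v (Pr v * T A v * gd #|A| (y v)).
  have d1 : depends A (fun v => Pr v * T A v).
    apply: depends2 (TA AF); apply: depends_prod => i iA; exact: depends_summand.
  have d2 : depends (~: A) (fun v => gd #|A| (y v)).
    apply: (depends_comp (gd #|A|)); apply: depends_sum => i iA; exact: depends_summand.
  by rewrite (Rintegral_indep pQ d1 d2 iPT igy).
have iDT : itg Q (fun v => D v * T A v).
  apply: (itg_bounded_mul (C := 2 ^+ #|A| * M) mD _ (iT AF)) => v.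
  by rewrite cardE -(size_map (fun i => L i v)); apply: mixed_diff_bounded => z; exact: gM.
have iPTg : itg Q (fun v => Pr v * T A v * gd #|A| (y v)).
  under eq_fun do rewrite mulrC.
  by apply: (itg_bounded_mul (C := M)) => // v; apply: gM; exact: leqW.
rewrite -RintegralB//.
(* The weight of the error with repeated index i. The repetition is truncated, since the q-th moment
   of L_i^2 need not exist. *)
pose w i v := (\prod_(j in A) `|L j v|) * Num.min 1 `|L i v|.
have Hw i : i \in A -> itg Q (fun v => powR (w i v) q) /\
    \int[Q]_v powR (w i v) q = m2 ^+ #|A|.-1 * m3.
  move=> iA.
  pose phi j (x : R) := if j == i then `|x| * Num.min 1 `|x| else `|x|.
  have phi0 j x : 0 <= phi j x by rewrite /phi; case: ifP => // _; rewrite mulr_ge0.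
  have iphi j : itg Q (fun v => powR (phi j (L j v)) q).
    by rewrite /phi; case: (j == i); [exact: itg_m3|exact: itg_m2].
  have [iw Ew] := itg_prod_powR A phi0 iphi.
  have wE : (fun v => powR (w i v) q) = (fun v => powR (\prod_(j in A) phi j (L j v)) q).
    apply/funext => v; congr powR; rewrite /w [LHS](_ : _ =
      `|L i v| * Num.min 1 `|L i v| * \prod_(j in A | j != i) `|L j v|); last first.
      by rewrite (bigD1 i iA) /= mulrAC.
    rewrite (bigD1 i iA) /= {1}/phi eqxx; congr (_ * _).
    by apply: eq_bigr => j /andP[_ /negbTE ji]; rewrite /phi ji.
  rewrite wE; split=> //; rewrite Ew (bigD1 i)//= mulrC; congr (_ * _).
    transitivity (\prod_(j in A :\ i) m2); last first.
      by rewrite prodr_const (cardsD1 i A) iA.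
    apply: eq_big => [j|j /andP[_ /negbTE ji]]; first by rewrite !inE andbC.
    rewrite /phi ji.
    exact: (Rintegral_summand permQ (h := fun x => powR `|x| q) j (itg_m2 i0)).
  rewrite /phi eqxx.
  exact: (Rintegral_summand permQ (h := fun x => powR (`|x| * Num.min 1 `|x|) q) i (itg_m3 i0)).
have wq0 i v : 0 <= w i v by rewrite mulr_ge0// prodr_ge0.
have pw v : `|D v - Pr v * gd #|A| (y v)| <= (2 ^+ k + 1) * M * \sum_(i in A) w i v.
  pose s := [seq L i v | i <- enum A].
  have ss : size s = #|A| by rewrite size_map -cardE.
  have h1 : `|D v| <= 2 ^+ k * M * \prod_(i in A) `|L i v|.
    have := @mixed_diff_le _ s gd M (y v); rewrite ss big_map big_enum /= => H.
    apply: le_trans (H _ _) _.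
    + by move=> j js; apply: dg; exact: (leq_trans (ltnW js) Ak).
    + by move=> j js; apply: gM; apply: leqW; exact: (leq_trans js Ak).
    apply: ler_pM; rewrite ?mulr_ge0 ?exprn_ge0 ?prodr_ge0//.
      by rewrite ler_wpM2r// ler_eXn2l// ltr1n.
    by apply: ler_prod => i _; rewrite min0 ge_min lexx orbT.
  have h2 : `|Pr v * gd #|A| (y v)| <= M * \prod_(i in A) `|L i v|.
    rewrite normrM normr_prod mulrC ler_wpM2r ?prodr_ge0//.
    by apply: gM; exact: leqW.
  have h3 : `|D v - Pr v * gd #|A| (y v)| <= M * (\prod_(i in A) `|L i v|) * \sum_(i in A) `|L i v|.
    have := @mixed_diff_approx _ s gd M (y v); rewrite ss !big_map !big_enum /=; apply.
    + by move=> j js; apply: dg; exact: (leq_trans js Ak).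
    + by move=> j js; apply: gM; rewrite (leq_trans js)// ltnS.
  have P0 : 0 <= \prod_(i in A) `|L i v| by apply: prodr_ge0.
  (* If some |L_i| exceeds 1, the sum of the truncated factors is at least 1 and the crude bounds
     [h1], [h2] suffice; otherwise truncation changes nothing and [h3] applies. *)
  rewrite -mulr_sumr; have [/existsP[i /andP[iA Li]]|/existsPn Lle] :=
      boolP [exists i, (i \in A) && (1 < `|L i v|)].
    have s1 : 1 <= \sum_(j in A) Num.min 1 `|L j v|.
      rewrite (bigD1 i)//= (_ : Num.min 1 `|L i v| = 1); last by apply/min_idPl; exact: ltW.
      by rewrite lerDl sumr_ge0.
    apply: (@le_trans _ _ ((2 ^+ k + 1) * M * \prod_(i in A) `|L i v|)).
      by rewrite (le_trans (ler_normB _ _))// !mulrDl mul1r lerD.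
    by rewrite ler_wpM2l ?mulr_ge0 ?addr_ge0 ?exprn_ge0// ler_peMr.
  apply: le_trans h3 _; rewrite -mulrA; apply: ler_pM => //.
  - by rewrite mulr_ge0// sumr_ge0.
  - by rewrite ler_peMl// lerDr exprn_ge0.
  rewrite ler_wpM2l//; apply: ler_sum => i iA; rewrite le_min lexx andbT.
  by have := Lle i; rewrite iA /= -leNgt => ->.
apply: (@le_trans _ _ (\int[Q]_v ((2 ^+ k + 1) * M *
    \sum_(i in A) (powR `|T A v| a + powR (w i v) q)))).
  apply: ler_norm_Rintegral.
  - by apply: (itg_measurable (mu := Q)); exact: itgB.
  - apply: itgZ; apply: itg_sum => i iA; apply: itgD; first exact: iTa.
    by have [] := Hw i iA.
  - move=> v; rewrite mulrAC -mulrBl normrM (le_trans (ler_wpM2r _ (pw v)))//.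
    rewrite -[leLHS]mulrA ler_wpM2l ?mulr_ge0 ?addr_ge0 ?exprn_ge0// mulr_suml.
    by apply: ler_sum => i iA; rewrite mulrC young_powR.
rewrite RintegralZl//; last first.
  by apply: itg_sum => i iA; apply: itgD; [exact: iTa|have [] := Hw i iA].
rewrite -[leRHS]mulrA ler_wpM2l ?mulr_ge0 ?addr_ge0 ?exprn_ge0//.
rewrite Rintegral_sum; last first.
  by move=> i iA; apply: itgD; [exact: iTa|have [] := Hw i iA].
have m20 : 0 <= m2 by apply: Rintegral_ge0 => v _; exact: powR_ge0.
have m30 : 0 <= m3 by apply: Rintegral_ge0 => v _; exact: powR_ge0.
rewrite (eq_bigr (fun=> tau A + m2 ^+ #|A|.-1 * m3)); last first.
  by move=> i iA; have [iw Ew] := Hw i iA; rewrite RintegralD ?Ew//; exact: iTa.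
rewrite sumr_const -[leLHS]mulr_natl ler_wpM2r ?ler_nat// addr_ge0 ?tau_ge0//.
by rewrite mulr_ge0// exprn_ge0.
Qed.

End low_order.

End degenerate_part.

Lemma sum_by_card {R : realType} (n k : nat) (g : {set 'I_n} -> R) :
  \sum_(A in small_sets n k) g A =
  \sum_(1 <= j < k.+1) \sum_(A : {set 'I_n} | #|A| == j) g A.
Proof.
transitivity (\sum_(A : {set 'I_n}) \sum_(1 <= j < k.+1 | j == #|A|) g A).
  rewrite big_mkcond; apply: eq_bigr => A _.
  by rewrite big_nat1_eq inE ltnS.
under eq_bigr do rewrite big_mkcond.
rewrite exchange_big; apply: eq_bigr => j _; rewrite [RHS]big_mkcond.
by apply: eq_bigr => A _; rewrite eq_sym.
Qed.

Lemma card_sets_le {R : realType} (n j : nat) (x : R) : 0 <= x ->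
  \sum_(A : {set 'I_n} | #|A| == j) x <= n%:R ^+ j * x.
Proof.
move=> x0; rewrite sumr_const -[leLHS]mulr_natl ler_wpM2r//.
have := @sum_card_le R n j 1 ler01.
by rewrite expr1n sumr_const mulr1.
Qed.

Lemma ler_expr {R : numDomainType} (x y : R) j : 0 <= x -> x <= y -> x ^+ j <= y ^+ j.
Proof. by move=> x0 xy; apply: lerXn2r => //; rewrite nnegrE// (le_trans x0). Qed.

(** * Powers of beta controlling the moments of the summands *)

Section core.
Context {R : realType} (n : nat).
Local Notation V := (n.-tuple R).
Variable Q : probability V R.
Hypothesis pQ : product_law Q.
Hypothesis permQ : forall s : {perm 'I_n},
  has_law Q (fun v : V => [tuple tnth v (s i) | i < n]) Q.
Variables (l : R -> R) (i0 : 'I_n).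
Hypothesis ml : measurable_fun setT l.
Local Notation L := (@summand R n l).
Hypothesis iL3 : itg Q (fun v => `|L i0 v| ^+ 3).
Hypothesis L1 : \int[Q]_v L i0 v = 0.
Hypothesis L2 : n%:R * \int[Q]_v L i0 v ^+ 2 = 1.
Local Notation beta := (beta3 Q l i0).

Let nR0 : 0 <= n%:R :> R. Proof. exact: ler0n. Qed.
Let b0 : 0 < beta := beta3_gt0 ml iL3 L2.

Variables (a : R) (k : nat).
Hypothesis a12 : 1 < a < 2.
Local Notation q := (a / (a - 1)).
Local Notation s := (q - 2).

Let q2 : 2 < q. Proof. by case/andP: a12 => ? ?; rewrite ltr_pdivlMr; lra. Qed.
Let q0 : 0 <= q. Proof. by apply: ltW; apply: lt_trans q2. Qed.
Let s0 : 0 <= s. Proof. by rewrite subr_ge0 ltW. Qed.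

Local Notation mu1 := (m1 Q l i0 a).
Local Notation mu2 := (m2 Q l i0 a).
Local Notation mu3 := (m3 Q l i0 a).

Let mu1_ge0 : 0 <= mu1. Proof. by apply: Rintegral_ge0 => v _; exact: powR_ge0. Qed.
Let mu2_ge0 : 0 <= mu2. Proof. by apply: Rintegral_ge0 => v _; exact: powR_ge0. Qed.
Let mu3_ge0 : 0 <= mu3. Proof. by apply: Rintegral_ge0 => v _; exact: powR_ge0. Qed.

Let n_mu1_ge0 : 0 <= n%:R * mu1 := mulr_ge0 nR0 mu1_ge0.
Let n_mu2_ge0 : 0 <= n%:R * mu2 := mulr_ge0 nR0 mu2_ge0.

Let iL2 : itg Q (fun v => L i0 v ^+ 2) := itg_moment2 (measurable_summand ml i0) iL3.

(* [y^s <= b^s + b^(s-1) y] for [s <= 1], used with [b = beta]. *)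
Lemma n_mu2_le : q <= 3 -> n%:R * mu2 <= 2 * powR beta s.
Proof.
move=> q3; have s1 : s <= 1 by lra.
have i2 := itg_m2 permQ ml iL3 a12 q3 i0.
have H : mu2 <= \int[Q]_v (powR beta s * L i0 v ^+ 2 + powR beta (s - 1) * `|L i0 v| ^+ 3).
  apply: ler_Rintegral => //; first by apply: itgD; exact: itgZ.
  move=> v; rewrite -[L i0 v ^+ 2]real_normK ?num_real//.
  have := normr_ge0 (L i0 v); move: `|L i0 v| => y y0.
  have -> : powR y q = y ^+ 2 * powR y s.
    rewrite -powR_mulrn// -powRD; first by congr powR; ring.
    by apply/implyP => /eqP; have := q2; lra.
  rewrite [leRHS](_ : _ = y ^+ 2 * (powR beta s + powR beta (s - 1) * y)); last by ring.
  rewrite ler_wpM2l ?sqr_ge0//.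
  have [yb|/ltW by_] := leP y beta.
    rewrite (le_trans (ler_powR2r s0 y0 yb))// lerDl.
    by rewrite mulr_ge0// powR_ge0.
  have y0' : 0 < y by exact: lt_le_trans by_.
  have -> : powR y s = powR y (s - 1) * y.
    rewrite -{3}(powRr1 y0) -powRD; first by congr powR; ring.
    by rewrite (gt_eqF y0') implybT.
  apply: (@le_trans _ _ (powR beta (s - 1) * y)); last by rewrite lerDr powR_ge0.
  rewrite ler_wpM2r//.
  have -> : s - 1 = - (1 - s) by ring.
  rewrite !powRN lef_pV2 ?posrE ?powR_gt0//.
  by apply: ler_powR2r => //; [lra|exact: ltW].
move: H; rewrite RintegralD//; [|exact: itgZ|exact: itgZ].
rewrite !RintegralZl// => /(ler_wpM2l nR0)/le_trans; apply.
rewrite mulrDr [n%:R * (_ * _)]mulrCA L2 mulr1 [n%:R * (_ * _)]mulrCA -/beta.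
have -> : powR beta (s - 1) * beta = powR beta s.
  rewrite -[X in _ * X](powRr1 (ltW b0)) -powRD; first by congr powR; ring.
  by rewrite (gt_eqF b0) implybT.
by rewrite mulrDl mul1r.
Qed.

Lemma mu1_le_mu2 : q <= 3 -> mu1 <= mu2.
Proof.
move=> q3; apply: ler_Rintegral.
- exact: itg_m1.
- exact: (itg_m2 permQ ml iL3 a12 q3 i0).
- move=> v; apply: (ler_powR2r q0); first by rewrite le_min ler01 normr_ge0.
  by rewrite ge_min lexx orbT.
Qed.

(** Here third moments cannot reach |L|^q, but min(1, y)^q <= y^3 holds for q >= 3. *)
Lemma n_mu1_le : 3 <= q -> n%:R * mu1 <= beta.
Proof.
move=> q3; rewrite ler_wpM2l//; apply: ler_Rintegral => //.
  exact: itg_m1.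
move=> v; have := normr_ge0 (L i0 v); move: `|L i0 v| => y y0.
have [y1|y1] := leP 1 y; first by rewrite powR1 exprn_ege1.
have [->|yn0] := eqVneq y 0; first by rewrite powR0 ?expr0n// gt_eqF//; have := q2; lra.
rewrite -powR_mulrn//; apply: ger_powR => //.
by rewrite lt_def yn0 y0 (ltW y1).
Qed.

Let powX (b : R) (j : nat) : powR b s ^+ j = powR b (s * j%:R).
Proof. by rewrite powRrM powR_mulrn// powR_ge0. Qed.

Let two_pow j : (j <= k)%N -> 2 ^+ j <= 2 ^+ k :> R.
Proof. by move=> jk; rewrite ler_eXn2l// ltr1n. Qed.

Let powbeta_le1 : beta <= 1 -> powR beta s <= 1.
Proof. by move=> b1; have := ler_powR2r s0 (ltW b0) b1; rewrite powR1. Qed.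

(** The threshold on j at work: for q < 3 the left side is at most (2 beta^s)^j, and beta^(j s) <=
    beta because j s >= 1 and beta <= 1. For q >= 3 it is at most beta^j. *)
Lemma mu1_pow_le j : (0 < j <= k)%N -> beta <= 1 -> 1 <= j%:R * s ->
  n%:R ^+ j * mu1 ^+ j <= 2 ^+ k * beta.
Proof.
move=> /andP[j0 jk] b1 js; rewrite -exprMn.
have k2 : 1 <= 2 ^+ k :> R by rewrite exprn_ege1// ler1n.
have [q3|/ltW q3] := leP q 3.
  apply: (@le_trans _ _ ((2 * powR beta s) ^+ j)).
    exact: (ler_expr j n_mu1_ge0 (le_trans (ler_wpM2l nR0 (mu1_le_mu2 q3)) (n_mu2_le q3))).
  rewrite exprMn powX ler_pM ?exprn_ge0 ?powR_ge0 ?two_pow//.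
  rewrite -[leRHS](powRr1 (ltW b0)); apply: ger_powR; first by rewrite b0.
  by rewrite mulrC.
apply: (@le_trans _ _ (beta ^+ j)).
  exact: (ler_expr j n_mu1_ge0 (n_mu1_le q3)).
rewrite -(prednK j0) exprS mulrC (le_trans _ (ler_peMl (ltW b0) k2))//.
by rewrite ler_piMl ?(ltW b0)// exprn_ile1// ltW.
Qed.

Lemma mu23_pow_le j : (0 < j <= k)%N -> beta <= 1 -> q <= 3 ->
  n%:R ^+ j * (mu2 ^+ j.-1 * mu3) <= 2 ^+ k * beta.
Proof.
case: j => // j /= jk b1 q3.
rewrite (_ : _ * _ = (n%:R * mu2) ^+ j * (n%:R * mu3)); last by rewrite exprMn exprSr; ring.
apply: ler_pM; rewrite ?exprn_ge0 ?mulr_ge0//; last exact: (m3_le permQ ml iL3 a12 q3).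
apply: le_trans (two_pow (ltnW jk)).
apply: (ler_expr j n_mu2_ge0); apply: le_trans (n_mu2_le q3) _.
by rewrite ler_piMr//; exact: powbeta_le1.
Qed.

Lemma mu2_pow_le1 j : (j <= k)%N -> beta <= 1 -> q <= 3 ->
  n%:R ^+ j * mu2 ^+ j <= 2 ^+ k.
Proof.
move=> jk b1 q3; rewrite -exprMn; apply: le_trans (two_pow jk).
apply: (ler_expr j n_mu2_ge0); apply: le_trans (n_mu2_le q3) _.
by rewrite ler_piMr//; exact: powbeta_le1.
Qed.

(** For beta >= 1 the inequality reverses: now j s <= 1 gives beta^(j s) <= beta, so the correction
    terms themselves are of the order of the error. *)
Lemma mu2_pow_le j : (j <= k)%N -> 1 <= beta -> q <= 3 -> j%:R * s <= 1 ->
  n%:R ^+ j * mu2 ^+ j <= 2 ^+ k * beta.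
Proof.
move=> jk b1 q3 js; rewrite -exprMn; apply: (@le_trans _ _ ((2 * powR beta s) ^+ j)).
  exact: (ler_expr j n_mu2_ge0 (n_mu2_le q3)).
rewrite exprMn powX ler_pM ?exprn_ge0 ?powR_ge0 ?two_pow//.
by rewrite -[leRHS](powRr1 (ltW b0)); apply: ler_powR => //; rewrite mulrC.
Qed.

End core.

(** For [term_bound], with E = 2^k, K = k, t the a-th moment of T_A, w the bound on [kap] beyond t,
    and b = beta: adds the error of [low_bound] and that of the normal approximation of its
    derivative factor. *)
Lemma cost_algebra {R : realFieldType} (M E K t u w b : R) :
  0 <= M -> 0 <= E -> 0 <= K -> 0 <= t -> 0 <= u -> 0 <= w -> 0 <= b -> b <= 1 ->
  (E + 1) * M * K * (t + u) + (t + w) * ((K + 3) * M * b) <=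
  ((E + 1) * K + (K + 3) + E) * M * (t + (u + w * b)).
Proof.
move=> M0 E0 K0 t0 u0 w0 b0 b1; have wb : 0 <= w * b by rewrite mulr_ge0.
have tb : t * b <= t by rewrite ler_piMr.
rewrite [leLHS](_ : _ = M * ((E + 1) * K * (t + u) + (K + 3) * (t * b + w * b))); last by ring.
rewrite [leRHS](_ : _ = M * (((E + 1) * K + (K + 3) + E) * (t + (u + w * b)))); last by ring.
rewrite ler_wpM2l//.
have Z1 : (K + 3) * (t * b + w * b) <= (K + 3) * (t + w * b).
  by rewrite ler_wpM2l ?addr_ge0// lerD2r.
have Z2 : 0 <= (E + 1) * K * (w * b) by rewrite !mulr_ge0// addr_ge0.
have Z3 : 0 <= (K + 3) * u by rewrite mulr_ge0// addr_ge0.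
have Z4 : 0 <= E * (t + (u + w * b)) by rewrite mulr_ge0// !addr_ge0.
apply: le_trans (lerD (lexx _) Z1) _; rewrite -subr_ge0.
rewrite [X in 0 <= X](_ : _ = (E + 1) * K * (w * b) + (K + 3) * u + E * (t + (u + w * b))); last by ring.
by rewrite !addr_ge0.
Qed.

Lemma dist_mul_le {R : realFieldType} (x c y z B B' C : R) :
  `|x - c * y| <= B -> `|y - z| <= B' -> `|c| <= C -> `|x - c * z| <= B + C * B'.
Proof.
move=> h1 h2 h3; rewrite (_ : x - c * z = (x - c * y) + c * (y - z)); last by ring.
by rewrite (le_trans (ler_normD _ _))// lerD// normrM ler_pM.
Qed.

(** Final addition of errors for beta <= 1, with X = 4^k, C the constant of one term and Z b the
    total of the costs; [sum_algebra2] does the same for beta >= 1. *)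
Lemma sum_algebra1 {R : realFieldType} (M X C Z b G : R) :
  0 <= M -> 0 <= X -> 0 <= C -> 0 <= Z -> 0 <= b -> 0 <= G ->
  2 * M * X * G + 3 * M * b + C * M * (G + Z * b) <= (4 + 2 * X + C * (1 + Z)) * M * (b + G).
Proof.
move=> M0 X0 C0 Z0 b0 G0; rewrite -subr_ge0.
rewrite [X in 0 <= X](_ : _ = M * (b + 4 * G + 2 * X * b + C * b + C * Z * G)); last by ring.
by rewrite mulr_ge0// !addr_ge0// !mulr_ge0.
Qed.

Lemma sum_algebra2 {R : realFieldType} (M X C Z W b G : R) :
  0 <= M -> 0 <= X -> 1 <= C -> 0 <= Z -> W <= Z -> 0 <= b -> 0 <= G ->
  M * (b + X * G) + 3 * M * b + M * (G + W * b) <= (4 + 2 * X + C * (1 + Z)) * M * (b + G).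
Proof.
move=> M0 X0 C1 Z0 WZ b0 G0; rewrite -subr_ge0.
rewrite [X in 0 <= X](_ : _ = M * (4 * G + 2 * X * b + X * G + C * b + (C - 1) * G + C * Z * G
  + ((C - 1) * Z + (Z - W)) * b)); last by ring.
have C0 : 0 <= C - 1 by rewrite subr_ge0.
have D0 : 0 <= Z - W by rewrite subr_ge0.
have E0 : 0 <= C by rewrite (le_trans ler01).
by rewrite mulr_ge0// !addr_ge0// !mulr_ge0// addr_ge0// mulr_ge0.
Qed.

(** The summands come from [low_bound], from [normal_approx_partial] with |A| <= k, and from
    [high_bound]. *)
Definition term_cst {R : realType} k : R := (2 ^+ k + 1) * k%:R + (k%:R + 3) + 2 ^+ k.

(** Here 2 * 4^k is the Taylor remainder, 4 leaves room for the 3 of the normal approximation, and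
    the last product is the error of a term summed over all sets. *)
Definition expansion_cst {R : realType} k : R :=
  4 + 2 * 4 ^+ k + term_cst k * (1 + k%:R * (2 * 2 ^+ k)).

(** * The expansion under the product law *)

Section expansion.
Context {R : realType} (n : nat).
Local Notation V := (n.-tuple R).
Variable Q : probability V R.
Hypothesis pQ : product_law Q.
Hypothesis permQ : forall s : {perm 'I_n},
  has_law Q (fun v : V => [tuple tnth v (s i) | i < n]) Q.
Variables (l : R -> R) (i0 : 'I_n).
Hypothesis ml : measurable_fun setT l.
Local Notation L := (@summand R n l).
Hypothesis iL3 : itg Q (fun v => `|L i0 v| ^+ 3).
Hypothesis L1 : \int[Q]_v L i0 v = 0.
Hypothesis L2 : n%:R * \int[Q]_v L i0 v ^+ 2 = 1.
Local Notation beta := (beta3 Q l i0).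
Let b0 : 0 < beta := beta3_gt0 ml iL3 L2.

Variables (k : nat) (T : {set 'I_n} -> V -> R).
Local Notation F := (small_sets n k).
Hypothesis iT : forall A, A \in F -> itg Q (T A).
Local Notation S := (fun v => \sum_(i < n) L i v).
Local Notation TT := (fun v => \sum_(A in F) T A v).

Let iL i : itg Q (L i).
Proof. exact: (itg_summand (h := id) permQ _ (itg_moment1 (measurable_summand ml i0) iL3)). Qed.
Let iS : itg Q S. Proof. by apply: itg_sum => i _. Qed.
Let iTT : itg Q TT. Proof. by apply: itg_sum => A; exact: iT. Qed.

Lemma crude_bound K (f : R -> R) : lip K f ->
  `|\int[Q]_v f (S v + TT v) - \int[Q]_v f (S v)| <= K * \int[Q]_v `|TT v|.
Proof.
move=> fK; have i1 := itg_lip_comp fK (itgD iS iTT); have i2 := itg_lip_comp fK iS.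
rewrite -RintegralB// -RintegralZl//; last exact: itg_norm.
apply: ler_norm_Rintegral.
- by apply: (itg_measurable (mu := Q)); exact: itgB.
- by apply: itgZ; exact: itg_norm.
- by move=> v; have := fK (S v + TT v) (S v); rewrite [S v + _]addrC addrK.
Qed.

Lemma expansion1 K M (f : R -> R) : lip K f -> smooth3 M f ->
  `|\int[Q]_v f (S v + TT v) - \int[normal_prob 0 1]_x f x|
    <= 3 * (K + M) * (beta + \sum_(A in F) \int[Q]_v `|T A v|).
Proof.
move=> fK fM; have K0 := lip_ge0 fK.
have h1 := normal_approx pQ permQ ml iL3 L1 L2 fM.
have h2 := crude_bound fK.
have M0 : 0 <= M.
  by move: fM => [g1 [g2 [_ _ _ h]]]; have := le_trans (normr_ge0 _) (h 0 1); rewrite normr1 expr1n mulr1.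
have h3 : \int[Q]_v `|TT v| <= \sum_(A in F) \int[Q]_v `|T A v|.
  rewrite -Rintegral_sum; last by move=> A /iT; exact: itg_norm.
  apply: ler_Rintegral; first exact: itg_norm.
    by apply: itg_sum => A /iT; exact: itg_norm.
  by move=> v; exact: ler_norm_sum.
have G0 : 0 <= \sum_(A in F) \int[Q]_v `|T A v|.
  by apply: sumr_ge0 => A _; exact: Rintegral_ge0.
have h4 := le_trans h2 (ler_wpM2l K0 h3).
have p1 := mulr_ge0 K0 (ltW b0); have p2 := mulr_ge0 M0 G0.
have p3 := mulr_ge0 M0 (ltW b0); have p4 := mulr_ge0 K0 G0.
apply: le_trans (ler_distD (\int[Q]_v f (S v)) _ _) _.
apply: le_trans (lerD h4 h1) _.
by rewrite !mulrDr !mulrDl; lra.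
Qed.

Variable a : R.
Hypothesis a12 : 1 < a < 2.
Hypothesis TA : forall A, A \in F -> depends A (T A).
Hypothesis iTa : forall A, A \in F -> itg Q (fun v => powR `|T A v| a).
Hypothesis dT : forall A, A \in F -> forall i, i \in A -> degenerate Q i (T A).
Local Notation tau A := (\int[Q]_v powR `|T A v| a).
Local Notation Gam := (\sum_(A in F) tau A).
Local Notation q := (a / (a - 1)).
Local Notation s := (q - 2).
Local Notation mu1 := (m1 Q l i0 a).
Local Notation mu2 := (m2 Q l i0 a).
Local Notation mu3 := (m3 Q l i0 a).

Variable p : nat.
Hypothesis ps : forall j, (0 < j <= k)%N -> (j <= p)%N = (j%:R * s < 1).

Variables (fd : nat -> R -> R) (M : R).
Hypothesis dfd : forall j, (j < k + 4)%N -> forall z : R, is_derive z 1 (fd j) (fd j.+1 z).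
Hypothesis fdM : forall j, (0 < j <= k + 4)%N -> forall z, `|fd j z| <= M.

Let M0 : 0 <= M.
Proof. by rewrite (le_trans _ (fdM (j := 1) _ 0))//; clear; lia. Qed.

Let lip_fd j : (j < k + 4)%N -> lip M (fd j).
Proof.
move=> jk x y; have := mean_value_le y (x - y) (dfd jk) (fdM (j := j.+1) jk).
by rewrite [y + _]addrC subrK.
Qed.

Let measurable_fd j : (j < k + 4)%N -> measurable_fun setT (fd j).
Proof. by move=> /lip_fd; exact: lip_measurable. Qed.

Let tau0 A : 0 <= tau A. Proof. exact: tau_ge0. Qed.
Let Gam0 : 0 <= Gam. Proof. by apply: sumr_ge0 => A _. Qed.

Let mu1_ge0 : 0 <= mu1. Proof. by apply: Rintegral_ge0 => v _; exact: powR_ge0. Qed.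
Let mu2_ge0 : 0 <= mu2. Proof. by apply: Rintegral_ge0 => v _; exact: powR_ge0. Qed.
Let mu3_ge0 : 0 <= mu3. Proof. by apply: Rintegral_ge0 => v _; exact: powR_ge0. Qed.

Let s0 : 0 <= s.
Proof. by case/andP: a12 => ? ?; rewrite subr_ge0 ler_pdivlMr; lra. Qed.

Local Notation I j := (\int[normal_prob 0 1]_x fd j.+1 x).

Let I_le j : (j <= k)%N -> `|I j| <= M.
Proof.
move=> jk; have jk' : (j.+1 < k + 4)%N by clear -jk; lia.
have fM x : `|fd j.+1 x| <= M by apply: fdM; clear -jk; lia.
exact: (ler_norm_Rintegral_cst (normal_prob 0 1) (measurable_fd jk') fM).
Qed.

(** A set with a main term has |A| s < 1, so s < 1 and third moments control the power q. *)
Let q3_of A : A \in F -> (#|A| <= p)%N -> q <= 3.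
Proof.
rewrite inE => Ak; rewrite ps// => js.
have : s <= #|A|%:R * s by rewrite ler_peMl// ler1n; case/andP: Ak.
by move: js; lra.
Qed.

Definition main_term (A : {set 'I_n}) : R := if (#|A| <= p)%N then kap Q l T A * I #|A| else 0.

(** The part of the error of a set of size j that does not involve T: for j <= p, the error of
    [low_bound] plus beta times the bound on [kap]; for j > p, the whole bound of [high_bound]. *)
Definition cost (j : nat) : R :=
  if (j <= p)%N then mu2 ^+ j.-1 * mu3 + mu2 ^+ j * beta else mu1 ^+ j.

Local Notation C1 := (@term_cst R k).

Let two_k : 1 <= 2 ^+ k :> R. Proof. by rewrite exprn_ege1// ler1n. Qed.

Lemma term_bound A : A \in F -> beta <= 1 ->
  `|\int[Q]_v (fd 1%N (S v) * T A v) - main_term A| <= C1 * M * (tau A + cost #|A|).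
Proof.
move=> AF b1; have /andP[A0 Ak] : (0 < #|A| <= k)%N by move: AF; rewrite inE.
have C10 : (2 ^+ k + 1) * k%:R <= C1 by rewrite /term_cst -addrA lerDl !addr_ge0// exprn_ge0.
rewrite /main_term /cost; case: ifP => Ap; last first.
  rewrite subr0; have := high_bound pQ permQ ml iL3 a12 iT iTa dT (gd := fun j => fd j.+1) (M := M) AF.
  move=> H; apply: le_trans (H _ _ _) _.
  - by move=> j jk; apply: dfd; clear -jk; lia.
  - by move=> j jk; apply: fdM; clear -jk; lia.
  - by apply: measurable_fd; clear; lia.
  - have E1 : 2 ^+ k <= C1.
      by rewrite /term_cst lerDr !addr_ge0// mulr_ge0// addr_ge0// exprn_ge0.
    exact: (ler_wpM2r (addr_ge0 (tau0 A) (exprn_ge0 _ mu1_ge0)) (ler_wpM2r M0 E1)).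
have q3 := q3_of AF Ap.
have H1 := low_bound pQ permQ ml iL3 a12 TA iT iTa dT q3 (gd := fun j => fd j.+1) (M := M) AF.
have {}H1 : `|\int[Q]_v (fd 1%N (S v) * T A v) -
     kap Q l T A * \int[Q]_v fd #|A|.+1 (\sum_(i in ~: A) L i v)|
    <= (2 ^+ k + 1) * M * k%:R * (tau A + mu2 ^+ #|A|.-1 * mu3).
  apply: H1.
  - by move=> j jk; apply: dfd; clear -jk; lia.
  - by move=> j jk; apply: fdM; clear -jk; lia.
  - by apply: measurable_fd; clear; lia.
  - by apply: measurable_fd; clear -Ak; lia.
have H2 : `|\int[Q]_v fd #|A|.+1 (\sum_(i in ~: A) L i v) - I #|A| | <= (k%:R + 3) * M * beta.
  apply: (@le_trans _ _ ((#|A|%:R + 3) * M * beta)); last first.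
    by rewrite ler_wpM2r ?(ltW b0)// ler_wpM2r// lerD2r ler_nat.
  (* The family starts at the derivative of order |A| + 1 and uses three more, reaching at most
     order k + 4. *)
  apply: (normal_approx_partial pQ permQ ml iL3 L1 L2 A (gd := fun j => fd (j + #|A|.+1)%N)).
  - by move=> j j3 z; apply: dfd; clear -j3 Ak; lia.
  - by move=> j /andP[j0 j3] z; apply: fdM; clear -j0 j3 Ak; lia.
have H3 := kap_le pQ permQ ml iL3 a12 iT iTa q3 AF.
have H4 := dist_mul_le H1 H2 H3.
apply: le_trans H4 _.
have P1 : 0 <= mu2 ^+ #|A|.-1 * mu3 by exact: (mulr_ge0 (exprn_ge0 _ mu2_ge0) mu3_ge0).
exact: (cost_algebra M0 (le_trans ler01 two_k) (ler0n R k) (tau0 A) P1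
  (exprn_ge0 _ mu2_ge0) (ltW b0) b1).
Qed.

(** There are at most n^j sets of size j, and each of the j factors in [cost] absorbs one n. *)
Lemma cost_sum : beta <= 1 -> \sum_(A in F) cost #|A| <= k%:R * (2 * 2 ^+ k) * beta.
Proof.
move=> b1; rewrite sum_by_card -mulrA.
apply: (@le_trans _ _ (\sum_(1 <= j < k.+1) (2 * 2 ^+ k * beta))); last first.
  by rewrite sumr_const_nat subn1 -[leLHS]mulr_natl lexx.
apply: ler_sum_nat => j /andP[j0]; rewrite ltnS => jk.
have jk' : (0 < j <= k)%N by rewrite j0.
have c0 : 0 <= cost j.
  rewrite /cost; case: ifP => _; last exact: (exprn_ge0 _ mu1_ge0).
  exact: (addr_ge0 (mulr_ge0 (exprn_ge0 _ mu2_ge0) mu3_ge0)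
    (mulr_ge0 (exprn_ge0 _ mu2_ge0) (ltW b0))).
rewrite (eq_bigr (fun=> cost j)); last by move=> A /eqP ->.
apply: le_trans (card_sets_le _ _ c0) _.
rewrite /cost; case: ifP => jp; last first.
  have js : 1 <= j%:R * s by rewrite leNgt -ps// jp.
  have := mu1_pow_le permQ ml iL3 L2 a12 jk' b1 js.
  have : 0 <= 2 ^+ k * beta by rewrite mulr_ge0 ?exprn_ge0// ltW.
  by rewrite -[2 * _ * beta]mulrA; lra.
have q3 : q <= 3.
  have : s <= j%:R * s by rewrite ler_peMl// ler1n.
  by move: jp; rewrite ps// ; lra.
have := mu23_pow_le permQ ml iL3 L2 a12 jk' b1 q3.
have := ler_wpM2r (ltW b0) (mu2_pow_le1 permQ ml iL3 L2 a12 jk b1 q3).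
by rewrite mulrDr -[2 * _ * beta]mulrA; lra.
Qed.

Let C10 : 1 <= C1.
Proof. by rewrite /term_cst; apply: le_trans two_k _; rewrite lerDr !addr_ge0// mulr_ge0// addr_ge0// exprn_ge0. Qed.

Let fd_normal : `|\int[Q]_v fd 0%N (S v) - \int[normal_prob 0 1]_x fd 0%N x| <= 3 * M * beta.
Proof.
apply: (normal_approx pQ permQ ml iL3 L1 L2).
have k0 : (0 < k + 4)%N by clear; lia.
have k1 : (1 < k + 4)%N by clear; lia.
have k2 : (2 < k + 4)%N by clear; lia.
exists (fd 1%N), (fd 2%N); split; [by exists M; exact: lip_fd..|].
by move=> x y; exact: (taylor2 x y (dfd k0) (dfd k1) (dfd k2) (fdM (j := 3) k2)).
Qed.

Let small_beta : beta <= 1 ->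
  `|\int[Q]_v fd 0%N (S v + TT v) - \int[normal_prob 0 1]_x fd 0%N x - \sum_(A in F) main_term A|
  <= 2 * M * 4 ^+ k * Gam + 3 * M * beta + C1 * M * (Gam + k%:R * (2 * 2 ^+ k) * beta).
Proof.
move=> b1.
have k0 : (0 < k + 4)%N by clear; lia.
have k1 : (1 < k + 4)%N by clear; lia.
have H1 := taylor_remainder permQ ml iL3 a12 TA iT iTa dT (dfd k0) (dfd k1)
  (fdM (j := 1) k0) (fdM (j := 2) k1).
have H2 := fd_normal.
have H3 : `|\sum_(A in F) \int[Q]_v (fd 1%N (S v) * T A v) - \sum_(A in F) main_term A|
    <= C1 * M * (Gam + k%:R * (2 * 2 ^+ k) * beta).
  rewrite -sumrB; apply: le_trans (ler_norm_sum _ _ _) _.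
  apply: (@le_trans _ _ (\sum_(A in F) C1 * M * (tau A + cost #|A|))).
    by apply: ler_sum => A AF; exact: term_bound.
  rewrite -mulr_sumr big_split /=; apply: ler_wpM2l.
    exact: (mulr_ge0 (le_trans ler01 C10) M0).
  by rewrite lerD2l; exact: cost_sum.
move: H1 H2 H3; rewrite /=.
move: (\int[Q]_v fd 0%N (S v + TT v)) (\int[Q]_v fd 0%N (S v)) (\int[normal_prob 0 1]_x fd 0%N x).
move: (\sum_(A in F) \int[Q]_v (fd 1%N (S v) * T A v)) (\sum_(A in F) main_term A).
move=> x1 x2 x3 x4 x5 H1 H2 H3.
rewrite (_ : x3 - x5 - x2 = (x3 - x4 - x1) + (x4 - x5) + (x1 - x2)); last by ring.
exact: (le_trans (ler_normD _ _) (lerD (le_trans (ler_normD _ _) (lerD H1 H2)) H3)).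
Qed.

Let TT_moment : \int[Q]_v powR `|TT v| a <= 4 ^+ k * Gam.
Proof.
have a12' : 1 < a <= 2 by have /andP[-> /ltW] := a12.
apply: le_trans (moment_sum_le a12' TA iT iTa dT (fintype.subxx F)) _.
rewrite mulr_sumr; apply: ler_sum => A; rewrite inE => /andP[_ Ak].
have Ak4 : 4 ^+ #|A| <= 4 ^+ k :> R by rewrite ler_eXn2l// ltr1n.
exact: (ler_wpM2r (tau0 A) Ak4).
Qed.

(** When beta >= 1 nothing has to be expanded: the main terms can be estimated away. *)
Let main_le : 1 <= beta -> `|\sum_(A in F) main_term A| <= M * (Gam + k%:R * 2 ^+ k * beta).
Proof.
move=> b1; apply: le_trans (ler_norm_sum _ _ _) _.
pose w j := if (j <= p)%N then mu2 ^+ j else 0.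
apply: (@le_trans _ _ (\sum_(A in F) M * (tau A + w #|A|))).
  apply: ler_sum => A AF; rewrite /main_term /w; case: ifP => Ap; last first.
    by rewrite normr0 addr0; exact: (mulr_ge0 M0 (tau0 A)).
  have Ak : (#|A| <= k)%N by move: AF; rewrite inE => /andP[].
  rewrite normrM mulrC.
  exact: (ler_pM (normr_ge0 _) (normr_ge0 _) (I_le Ak)
    (kap_le pQ permQ ml iL3 a12 iT iTa (q3_of AF Ap) AF)).
rewrite -mulr_sumr big_split /=; apply: (ler_wpM2l M0); rewrite lerD2l.
rewrite sum_by_card -mulrA.
apply: (@le_trans _ _ (\sum_(1 <= j < k.+1) (2 ^+ k * beta))); last first.
  by rewrite sumr_const_nat subn1 -[leLHS]mulr_natl lexx.
apply: ler_sum_nat => j /andP[j0]; rewrite ltnS => jk.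
rewrite (eq_bigr (fun=> w j)); last by move=> A /eqP ->.
have w0 : 0 <= w j.
  by rewrite /w; case: ifP => _ //; exact: (exprn_ge0 _ mu2_ge0).
apply: le_trans (card_sets_le _ _ w0) _.
rewrite /w; case: ifP => jp; last first.
  by rewrite mulr0; exact: (mulr_ge0 (le_trans ler01 two_k) (ltW b0)).
have js : j%:R * s < 1 by rewrite -ps// j0.
have q3 : q <= 3.
  have : s <= j%:R * s by rewrite ler_peMl// ler1n.
  by move: js; lra.
exact: (mu2_pow_le permQ ml iL3 L2 a12 jk b1 q3 (ltW js)).
Qed.

Lemma expansion :
  `|\int[Q]_v fd 0%N (S v + TT v) - \int[normal_prob 0 1]_x fd 0%N x - \sum_(A in F) main_term A|
  <= @expansion_cst R k * M * (beta + Gam).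
Proof.
have X0 : 0 <= 4 ^+ k :> R by rewrite exprn_ge0.
have E0 : 0 <= 2 ^+ k :> R by rewrite exprn_ge0.
have Z0 : 0 <= k%:R * (2 * 2 ^+ k) :> R by rewrite !mulr_ge0.
have [b1|/ltW b1] := leP beta 1.
  exact: (le_trans (small_beta b1) (sum_algebra1 M0 X0 (le_trans ler01 C10) Z0 (ltW b0) Gam0)).
have k0 : (0 < k + 4)%N by clear; lia.
(* Here |y| <= 1 + |y|^a, and 1 <= beta pays for the constant. *)
have TT1 : \int[Q]_v `|TT v| <= beta + 4 ^+ k * Gam.
  have iTTa : itg Q (fun v => powR `|TT v| a).
    have a12' : 1 < a <= 2 by have /andP[-> /ltW] := a12.
    exact: (itg_powR_sum a12' iT iTa (fintype.subxx F)).
  have a1' : 1 <= a by have /andP[/ltW] := a12.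
  have : \int[Q]_v `|TT v| <= \int[Q]_v (1 + powR `|TT v| a).
    apply: ler_Rintegral; [exact: itg_norm|apply: itgD => //; exact: itg_cst|].
    by move=> v; exact: (ler_1DpowR a1' (normr_ge0 _)).
  rewrite RintegralD//; last exact: itg_cst.
  rewrite Rintegral_probability_cst => /le_trans; apply.
  exact: (lerD b1 TT_moment).
have H1 := le_trans (crude_bound (lip_fd k0)) (ler_wpM2l M0 TT1).
have H2 := fd_normal.
have H3 := main_le b1.
have WZ : k%:R * 2 ^+ k <= k%:R * (2 * 2 ^+ k) :> R.
  by rewrite ler_wpM2l// ler_peMl// ler1n.
apply: le_trans (sum_algebra2 M0 X0 C10 Z0 WZ (ltW b0) Gam0).
move: H1 H2 H3; rewrite /=.
move: (\int[Q]_v fd 0%N (S v + TT v)) (\int[Q]_v fd 0%N (S v)) (\int[normal_prob 0 1]_x fd 0%N x).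
move: (\sum_(A in F) main_term A).
move=> x2 x3 x4 x5 H1 H2 H3.
rewrite (_ : x3 - x5 - x2 = (x3 - x4) + (x4 - x5) - x2); last by ring.
exact: (le_trans (ler_normB _ _) (lerD (le_trans (ler_normD _ _) (lerD H1 H2)) H3)).
Qed.

End expansion.

(** * Transfer to the law of the sample *)

(** The lists of A followed by its complement, and of B followed by its complement, are matched
    entry by entry. Prescribing one value as well is what transports degeneracy from a given index
    to another. *)
Lemma perm_onto {n : nat} (A B : {set 'I_n}) (i j : 'I_n) : #|A| = #|B| -> i \in A -> j \in B ->
  exists s : {perm 'I_n}, s @: A = B /\ s i = j.
Proof.
move=> AB iA jB; pose list (K : {set 'I_n}) := enum K ++ enum (~: K).
have list_uniq K : uniq (list K).
  rewrite cat_uniq !enum_uniq /= andbT; apply/hasPn => x.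
  by rewrite !mem_enum inE.
have list_size K : size (list K) = n by rewrite size_cat -!cardE cardsC card_ord.
have list_mem K x : x \in list K by rewrite mem_cat !mem_enum inE orbN.
pose f x := nth i (list B) (index x (list A)).
have f_inj : injective f.
  move=> x y; rewrite /f => /eqP; rewrite nth_uniq ?list_size//.
  - by move=> /eqP; exact: (index_inj x).
  - by rewrite -[ltnRHS](list_size A) index_mem.
  - by rewrite -[ltnRHS](list_size A) index_mem.
pose s := perm f_inj.
have sAB : s @: A = B.
  apply/eqP; rewrite eqEcard card_imset ?AB ?leqnn ?andbT; last exact: perm_inj.
  apply/fintype.subsetP => _ /imsetP[x xA ->]; rewrite permE /f.
  have xi : (index x (list A) < size (enum B))%N.
    by rewrite -cardE -AB cardE /list index_cat mem_enum xA index_mem mem_enum.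
  by rewrite nth_cat xi -mem_enum mem_nth.
(* The transposition exchanges two elements of B, so the image of A is unchanged. *)
exists (s * tperm (s i) j)%g; split; last by rewrite permM tpermL.
have siB : s i \in B by rewrite -sAB imset_f.
apply/eqP; rewrite eqEcard card_imset ?AB ?leqnn ?andbT; last exact: perm_inj.
apply/fintype.subsetP => _ /imsetP[x xA ->]; rewrite permM.
have sxB : s x \in B by rewrite -sAB imset_f.
by case: tpermP => [_|_|//].
Qed.

Section law.
Context {d} {Omega : measurableType d} {R : realType} {P : probability Omega R}.
Variables (n : nat) (X : 'I_n -> Omega -> R).
Local Notation V := (n.-tuple R).
Local Notation Xt := (fun w => [tuple X i w | i < n] : V).
Local Notation permute s := (fun v : V => [tuple tnth v (s i) | i < n]).

Lemma measurable_mktuple {d'} {S : measurableType d'} m (Y : 'I_m -> S -> R) :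
  (forall i, measurable_fun setT (Y i)) ->
  measurable_fun setT (fun w => [tuple Y i w | i < m] : m.-tuple R).
Proof.
move=> mY; apply/measurable_fun_tnthP => i.
by rewrite (_ : _ \o _ = Y i)//; apply/funext => w /=; rewrite tnth_mktuple.
Qed.

Lemma law_exists : iid P X -> exists Q : probability V R,
  [/\ has_law P Xt Q, product_law Q & forall s : {perm 'I_n}, has_law Q (permute s) Q].
Proof.
move=> [mX [indep ident]]; have mXt := measurable_mktuple mX.
pose Y : {mfun Omega >-> V} := HB.pack Xt (isMeasurableFun.Build _ _ _ _ Xt mXt).
pose Q : probability V R := distribution P Y.
have QE A : Q A = P (Xt @^-1` A) by [].
have Qi (i : 'I_n) (B : set R) : Q [set v | B (tnth v i)] = P (X i @^-1` B).
  rewrite QE; congr (P _); apply/seteqP; split => w /=; by rewrite tnth_mktuple.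
have pQ : product_law Q.
  move=> B mB; transitivity (P (\bigcap_(i in [set: 'I_n]) (X i @^-1` B i))).
    rewrite QE; congr (P _); apply/seteqP; split => w /= H i.
      by move=> _; have := H i; rewrite tnth_mktuple.
    by rewrite tnth_mktuple; exact: H.
  by rewrite indep//; apply: eq_bigr => i _; rewrite Qi.
exists Q; split => // s.
have ms : measurable_fun setT (permute s).
  by apply: measurable_mktuple => i; exact: measurable_tnth.
split=> // A mA.
pose m' : {measure set V -> \bar R} :=
  @measure_function_pushforward__canonical__measure_function_Measure _ _ _ _ R Q _ ms.
apply: (@tuple_law_unique _ _ m' Q) mA.
  by rewrite /m' /= /pushforward preimage_setT [X in (X < _)%E](probability_setT Q) ltry.
move=> B mB; rewrite /m' /= /pushforward.
have -> : permute s @^-1` rect B = rect (fun i => B (s^-1 i)%g).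
  apply/seteqP; split => v /= H i; first by have := H (s^-1 i)%g; rewrite tnth_mktuple permKV.
  by rewrite tnth_mktuple; have := H (s i); rewrite permK.
rewrite [LHS]pQ// [RHS]pQ// (reindex_inj (@perm_inj _ s)) /=; apply: eq_bigr => i _.
by rewrite permK !Qi; exact: ident.
Qed.

End law.

(** * Symmetric kernels and permutations of the sample *)

Section symmetric.
Context {R : realType} (n k : nat) (t : forall j : nat, j.-tuple R -> R).
Local Notation V := (n.-tuple R).
Hypothesis sym : forall j (s : j.-tuple R) (sg : 'I_j -> 'I_j), (1 <= j <= k)%N ->
  injective sg -> t [tuple tnth s (sg i) | i < j] = t s.

Definition coord (i : 'I_n) (v : V) : R := tnth v i.
Local Notation T := (TA coord t).
Local Notation F := (small_sets n k).

(** [TA] lists its arguments in the order of [enum_val]; by symmetry any injective listing of A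
    gives the same value. The separate j avoids transporting tuples between equal lengths. *)
Lemma TA_enum j (A : {set 'I_n}) (e : 'I_j -> 'I_n) v : A \in F -> #|A| = j -> injective e ->
  (forall m, e m \in A) -> T A v = t [tuple tnth v (e m) | m < j].
Proof.
rewrite inE => AF Aj; move: e; case: j / Aj => e inj_e eA.
pose sg m := enum_rank_in (eA m) (e m).
have sgE m : enum_val (sg m) = e m by rewrite enum_rankK_in.
rewrite /TA -[LHS](sym _ (sg := sg))//; last by move=> x y /(congr1 enum_val); rewrite !sgE => /inj_e.
by congr t; apply: eq_from_tnth => m; rewrite !tnth_mktuple sgE.
Qed.

Lemma TA_permute (A : {set 'I_n}) (s : {perm 'I_n}) v : A \in F ->
  T A [tuple tnth v (s i) | i < n] = T (s @: A) v.
Proof.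
move=> AF; have cA : #|s @: A| = #|A| by rewrite card_imset//; exact: perm_inj.
have sAF : s @: A \in F by move: AF; rewrite !inE cA.
rewrite (@TA_enum #|A| (s @: A) (fun m => s (enum_val m)) v)//.
- by congr t; apply: eq_from_tnth => m; rewrite !tnth_mktuple /coord tnth_mktuple.
- by move=> x y /perm_inj/enum_val_inj.
- by move=> m; rewrite imset_f// enum_valP.
Qed.

Lemma depends_TA A : depends A (T A).
Proof.
move=> v v' vv; congr t; apply: eq_from_tnth => m.
by rewrite !tnth_mktuple; apply: vv; exact: enum_valP.
Qed.

End symmetric.

(** * Orthogonality of products of the L_i to the other degenerate terms *)

Section orthogonality.
Context {R : realType} (n : nat).
Local Notation V := (n.-tuple R).
Variable Q : probability V R.
Hypothesis pQ : product_law Q.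
Hypothesis permQ : forall s : {perm 'I_n},
  has_law Q (fun v : V => [tuple tnth v (s i) | i < n]) Q.
Variables (l : R -> R) (i0 : 'I_n).
Hypothesis ml : measurable_fun setT l.
Local Notation L := (@summand R n l).
Hypothesis iL3 : itg Q (fun v => `|L i0 v| ^+ 3).
Hypothesis L1 : \int[Q]_v L i0 v = 0.
Variables (a : R) (k : nat) (T : {set 'I_n} -> V -> R).
Hypothesis a12 : 1 < a < 2.
Local Notation F := (small_sets n k).
Hypothesis TA : forall A, A \in F -> depends A (T A).
Hypothesis iT : forall A, A \in F -> itg Q (T A).
Hypothesis iTa : forall A, A \in F -> itg Q (fun v => powR `|T A v| a).
Hypothesis dT : forall A, A \in F -> forall i, i \in A -> degenerate Q i (T A).
Hypothesis q3 : a / (a - 1) <= 3.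

Lemma itg_prod_T (A B : {set 'I_n}) : B \in F -> itg Q (fun v => (\prod_(i in A) L i v) * T B v).
Proof.
move=> BF; apply: (itg_mul_T a12 iT iTa BF); first exact: measurable_prod_summand.
exact: (m2_prod pQ permQ ml iL3 a12 q3 A).1.
Qed.

Let iL i : itg Q (L i).
Proof. exact: (itg_summand (h := id) permQ _ (itg_moment1 (measurable_summand ml i0) iL3)). Qed.

Let degenerate_L i : degenerate Q i (L i).
Proof.
apply: (degenerate_mean0 pQ) => //; first by apply: depends_summand; rewrite inE.
by rewrite (Rintegral_summand (h := id) (i0 := i0) permQ).
Qed.

(** Only B = A survives: if B has an index outside A, degeneracy of T_B kills the term; if B is a
    proper subset of A, an index of A outside B does so because its L_i has mean zero. *)
Lemma Rintegral_prod_sum (A : {set 'I_n}) : A \in F ->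
  \int[Q]_v ((\prod_(i in A) L i v) * \sum_(B in F) T B v) = kap Q l T A.
Proof.
move=> AF; under eq_Rintegral do rewrite mulr_sumr.
rewrite Rintegral_sum; last by move=> B BF; exact: itg_prod_T.
rewrite (bigD1 A)//= big1 ?addr0// => B /andP[BF BA].
have [BsA|/fintype.subsetPn[i iB iA]] := boolP (B \subset A); last first.
  apply: (dT BF iB); [exact: measurable_prod_summand| |exact: itg_prod_T].
  apply: depends_prod => j jA; apply: depends_summand; rewrite !inE.
  by apply: contraNneq iA => <-.
have /properP[_ [i iA iB]] : B \proper A by rewrite finset.properEneq BA BsA.
have E v : (\prod_(i in A) L i v) * T B v = (\prod_(j in A :\ i) L j v) * T B v * L i v.
  by rewrite (big_setD1 i)//=; ring.
under eq_Rintegral do rewrite E.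
apply: (degenerate_L (i := i)).
- apply: measurable_funM; first exact: measurable_prod_summand.
  exact: (itg_measurable (iT BF)).
- apply: depends2.
    apply: depends_prod => j; rewrite !inE => /andP[ji _].
    by apply: depends_summand; rewrite !inE.
  apply: dependsS (TA BF); apply/fintype.subsetP => j jB; rewrite !inE.
  by apply: contraTneq jB => ->.
- by have := itg_prod_T A BF; under eq_fun do rewrite E.
Qed.

End orthogonality.

Section exchangeable.
Context {R : realType} (n k : nat) (t : forall j : nat, j.-tuple R -> R).
Local Notation V := (n.-tuple R).
Hypothesis sym : forall j (s : j.-tuple R) (sg : 'I_j -> 'I_j), (1 <= j <= k)%N ->
  injective sg -> t [tuple tnth s (sg i) | i < j] = t s.
Variable Q : probability V R.
Hypothesis permQ : forall s : {perm 'I_n},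
  has_law Q (fun v : V => [tuple tnth v (s i) | i < n]) Q.
Local Notation T := (TA (@coord R n) t).
Local Notation F := (small_sets n k).

Lemma small_sets_perm (A B : {set 'I_n}) i j : A \in F -> #|A| = #|B| ->
  i \in A -> j \in B ->
  exists s : {perm 'I_n}, [/\ s @: A = B, s i = j & forall v : V,
    T A [tuple tnth v (s i) | i < n] = T B v].
Proof.
move=> AF AB iA jB; have [s [sAB sij]] := perm_onto AB iA jB.
by exists s; split=> // v; rewrite (TA_permute sym s v AF) sAB.
Qed.

Let small_sets_perm0 (A B : {set 'I_n}) : A \in F -> #|A| = #|B| ->
  exists s : {perm 'I_n}, s @: A = B /\ forall v : V,
    T A [tuple tnth v (s i) | i < n] = T B v.
Proof.
move=> AF AB; move: (AF); rewrite inE => /andP[A0 _]; move: (A0).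
rewrite card_gt0 => /set0Pn[i iA]; have /set0Pn[j jB] : B != finset.set0 by rewrite -card_gt0 -AB.
by have [s [sAB _ sT]] := small_sets_perm AF AB iA jB; exists s.
Qed.

Lemma itg_TA_card (h : R -> R) (A B : {set 'I_n}) : A \in F -> #|A| = #|B| -> itg Q (fun v => h (T A v)) ->
  itg Q (fun v => h (T B v)).
Proof.
move=> AF /(small_sets_perm0 AF)[s [_ sT]] /(itg_law (permQ s)).
by under eq_fun do rewrite sT.
Qed.

Lemma Rintegral_TA_card (h : R -> R) (A B : {set 'I_n}) : A \in F -> #|A| = #|B| ->
  itg Q (fun v => h (T A v)) -> \int[Q]_v h (T B v) = \int[Q]_v h (T A v).
Proof.
move=> AF /(small_sets_perm0 AF)[s [_ sT]] /(Rintegral_law (permQ s)) <-.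
by apply: eq_Rintegral => v _; rewrite sT.
Qed.

Lemma kap_card l (A B : {set 'I_n}) : A \in F -> #|A| = #|B| ->
  itg Q (fun v => (\prod_(i in A) summand l i v) * T A v) ->
  kap Q l T B = kap Q l T A.
Proof.
move=> AF /(small_sets_perm0 AF)[s [sAB sT]] /(Rintegral_law (permQ s)) E; rewrite [RHS]/kap -[RHS]E.
apply: eq_Rintegral => v _; rewrite sT -sAB; congr (_ * _).
rewrite big_imset /=; last by move=> x y _ _; exact: perm_inj.
by apply: eq_bigr => i _; rewrite /summand tnth_mktuple.
Qed.

(** Degeneracy is assumed only for the first set of each size and its first index; this carries it
    to all sets and all their indices. *)
Lemma degenerate_TA_card (A B : {set 'I_n}) i j : A \in F -> #|A| = #|B| -> i \in A -> j \in B ->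
  itg Q (T A) -> degenerate Q i (T A) -> degenerate Q j (T B).
Proof.
move=> AF AB iA jB iTA dA H mH Hj iHT.
have [s [sAB sij sT]] := small_sets_perm AF AB iA jB.
have sVT v : T B [tuple tnth v (s^-1 i)%g | i < n] = T A v.
  rewrite -sT; congr (T A _); apply: eq_from_tnth => m.
  by rewrite !tnth_mktuple permK.
rewrite -(Rintegral_law (permQ s^-1%g) iHT).
under eq_Rintegral do rewrite sVT.
apply: dA.
- by apply: measurableT_comp mH _; have [] := permQ s^-1%g.
- move=> v v' vv; apply: Hj => m; rewrite !inE => mj; rewrite !tnth_mktuple; apply: vv.
  by rewrite !inE; apply: contra mj => /eqP E; rewrite -sij -E permKV.
- have := itg_law (permQ s^-1%g) iHT; by under eq_fun do rewrite sVT.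
Qed.

End exchangeable.

(** Bridges degeneracy on tuples and the sigma-algebra of X_2, ..., X_j. Setting the other
    coordinates to 0 leaves the event unchanged, and the good events form a sigma-algebra containing
    the one-coordinate ones. *)
Lemma sigma_2_to_preimage {d} {Omega : measurableType d} {R : realType} (n : nat)
    (X : 'I_n -> Omega -> R) (j : nat) (D : set (n.-tuple R)) :
  measurable D -> depends [set i : 'I_n | (0 < i < j)%N]%SET D ->
  sigma_2_to X j ((fun w => [tuple X i w | i < n]) @^-1` D).
Proof.
move=> mD Dj.
pose r w : n.-tuple R := [tuple if (0 < i < j)%N then X i w else 0 | i < n].
have -> : (fun w => [tuple X i w | i < n]) @^-1` D = r @^-1` D.
  apply/funext => w /=; apply: Dj => i; rewrite !inE => ij.
  by rewrite !tnth_mktuple ij.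
set G := sigma_2_to X j; have sG : sigma_algebra setT G by exact: smallest_sigma_algebra.
have sr : sigma_algebra setT [set E : set (n.-tuple R) | G (r @^-1` E)].
  have [G0 GC GU] := sG; split => /=.
  - by rewrite preimage_set0.
  - by move=> E GE; rewrite setTD preimage_setC -setTD; exact: GC.
  - by move=> E GE; rewrite preimage_bigcup; exact: GU.
apply: (smallest_sub sr _ mD); rewrite -bigcup_seq => _ [i _] [C mC <-] /=.
rewrite setTI.
have [ij|ij] := boolP (0 < i < j)%N.
  rewrite (_ : r @^-1` _ = X i @^-1` C); last first.
    by apply/funext => w; rewrite /preimage /= tnth_mktuple ij.
  apply: sub_sigma_algebra; rewrite -bigcup_seq_cond.
  exists i; first by rewrite /= mem_index_enum ij.
  by exists C => //; rewrite setTI.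
(* A coordinate frozen at 0 gives the full event or the empty one. *)
have [C0|C0] := pselect (C 0).
  rewrite (_ : r @^-1` _ = setT) ?[setT]setTD0; last first.
    by apply/seteqP; split => w //= _; rewrite tnth_mktuple (negbTE ij).
  have [G0 GC _] := sG; rewrite -(setD0 setT); exact: GC.
rewrite (_ : r @^-1` _ = set0); last first.
  by apply/seteqP; split => w //=; rewrite tnth_mktuple (negbTE ij).
by have [] := sG.
Qed.

Lemma card_ord_ltn (n j : nat) : (j <= n)%N -> #|[set i : 'I_n | (i < j)%N]%SET| = j.
Proof.
move=> jn; rewrite -sum1_card; under eq_bigl do rewrite inE.
by rewrite (big_ord_narrow jn) sum1_card card_ord.
Qed.

Lemma sumr_card_const {R : realType} (n j : nat) (x : R) :
  \sum_(A : {set 'I_n} | #|A| == j) x = 'C(n, j)%:R * x.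
Proof.
rewrite sumr_const -[LHS]mulr_natl; congr (_%:R * _).
rewrite -[X in 'C(X, _)]card_ord -card_draws; apply: eq_card => A.
by rewrite !inE.
Qed.

Lemma itg_ge0 {d} {T : measurableType d} {R : realType} (mu : {measure set T -> \bar R})
    (f : T -> R) : measurable_fun setT f -> (forall x, 0 <= f x) ->
  (\int[mu]_x (f x)%:E < +oo)%E -> itg mu f.
Proof.
move=> mf f0 fi; apply/integrableP; split; first exact/measurable_EFinP.
by under eq_integral do rewrite gee0_abs ?lee_fin//.
Qed.

(** * The quantities of the statement expressed through the law of the sample *)

Section transfer.
Context {R : realType} (k n : nat) (hn : (0 < n)%N) {d} {Omega : measurableType d}
  (P : probability Omega R) (X : 'I_n -> Omega -> R) (l : R -> R)
  (t : forall j : nat, j.-tuple R -> R).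
Local Notation V := (n.-tuple R).
Local Notation Xt := (fun w => [tuple X i w | i < n] : V).
Local Notation i0 := (Ordinal hn).
Variable Q : probability V R.
Hypothesis lawQ : has_law P Xt Q.
Hypothesis pQ : product_law Q.
Hypothesis permQ : forall s : {perm 'I_n},
  has_law Q (fun v : V => [tuple tnth v (s i) | i < n]) Q.
Hypothesis ml : measurable_fun setT l.
Hypothesis mt : forall j, (1 <= j <= k)%N -> measurable_fun setT (@t j).
Hypothesis sym : forall j (s : j.-tuple R) (sg : 'I_j -> 'I_j), (1 <= j <= k)%N ->
  injective sg -> t [tuple tnth s (sg i) | i < j] = t s.
Hypothesis L1 : (\int[P]_w (Lv X l i0 w)%:E = 0)%E.
Hypothesis L2 : ((n%:R)%:E * \int[P]_w ((Lv X l i0 w) ^+ 2)%:E = 1)%E.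
Hypothesis hT : forall j, (1 <= j <= k)%N -> (j <= n)%N ->
  P.-integrable setT (EFin \o Tfirst X t j) /\
  cond_exp_zero P (sigma_2_to X j) (Tfirst X t j).
Hypothesis h3 : (\int[P]_w (`|Lv X l i0 w| ^+ 3)%:E < +oo)%E.
Local Notation L := (@summand R n l).
Local Notation T := (TA (@coord R n) t).
Local Notation F := (small_sets n k).
Local Notation first j := ([set i : 'I_n | (i < j)%N]%SET).

Lemma Lv_law i w : Lv X l i w = L i (Xt w).
Proof. by rewrite /Lv /summand tnth_mktuple. Qed.

Lemma TA_law A w : TA X t A w = T A (Xt w).
Proof.
by rewrite /TA; congr t; apply: eq_from_tnth => m; rewrite !tnth_mktuple /coord tnth_mktuple.
Qed.

Lemma TT_law w : TT X t k w = \sum_(A in F) T A (Xt w).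
Proof. by rewrite /TT; apply: eq_big => A; rewrite ?inE// TA_law. Qed.

Lemma SS_law w : SS X l t k w = \sum_(i < n) L i (Xt w) + \sum_(A in F) T A (Xt w).
Proof. by rewrite /SS TT_law /LL; congr (_ + _); apply: eq_bigr => i _; exact: Lv_law. Qed.

Lemma itg_L3 : itg Q (fun v => `|L i0 v| ^+ 3).
Proof.
have mL : measurable_fun setT (fun v => `|L i0 v| ^+ 3).
  apply: measurable_funX; apply: measurableT_comp => //; exact: measurable_summand.
apply: (itg_lawP lawQ) => //; under eq_fun do rewrite -Lv_law; apply: itg_ge0 => //.
by under eq_fun do rewrite Lv_law; exact: measurableT_comp mL (proj1 lawQ).
Qed.

Let mL0 : measurable_fun setT (L i0) := measurable_summand ml i0.
Let iL : itg Q (L i0) := itg_moment1 mL0 itg_L3.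
Let iL2 : itg Q (fun v => L i0 v ^+ 2) := itg_moment2 mL0 itg_L3.

Lemma mean_L : \int[Q]_v L i0 v = 0.
Proof.
rewrite -(Rintegral_law lawQ iL) /Rintegral -[RHS]/(fine 0%E) -L1.
by congr fine; apply: eq_integral => w _; rewrite Lv_law.
Qed.

Lemma variance_L : n%:R * \int[Q]_v L i0 v ^+ 2 = 1.
Proof.
apply: EFin_inj; rewrite EFinM (EFin_Rintegral iL2) -(integral_law lawQ iL2) -L2.
by congr (_ * _)%E; apply: eq_integral => w _; rewrite Lv_law.
Qed.

Lemma beta_law : beta_ X l P i0 = beta3 Q l i0.
Proof.
rewrite /beta_ /beta3 -(Rintegral_law lawQ itg_L3); congr (_ * _).
by apply: eq_Rintegral => w _; rewrite Lv_law.
Qed.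

Lemma measurable_TA A : A \in F -> measurable_fun setT (T A).
Proof.
rewrite inE => AF; apply: measurableT_comp (mt AF) _.
by apply: measurable_mktuple => i; exact: measurable_tnth.
Qed.

Lemma small_setsP A : A \in F ->
  [/\ (0 < #|A| <= k)%N, (#|A| <= n)%N, first #|A| \in F & #|first #|A| | = #|A|].
Proof.
rewrite inE => AF; have An : (#|A| <= n)%N by rewrite -[leqRHS]card_ord max_card.
by split => //; rewrite ?inE card_ord_ltn.
Qed.

Lemma itg_TA A : A \in F -> itg Q (T A).
Proof.
move=> /small_setsP[Ak An fF fA].
apply: (itg_TA_card (h := id) sym permQ fF fA).
apply: (itg_lawP lawQ); first exact: measurable_TA.
by have [+ _] := hT Ak An; apply: eq_integrable => // w _ /=; rewrite /Tfirst TA_law.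
Qed.

Lemma degenerate_TA A i : A \in F -> i \in A -> degenerate Q i (T A).
Proof.
move=> AF iA; have [Ak An fF fA] := small_setsP AF.
(* Index 0 is X_1; removing it from the first |A| indices leaves those generating [sigma_2_to]. *)
have z0 : i0 \in first #|A| by rewrite inE /=; case/andP: Ak.
apply: (degenerate_TA_card sym permQ fF fA z0 iA (itg_TA fF)).
apply: (degenerate_intro pQ (depends_TA (A := first #|A|) t) (itg_TA fF)) => D mD D0.
have [_ cz] := hT Ak An.
have XD : sigma_2_to X #|A| (Xt @^-1` D).
  apply: sigma_2_to_preimage => //; apply: dependsS D0.
  apply/fintype.subsetP => j; rewrite !inE -val_eqE /= => /andP[j0 ->].
  by rewrite lt0n j0.
have mXD : measurable (Xt @^-1` D).
  by rewrite -[X in measurable X]setTI; exact: (proj1 lawQ).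
have iDT : itg Q (fun v => \1_D v * T (first #|A|) v).
  apply: (itg_bounded_mul (C := 1)); [exact: measurable_indic| |exact: itg_TA].
  by move=> v; rewrite indicE; case: (v \in D); rewrite ?normr1 ?normr0.
rewrite -(Rintegral_law lawQ iDT) /Rintegral -[RHS]/(fine 0%E) -(cz _ XD); congr fine.
rewrite [RHS]integral_mkcond; apply: eq_integral => w _.
rewrite patchE indicE /Tfirst TA_law.
have -> : (Xt w \in D) = (w \in Xt @^-1` D) by apply/idP/idP; rewrite !inE.
by case: ifP => _; rewrite ?mul1r ?mul0r.
Qed.

Section moments.
Variable a : R.
Hypothesis hTa : forall j, (1 <= j <= k)%N -> (j <= n)%N ->
  (\int[P]_w (powR `|Tfirst X t j w| a)%:E < +oo)%E.

Let mpow A : A \in F -> measurable_fun setT (fun v => powR `|T A v| a).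
Proof.
move=> AF; apply: measurableT_comp (measurable_powR a) _.
by apply: measurableT_comp => //; exact: measurable_TA.
Qed.

Let itg_first A : A \in F -> itg Q (fun v => powR `|T (first #|A|) v| a).
Proof.
move=> /small_setsP[Ak An fF fA]; apply: (itg_lawP lawQ); first exact: mpow.
apply: itg_ge0.
- exact: measurableT_comp (mpow fF) (proj1 lawQ).
- by move=> w; exact: powR_ge0.
- rewrite [X in (X < _)%E](_ : _ = \int[P]_w (powR `|Tfirst X t #|A| w| a)%:E)%E.
    exact: (hTa Ak An).
  by apply: eq_integral => w _; rewrite /Tfirst TA_law.
Qed.

Lemma itg_powR_TA A : A \in F -> itg Q (fun v => powR `|T A v| a).
Proof.
move=> AF; have [_ _ fF fA] := small_setsP AF.
exact: (itg_TA_card (h := fun x => powR `|x| a) sym permQ fF fA (itg_first AF)).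
Qed.

Lemma gamma_law : gamma_ X t k P a = \sum_(A in F) \int[Q]_v powR `|T A v| a.
Proof.
rewrite sum_by_card /gamma_; apply: eq_big_nat => j; rewrite ltnS => jk.
(* For j > n the binomial coefficient is 0 and there are no sets of size j. *)
have [jn|nj] := leqP j n; last first.
  rewrite bin_small// mul0r big_pred0// => A; apply/negbTE.
  by rewrite neq_ltn (leq_ltn_trans _ nj)// -[leqRHS]card_ord max_card.
rewrite -sumr_card_const; apply: eq_bigr => A /eqP Aj.
have AF : A \in F by rewrite inE Aj.
have [_ _ fF fA] := small_setsP AF; rewrite -Aj.
rewrite (Rintegral_TA_card (h := fun x => powR `|x| a) sym permQ fF fA (itg_first AF)).
rewrite -(Rintegral_law lawQ (itg_first AF)).
by apply: eq_Rintegral => w _; rewrite /Tfirst TA_law.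
Qed.

Hypothesis a12 : 1 < a < 2.
Hypothesis q3 : a / (a - 1) <= 3.

(** kappa_j pairs the first j summands with all of T; orthogonality keeps only the term of the set
    {1, ..., j}, and the binomial coefficient counts the sets of that size. *)
Lemma kappa_law j : (0 < j <= k)%N ->
  kappa X l t k P j = \sum_(A : {set 'I_n} | #|A| == j) kap Q l T A.
Proof.
move=> jk; rewrite /kappa; have [jn|nj] := leqP j n; last first.
  rewrite bin_small// mul0r big_pred0// => A; apply/negbTE.
  by rewrite neq_ltn (leq_ltn_trans _ nj)// -[leqRHS]card_ord max_card.
have fj := card_ord_ltn jn.
have fF : first j \in F by rewrite inE fj.
have ip B : B \in F -> itg Q (fun v => (\prod_(i in first j) L i v) * T B v).
  exact: (itg_prod_T pQ permQ ml itg_L3 a12 itg_TA itg_powR_TA q3).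
rewrite -sumr_card_const; apply: eq_bigr => A /eqP Aj.
rewrite (kap_card sym permQ fF _ (ip _ fF)) ?Aj//.
rewrite -(Rintegral_prod_sum pQ permQ ml itg_L3 mean_L a12 (fun A _ => depends_TA (A := A) t)
  itg_TA itg_powR_TA (fun A AF i => degenerate_TA (A := A) (i := i) AF) q3 fF).
have isum : itg Q (fun v => (\prod_(i in first j) L i v) * \sum_(B in F) T B v).
  by under eq_fun do rewrite mulr_sumr; exact: itg_sum.
rewrite -(Rintegral_law lawQ isum); apply: eq_Rintegral => w _.
by rewrite TT_law; congr (_ * _); apply: eq_big => i; rewrite ?inE// Lv_law.
Qed.

End moments.

Let itg_SS K (g : R -> R) : lip K g ->
  itg Q (fun v => g (\sum_(i < n) L i v + \sum_(A in F) T A v)).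
Proof.
move=> gK; apply: (itg_lip_comp gK); apply: itgD; last by apply: itg_sum => A; exact: itg_TA.
by apply: itg_sum => i _; exact: (itg_summand (h := id) permQ _ iL).
Qed.

Let Rintegral_SS K (g : R -> R) : lip K g ->
  \int[P]_w g (SS X l t k w) =
  \int[Q]_v g (\sum_(i < n) L i v + \sum_(A in F) T A v).
Proof.
move=> gK; rewrite -(Rintegral_law lawQ (itg_SS gK)).
by apply: eq_Rintegral => w _; rewrite SS_law.
Qed.

(** [M2] serves to make the first derivative Lipschitz, a qualitative use, so the final constant
    contains the first and third derivatives only. *)
Lemma real_expansion1 (g : R -> R) K M2 M kap : rCn 3 g ->
  (forall x, `|dern 1 g x| <= K) -> (forall x, `|dern 2 g x| <= M2) ->
  (forall x, `|dern 3 g x| <= M) ->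
  (forall j, (1 <= j <= k)%N -> (j <= n)%N ->
    (\int[P]_w (powR `|Tfirst X t j w| 1)%:E < +oo)%E) ->
  `|\int[P]_w g (SS X l t k w) - \int[lebesgue_measure]_x (g x * derive1 (Np kap 0) x)|
    <= 3 * (K + M) * (beta_ X l P i0 + gamma_ X t k P 1).
Proof.
move=> [dg cg] gK gM2 gM hT1.
have der j : (j < 3)%N -> forall x : R, is_derive x 1 (dern j g) (dern j.+1 g x).
  by move=> j3 x; apply: DeriveDef; [exact: dg|rewrite -derive1E].
have lipd j c : (j < 3)%N -> (forall x, `|dern j.+1 g x| <= c) -> lip c (dern j g).
  move=> j3 gc x y; have := mean_value_le y (x - y) (der j j3) gc.
  by rewrite [y + _]addrC subrK.
have g0 : lip K (dern 0 g) by exact: (lipd 0%N).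
have g1 : lip M2 (dern 1 g) by exact: (lipd 1%N).
have g2 : lip M (dern 2 g) by exact: (lipd 2%N).
have sg : smooth3 M g.
  exists (dern 1 g), (dern 2 g); split; [by exists K|by exists M2|by exists M|].
  by move=> x y; exact: (taylor2 x y (der 0%N isT) (der 1%N isT) (der 2%N isT) gM).
rewrite (Rintegral_SS g0) Rintegral_Np; first last.
- case=> [|[|//]] _; [exact: (lip_growth_growth g0)|exact: (lip_growth_growth g1)].
- exact: (lip_continuous g1).
- by move=> j j0; apply: dg; rewrite (leq_ltn_trans j0).
rewrite big_geq// addr0 beta_law (gamma_law hT1).
under eq_bigr => A _. under eq_Rintegral do rewrite powRr1//. over.
exact: (expansion1 pQ permQ ml itg_L3 mean_L variance_L itg_TA g0 sg).
Qed.

Lemma real_expansion a p (g : R -> R) M : 1 < a < 2 ->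
  (forall j, (1 <= j <= k)%N -> (j <= n)%N ->
    (\int[P]_w (powR `|Tfirst X t j w| a)%:E < +oo)%E) ->
  (p <= k)%N ->
  (forall j, (0 < j <= k)%N -> (j <= p)%N = (j%:R * (a / (a - 1) - 2) < 1)) ->
  rCn (k + 4) g ->
  (forall j, (0 < j <= k + 4)%N -> forall x, `|dern j g x| <= M) ->
  `|\int[P]_w g (SS X l t k w) -
    \int[lebesgue_measure]_x (g x * derive1 (Np (kappa X l t k P) p) x)|
    <= @expansion_cst R k * M * (beta_ X l P i0 + gamma_ X t k P a).
Proof.
move=> a12 hTa pk ps [dg cg] gM.
have der j : (j < k + 4)%N -> forall x : R, is_derive x 1 (dern j g) (dern j.+1 g x).
  by move=> j3 x; apply: DeriveDef; [exact: dg|rewrite -derive1E].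
have lipd j : (j < k + 4)%N -> lip M (dern j g).
  move=> jk x y; have := mean_value_le y (x - y) (der j jk) (gM j.+1 jk).
  by rewrite [y + _]addrC subrK.
have k0 : (0 < k + 4)%N by clear; lia.
rewrite (Rintegral_SS (lipd 0%N k0)) Rintegral_Np; first last.
- by move=> j jp; apply: (lip_growth_growth (lipd j _)); clear -jp pk; lia.
- by apply: (lip_continuous (lipd _ _)); clear -pk; lia.
- by move=> j jp; apply: dg; clear -jp pk; lia.
have := expansion pQ permQ ml itg_L3 mean_L variance_L itg_TA a12
  (fun A _ => depends_TA (A := A) t) (itg_powR_TA hTa)
  (fun A AF i => degenerate_TA (A := A) (i := i) AF) ps der gM.
rewrite beta_law (gamma_law hTa); congr (`|_| <= _).
rewrite opprD addrA; congr (_ - _).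
(* Both sums are brought to the range 1..k; [main_term] vanishes on the sets of size larger than
   p. *)
rewrite sum_by_card [RHS](big_nat_widen _ _ k.+1)// [RHS]big_mkcond; apply: eq_big_nat => j /andP[j0]; rewrite ltnS => jk.
rewrite ltnS /=; case: ifP => jp; last first.
  by apply: big1 => A /eqP Aj; rewrite /main_term Aj jp.
have s0 : 0 <= a / (a - 1) - 2.
  by case/andP: a12 => ? ?; rewrite subr_ge0 ler_pdivlMr; lra.
have q3 : a / (a - 1) <= 3.
  have : j%:R * (a / (a - 1) - 2) < 1 by rewrite -ps// j0.
  have : a / (a - 1) - 2 <= j%:R * (a / (a - 1) - 2) by rewrite ler_peMl// ler1n.
  by lra.
rewrite (kappa_law hTa a12 q3) ?j0// mulr_suml.
by apply: eq_bigr => A /eqP Aj; rewrite /main_term Aj jp.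
Qed.

End transfer.

(** * Complex-valued functions and the order of the expansion *)

Section cabs.
Context {R : realType}.
Implicit Types (z : R[i]) (h : R -> R[i]).

Lemma normr_Re_cabs z : `|complex.Re z| <= cabs z.
Proof. by rewrite -sqrtr_sqr ler_wsqrtr// lerDl sqr_ge0. Qed.

Lemma normr_Im_cabs z : `|complex.Im z| <= cabs z.
Proof. by rewrite -sqrtr_sqr ler_wsqrtr// lerDr sqr_ge0. Qed.

Lemma cabs_le z : cabs z <= `|complex.Re z| + `|complex.Im z|.
Proof.
rewrite -[leRHS]ger0_norm ?addr_ge0// -sqrtr_sqr ler_wsqrtr// sqrrD !real_normK ?num_real//.
by rewrite lerD2r lerDl mulrn_wge0// mulr_ge0.
Qed.

Lemma cabs_supnorm h x : cbounded h -> cabs (h x) <= supnorm h.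
Proof.
move=> [M hM]; apply: ub_le_sup; last by exists x.
by exists M => _ [y _ <-].
Qed.

Lemma supnorm_ge0 h : cbounded h -> 0 <= supnorm h.
Proof. by move=> hb; rewrite (le_trans _ (cabs_supnorm 0 hb))// sqrtr_ge0. Qed.

End cabs.

Lemma p_alpha_k_le {R : realType} (a : R) k : (p_alpha_k a k <= k)%N.
Proof.
rewrite /p_alpha_k big_nat_cond; apply: (big_ind (fun m => m <= k)%N) => //.
- by move=> x y xk yk; rewrite geq_max xk.
- by move=> j /andP[/andP[_]].
Qed.

Lemma p_alpha_k1 {R : realType} k : p_alpha_k (1 : R) k = 0%N.
Proof.
rewrite /p_alpha_k big_pred0// => j.
by rewrite subrr mul0r ltNge ler0n.
Qed.

(** As s = (2 - a) / (a - 1), the condition j s < 1 is the one defining p; it is inherited by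
    smaller j, so a comparison with the maximum decides it. *)
Lemma p_alpha_kP {R : realType} (a : R) k j : 1 < a < 2 -> (0 < j <= k)%N ->
  (j <= p_alpha_k a k)%N = (j%:R * (a / (a - 1) - 2) < 1).
Proof.
move=> /andP[a1 a2] /andP[j0 jk].
have a1' : 0 < a - 1 by rewrite subr_gt0.
have a2' : 0 < 2 - a by rewrite subr_gt0.
have E m : (m%:R * (a / (a - 1) - 2) < 1) = (m%:R < (a - 1) / (2 - a)).
  rewrite (_ : a / (a - 1) - 2 = (2 - a) / (a - 1)); last by field; rewrite gt_eqF.
  by rewrite mulrA ltr_pdivrMr// mul1r ltr_pdivlMr.
rewrite E; set b := (a - 1) / _; apply/idP/idP => [jp|jb]; last first.
  rewrite /p_alpha_k; apply: (@leq_bigmax_seq _ _ _ id _ _ jb).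
  by rewrite mem_index_iota.
(* The maximum is either the default 0 of an empty range or itself admissible. *)
have : p_alpha_k a k = 0%N \/ (p_alpha_k a k)%:R < b.
  rewrite /p_alpha_k; apply: (big_ind (fun m => m = 0%N \/ m%:R < b)).
  - by left.
  - by move=> x y; rewrite /maxn; case: ifP.
  - by move=> m mb; right.
case=> [p0|]; first by move: jp; rewrite p0 leqNgt j0.
by apply: le_lt_trans; rewrite ler_nat.
Qed.

Theorem theorem6 (R : realType) (k : nat) (alpha : R) :
  1 <= alpha < 2 ->
  exists c : R, 0 < c /\
  forall (n : nat) (hn : (0 < n)%N)
    (d : measure_display) (Omega : measurableType d) (P : probability Omega R)
    (X : 'I_n -> Omega -> R) (l : R -> R)
    (t : forall j : nat, j.-tuple R -> R) (f : R -> R[i]),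
  (* X_1, ..., X_n are i.i.d. random variables *)
  iid P X ->
  (* l and t_j are Borel, t_j symmetric *)
  measurable_fun setT l ->
  (forall j, (1 <= j <= k)%N -> measurable_fun setT (t j)) ->
  (forall j (s : j.-tuple R) (sg : 'I_j -> 'I_j), (1 <= j <= k)%N ->
     injective sg -> t j [tuple tnth s (sg i) | i < j] = t j s) ->
  (* E L_1 = 0 and n E L_1^2 = 1 *)
  P.-integrable setT (EFin \o Lv X l (Ordinal hn)) ->
  (\int[P]_w (Lv X l (Ordinal hn) w)%:E = 0)%E ->
  ((n%:R)%:E * \int[P]_w ((Lv X l (Ordinal hn) w) ^+ 2)%:E = 1)%E ->
  (* t_j(X_1..X_j) integrable and degenerate: E[t_j(X_1..X_j) | X_2..X_j] = 0 *)
  (forall j, (1 <= j <= k)%N -> (j <= n)%N ->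
     P.-integrable setT (EFin \o Tfirst X t j) /\
     cond_exp_zero P (sigma_2_to X j) (Tfirst X t j)) ->
  (* beta < oo *)
  (\int[P]_w (`|Lv X l (Ordinal hn) w| ^+ 3)%:E < +oo)%E ->
  (* gamma^(alpha) < oo *)
  (forall j, (1 <= j <= k)%N -> (j <= n)%N ->
     (\int[P]_w (powR `|Tfirst X t j w| alpha)%:E < +oo)%E) ->
  (* regularity of f *)
  (alpha = 1 -> cCn 3 f /\
     cbounded (cdern 1 f) /\ cbounded (cdern 2 f) /\ cbounded (cdern 3 f)) ->
  (1 < alpha -> cCn (k + 4) f /\
     forall j, (1 <= j <= k + 4)%N -> cbounded (cdern j f)) ->
  let C := if alpha == 1 then supnorm (cdern 1 f) + supnorm (cdern 3 f)
           else \sum_(1 <= j < k + 5) supnorm (cdern j f) in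
  let p := p_alpha_k alpha k in
  cabs (cint P setT (fun w => f (SS X l t k w))
        - cint lebesgue_measure setT
            (fun u => f u * Complex (derive1 (Np (kappa X l t k P) p) u) 0))
  <= c * C * (beta_ X l P (Ordinal hn) + gamma_ X t k P alpha).
Proof.
move=> /andP[a1 a2]; pose b : R := if alpha == 1 then 3 else expansion_cst k.
(* The factor 2 adds the bounds for the real and imaginary parts. *)
exists (2 * b); split.
  rewrite mulr_gt0// /b; case: ifP => _ //.
  by rewrite /expansion_cst /term_cst -addrA ltr_wpDr.
move=> n hn d Omega P X l t f iidX ml mt sym _ L1 L2 hT h3 hTa f1 f2; cbv zeta.
set C := (if _ then _ else _); set p := p_alpha_k alpha k.
have [Q [lawQ pQ permQ]] := law_exists iidX.
set B := _ + gamma_ _ _ _ _ _; set ka := kappa X l t k P.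
pose err (g : R -> R) := \int[P]_w g (SS X l t k w) -
  \int[lebesgue_measure]_x (g x * derive1 (Np ka p) x).
(* Stated for a real function dominated derivative by derivative by f, so that it serves both
   parts. *)
have part (g : R -> R) :
    (alpha = 1 -> rCn 3 g) -> (1 < alpha -> rCn (k + 4) g) ->
    (forall j x, `|dern j g x| <= cabs (cdern j f x)) ->
    `|err g| <= b * C * B.
  move=> g1 g2 gf; rewrite /err /b /C; case: eqVneq => [E|aN].
    have [_ [b1 [b2 b3]]] := f1 E.
    rewrite /p E p_alpha_k1 /B E; apply: (real_expansion1 lawQ pQ permQ ml mt sym L1 L2 hT h3 ka (g1 E)
      (M2 := supnorm (cdern 2 f))).
    - by move=> x; exact: (le_trans (gf 1%N x) (cabs_supnorm x b1)).
    - by move=> x; exact: (le_trans (gf 2%N x) (cabs_supnorm x b2)).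
    - by move=> x; exact: (le_trans (gf 3%N x) (cabs_supnorm x b3)).
    - by rewrite -E.
  have a1' : 1 < alpha by rewrite lt_def aN.
  have [_ fb] := f2 a1'.
  have a12 : 1 < alpha < 2 by rewrite a1'.
  apply: (real_expansion lawQ pQ permQ ml mt sym L1 L2 hT h3 a12 hTa (p_alpha_k_le _ _) _ (g2 a1')).
  - by move=> j jk; exact: p_alpha_kP.
  - move=> j jk x; apply: (le_trans (le_trans (gf j x) (cabs_supnorm x (fb j jk)))).
    have jk' : (1 <= j < k + 5)%N by clear -jk; lia.
    rewrite (bigD1_seq j) ?iota_uniq ?mem_index_iota//= lerDl big_nat_cond.
    by apply: sumr_ge0 => m mk; apply: supnorm_ge0; apply: fb; clear -mk; lia.
set z := cint _ _ _ - _.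
pose fRe (x : R) := complex.Re (f x); pose fIm (x : R) := complex.Im (f x).
have zRe : complex.Re z = err fRe.
  rewrite /z /cint; congr (_ - _); apply: eq_Rintegral => x _.
  by rewrite /fRe; case: (f x) => u v /=; rewrite mulr0 subr0.
have zIm : complex.Im z = err fIm.
  rewrite /z /cint; congr (_ - _); apply: eq_Rintegral => x _.
  by rewrite /fIm; case: (f x) => u v /=; rewrite mulr0 add0r.
have pRe : `|err fRe| <= b * C * B.
  exact: (part fRe (fun E => proj1 (proj1 (f1 E))) (fun E => proj1 (proj1 (f2 E)))
    (fun j x => normr_Re_cabs (cdern j f x))).
have pIm : `|err fIm| <= b * C * B.
  exact: (part fIm (fun E => proj2 (proj1 (f1 E))) (fun E => proj2 (proj1 (f2 E)))
    (fun j x => normr_Im_cabs (cdern j f x))).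
apply: le_trans (cabs_le z) _; rewrite zRe zIm.
apply: le_trans (lerD pRe pIm) _.
by rewrite -!mulrA mulr_natl mulr2n.
Qed.
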